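(* For $t\in[0,T)$ let $Q(t)=\lim_{n\to\infty}Q^n(t)$, where $Q^n$ is the first component of the solution of the Riccati equation given in the context, and put $$P=Q-\begin{bmatrix}0&0\\0&\gamma^{-1}\end{bmatrix}.$$ Then, for all $(t,x,y)\in[0,T)\times\mathbb R^d\times\mathbb R^d$, the value function $V$ of the liquidation problem (defined in the context) is given by $$V(t,x,y)=\frac12\begin{bmatrix}x^{\mathrm T}&y^{\mathrm T}\end{bmatrix}P(t)\begin{bmatrix}x\\ y\end{bmatrix},$$ and the optimal control is given in feedback form by $$\xi^*(t,x,y)=-\Lambda^{-1}\begin{bmatrix}-I_d&\gamma\end{bmatrix}Q(t)\begin{bmatrix}x\\ y\end{bmatrix}.$$
   Context: Setting: $T\in(0,\infty)$, $d\in\mathbb N$; $(\Omega,\mathcal F,(\mathcal F_t)_{t\in[0,T]},\mathbb P)$ is a filtered probability space carrying a one-dimensional standard Brownian motion $W$; $(\mathcal F_t)$ is the filtration generated by $W$ completed by the null sets and $\mathcal F=\mathcal F_T$. All equations and inequalities are understood $\mathbb P$-a.s. $\mathcal S^d$ (resp. $\mathcal S^d_+$) is the set of symmetric (resp. symmetric nonnegative definite) $d\times d$ real matrices, $I_d$ the identity. $L^2_{\mathcal F}(s,T;H)$ is the space of $H$-valued adapted processes on $[s,T]$ with $\mathbb E\int_s^T|f|^2dt<\infty$. $L^\infty_{\mathcal F}(\Omega;C([0,T];H))$ is the space of progressively measurable continuous processes with $\operatorname{ess\,sup}_\omega\max_t|f(t,\omega)|<\infty$. Data: $\Lambda\in\mathcal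 S^d$ positive definite; $\gamma=\mathrm{diag}(\gamma_i)$ positive definite diagonal with largest entry $\gamma_{\max}$; $\rho=\mathrm{diag}(\rho_i)$ and $\Sigma$ progressively measurable, essentially bounded $\mathcal S^d_+$-valued processes. Liquidation problem: for $\xi\in L^2_{\mathcal F}(t,T;\mathbb R^d)$ and initial state $X(t)=x$, $Y(t)=y$ let $dX(s)=-\xi(s)\,ds$, $dY(s)=\{-\rho(s)Y(s)+\gamma\xi(s)\}\,ds$, $s\in[t,T]$. Let $\mathcal A(t,x)$ be the set of all $\xi\in L^2_{\mathcal F}(t,T;\mathbb R^d)$ with $X(T)=0$ a.s. The value function is $$V(t,x,y)=\operatorname*{ess\,inf}_{\xi\in\mathcal A(t,x)}\mathbb E\Big[\int_t^T\tfrac12\xi(s)^{\mathrm T}\Lambda\xi(s)+Y(s)^{\mathrm T}\xi(s)+\tfrac12X(s)^{\mathrm T}\Sigma(s)X(s)\,ds\,\Big|\,\mathcal F_t\Big].$$ A feedback control means the process $\xi(s)=\xi^*(s,X(s),Y(s))$ along the resulting state process. Riccati equation: for $n\ge\gamma_{\max}$, $(Q^n,M^n)\in L^\infty_{\mathcal F}(\Omega;C([0,T];\mathcal S^{2d}_+))\times L^2_{\mathcal F}(0,T;\mathcal S^{2d})$ is the unique solution of $$\begin{aligned}-dQ(t)=&\Bigg\{-Q(t)\begin{bmatrix}-I_d\\ \gamma\end{bmatrix}\Lambda^{-1}\begin{bmatrix}-I_d&\gamma\end{bmatrix}Q(t)+Q(t)\begin{bmatrix}0&0\\0&-\rho(t)\end{bmatrix}+\begin{bmatrix}0&0\\0&-\rho(t)\end{bmatrix}Q(t)\\&\quad+\begin{bmatrix}\Sigma(t)&0\\0&\gamma^{-1}\rho(t)+\rho(t)\gamma^{-1}\end{bmatrix}\Bigg\}\,dt-M(t)\,dW(t),\qquad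 Q(T)=\begin{bmatrix}nI_d&I_d\\ I_d&\gamma^{-1}\end{bmatrix}.\end{aligned}$$ The limit $Q(t)=\lim_n Q^n(t)$ exists for every $t\in[0,T)$, the convergence being uniform on compact subintervals of $[0,T)$. *)

(* Defs.v *)
From HB Require Import structures.
From mathcomp Require Import all_boot all_order all_algebra.
From mathcomp Require Import all_classical all_reals all_analysis.
From mathcomp Require Import measurable_realfun.

Set Implicit Arguments.
Unset Strict Implicit.
Unset Printing Implicit Defensive.
Import Order.TTheory GRing.Theory Num.Theory.
Import numFieldNormedType.Exports.
Local Open Scope classical_set_scope.
Local Open Scope ring_scope.

Definition psdmx (R : realType) (m : nat) (A : 'M[R]_m) : Prop :=
  A^T = A /\ forall u : 'cV[R]_m, 0 <= (u^T *m A *m u) 0 0.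

Definition pdmx (R : realType) (m : nat) (A : 'M[R]_m) : Prop :=
  A^T = A /\ forall u : 'cV[R]_m, u != 0 -> 0 < (u^T *m A *m u) 0 0.

Section stochastic_analysis.
Context (R : realType) (disp : measure_display) (Omega : measurableType disp).
Variable P : probability Omega R.
Variable W : R -> Omega -> R.
Variable T : R.
Local Notation mu := (@lebesgue_measure R).

Definition filtration_gen (t : R) : set (set Omega) :=
  [set A | exists s, 0 <= s <= t /\
     exists2 B : set R, measurable B & A = W s @^-1` B]
  `|` [set A | P.-negligible A].

(* Omega with the sigma-algebra F_t = <<s filtration_gen t>>. *)
Definition filtered (t : R) := g_sigma_algebraType (filtration_gen t).

Definition increment (s t : R) (w : Omega) : R := W t w - W s w.

Definition is_brownian : Prop :=
  [/\ {ae P, forall w, W 0 w = 0},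
      {ae P, forall w, {within `[0, T], continuous (fun t => W t w)}},
      forall s t, 0 <= s -> s <= t -> t <= T ->
        forall (A : set Omega) (B : set R),
        <<s filtration_gen s>> A -> measurable B ->
        P (A `&` increment s t @^-1` B) = (P A * P (increment s t @^-1` B))%E
    & forall s t, 0 <= s -> s < t -> t <= T ->
        forall B : set R, measurable B ->
        P (increment s t @^-1` B) = normal_prob 0 (Num.sqrt (t - s)) B].

(* The sigma-algebra of Omega is F_T. *)
Definition full_filtration : Prop :=
  forall A : set Omega, measurable A <-> <<s filtration_gen T>> A.

Definition progressive (f : R -> Omega -> R) : Prop :=
  forall t, 0 <= t <= T ->
    measurable_fun (`[0, t] `*` [set: filtered t])
      (fun p : R * filtered t => f p.1 p.2).

Definition adapted (a b : R) (f : R -> Omega -> R) : Prop :=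
  forall s, a <= s <= b -> measurable_fun setT (f s : filtered s -> R).

Definition L2F (a b : R) (f : R -> Omega -> R) : Prop :=
  [/\ adapted a b f,
      measurable_fun (`[a, b] `*` [set: Omega])
        (fun p : R * Omega => f p.1 p.2)
    & (\int[P]_w \int[mu]_(s in `[a, b]) (f s w ^+ 2)%:E < +oo)%E].

Definition entrywise (S : (R -> Omega -> R) -> Prop) (m n : nat)
    (f : R -> Omega -> 'M[R]_(m, n)) : Prop :=
  forall i j, S (fun s w => f s w i j).

Definition continuous_paths (a b : R) (f : R -> Omega -> R) : Prop :=
  forall w, {within `[a, b], continuous (fun s => f s w)}.

(* Essentially bounded with respect to ds x dP on [0, T] x Omega. *)
Definition ess_bounded (f : R -> Omega -> R) : Prop :=
  exists K : R, {ae (mu \x P)%E, forall p : R * Omega,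
    0 <= p.1 <= T -> `|f p.1 p.2| <= K}.

(* ess sup_w max_[0, T] |f| < oo, with a single null set for all times. *)
Definition ess_bounded_paths (f : R -> Omega -> R) : Prop :=
  exists K : R, {ae P, forall w, forall t, 0 <= t <= T -> `|f t w| <= K}.

(* Data (tau_j, phi_j) of the simple adapted integrand
   sum_(j < m) phi_j 1_(tau_j, tau_(j+1)] on [a, b]. *)
Definition simple_data (a b : R) (m : nat) (tau : nat -> R)
    (phi : nat -> Omega -> R) : Prop :=
  [/\ forall j, (j <= m)%N -> a <= tau j <= b,
      forall j, (j < m)%N -> tau j <= tau j.+1
    & forall j, (j < m)%N ->
        measurable_fun setT (phi j : filtered (tau j) -> R) /\
        exists K : R, forall w, `|phi j w| <= K].

Definition simple_process (m : nat) (tau : nat -> R)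
    (phi : nat -> Omega -> R) (s : R) (w : Omega) : R :=
  \sum_(j < m) phi j w * \1_(`]tau j, tau j.+1]) s.

Definition simple_integral (m : nat) (tau : nat -> R)
    (phi : nat -> Omega -> R) (w : Omega) : R :=
  \sum_(j < m) phi j w * increment (tau j) (tau j.+1) w.

(* I is a version of the Ito integral of f over [a, b] against W: the L^2
   limit of the integrals of simple processes approximating f in L^2. *)
Definition is_ito_integral (a b : R) (f : R -> Omega -> R)
    (I : Omega -> R) : Prop :=
  measurable_fun setT I /\
  exists (m : nat -> nat) (tau : nat -> nat -> R)
         (phi : nat -> nat -> Omega -> R),
  [/\ forall k, simple_data a b (m k) (tau k) (phi k),
      (\int[P]_w \int[mu]_(s in `[a, b])
         ((f s w - simple_process (m k) (tau k) (phi k) s w) ^+ 2)%:E)%E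
        @[k --> \oo] --> 0%E
    & (\int[P]_w
         ((I w - simple_integral (m k) (tau k) (phi k) w) ^+ 2)%:E)%E
        @[k --> \oo] --> 0%E].

(* J is a version of E[Z | F_t]. *)
Definition is_cond_exp (t : R) (Z J : Omega -> R) : Prop :=
  [/\ P.-integrable setT (EFin \o Z),
      P.-integrable setT (EFin \o J),
      measurable_fun setT (J : filtered t -> R)
    & forall A : set Omega, <<s filtration_gen t>> A ->
        (\int[P]_(w in A) (J w)%:E = \int[P]_(w in A) (Z w)%:E)%E].

(* V is a version of the essential infimum of the family S. *)
Definition is_ess_inf (S : set (Omega -> R)) (V : Omega -> \bar R) : Prop :=
  [/\ measurable_fun [set: Omega] V,
      forall J, S J -> {ae P, forall w, (V w <= (J w)%:E)%E}
    & forall U : Omega -> \bar R, measurable_fun [set: Omega] U ->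
        (forall J, S J -> {ae P, forall w, (U w <= (J w)%:E)%E}) ->
        {ae P, forall w, (U w <= V w)%E}].

Section liquidation.
Variable d : nat.
Variables (Lambda : 'M[R]_d) (gamma : 'rV[R]_d).
Variables (rho : R -> Omega -> 'rV[R]_d) (Sigma : R -> Omega -> 'M[R]_d).
Local Notation G := (diag_mx gamma).

Definition is_position (t : R) (x : 'cV[R]_d) (xi X : R -> Omega -> 'cV[R]_d)
    : Prop :=
  [/\ entrywise (adapted t T) X, entrywise (continuous_paths t T) X
    & {ae P, forall w, forall s, t <= s <= T -> forall i,
        mu.-integrable `[t, s] (fun u => (xi u w i 0)%:E) /\
        X s w i 0 = x i 0 - \int[mu]_(u in `[t, s]) xi u w i 0}].

Definition impact_drift (xi Y : R -> Omega -> 'cV[R]_d) (u : R) (w : Omega)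
    : 'cV[R]_d :=
  - (diag_mx (rho u w) *m Y u w) + G *m xi u w.

Definition is_impact (t : R) (y : 'cV[R]_d) (xi Y : R -> Omega -> 'cV[R]_d)
    : Prop :=
  [/\ entrywise (adapted t T) Y, entrywise (continuous_paths t T) Y
    & {ae P, forall w, forall s, t <= s <= T -> forall i,
        mu.-integrable `[t, s] (fun u => (impact_drift xi Y u w i 0)%:E) /\
        Y s w i 0
        = y i 0 + \int[mu]_(u in `[t, s]) impact_drift xi Y u w i 0}].

Definition admissible (t : R) (x : 'cV[R]_d) (xi : R -> Omega -> 'cV[R]_d)
    : Prop :=
  entrywise (L2F t T) xi /\
  exists2 X, is_position t x xi X & {ae P, forall w, X T w = 0}.

Definition running_cost (xi X Y : R -> Omega -> 'cV[R]_d) (s : R) (w : Omega)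
    : R :=
  (2^-1 *: ((xi s w)^T *m Lambda *m xi s w) + (Y s w)^T *m xi s w
   + 2^-1 *: ((X s w)^T *m Sigma s w *m X s w)) 0 0.

(* J is a version of the conditional expected cost, given F_t, of xi. *)
Definition is_cost (t : R) (x y : 'cV[R]_d) (xi : R -> Omega -> 'cV[R]_d)
    (J : Omega -> R) : Prop :=
  exists X Y, [/\ is_position t x xi X, is_impact t y xi Y
    & is_cond_exp t
        (fun w => \int[mu]_(s in `[t, T]) running_cost xi X Y s w) J].

Definition costs (t : R) (x y : 'cV[R]_d) : set (Omega -> R) :=
  [set J | exists2 xi, admissible t x xi & is_cost t x y xi J].

(* V is a version of the value function at (t, x, y). *)
Definition is_value (t : R) (x y : 'cV[R]_d) (V : Omega -> R) : Prop :=
  is_ess_inf (costs t x y) (EFin \o V).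

Definition is_optimal (t : R) (x y : 'cV[R]_d) (xi : R -> Omega -> 'cV[R]_d)
    : Prop :=
  admissible t x xi /\
  exists2 J, is_cost t x y xi J & is_value t x y J.

Definition gamma_max : R := \big[Num.max/0]_(i < d) gamma 0 i.

Definition riccati_drift (rho_ : 'rV[R]_d) (Sigma_ : 'M[R]_d)
    (Q : 'M[R]_(d + d)) : 'M[R]_(d + d) :=
  let r := diag_mx rho_ in
  - (Q *m col_mx (- 1%:M) G *m invmx Lambda *m row_mx (- 1%:M) G *m Q)
  + Q *m block_mx 0 0 0 (- r) + block_mx 0 0 0 (- r) *m Q
  + block_mx Sigma_ 0 0 (invmx G *m r + r *m invmx G).

Definition riccati_terminal (n : nat) : 'M[R]_(d + d) :=
  block_mx n%:R%:M 1%:M 1%:M (invmx G).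

Definition riccati_solution (n : nat) (Q M : R -> Omega -> 'M[R]_(d + d))
    : Prop :=
  [/\ [/\ entrywise progressive Q, entrywise (continuous_paths 0 T) Q,
          entrywise ess_bounded_paths Q
        & forall t w, 0 <= t <= T -> psdmx (Q t w)],
      entrywise (L2F 0 T) M /\ (forall t w, 0 <= t <= T -> (M t w)^T = M t w),
      {ae P, forall w, Q T w = riccati_terminal n}
    & forall t, 0 <= t <= T -> forall i j,
        exists2 I, is_ito_integral t T (fun s w => M s w i j) I
        & {ae P, forall w,
            mu.-integrable `[t, T]
              (fun s => (riccati_drift (rho s w) (Sigma s w) (Q s w) i j)%:E) /\
            Q t w i j = Q T w i j
              + \int[mu]_(s in `[t, T])
                  riccati_drift (rho s w) (Sigma s w) (Q s w) i j
              - I w}].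

Definition is_riccati_limit (Qn : nat -> R -> Omega -> 'M[R]_(d + d))
    (Q : R -> Omega -> 'M[R]_(d + d)) : Prop :=
  {ae P, forall w, forall tau : R, 0 <= tau < T -> forall i j,
    {uniform `[0, tau], (fun n (s : R) => Qn n s w i j) @ \oo -->
       (fun s : R => Q s w i j)}}.

Definition value_form (Q : 'M[R]_(d + d)) (x y : 'cV[R]_d) : R :=
  let P_ := Q - block_mx 0 0 0 (invmx G) in
  2^-1 * (row_mx x^T y^T *m P_ *m col_mx x y) 0 0.

Definition feedback (Q : 'M[R]_(d + d)) (x y : 'cV[R]_d) : 'cV[R]_d :=
  - (invmx Lambda *m row_mx (- 1%:M) G *m Q *m col_mx x y).

End liquidation.
End stochastic_analysis.

(* Main.v *)
Require Import Defs.
From mathcomp Require Import all_boot all_order all_algebra.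
From mathcomp Require Import all_classical all_reals all_analysis.
From mathcomp Require Import measurable_realfun ring lra.
Set Implicit Arguments.
Unset Strict Implicit.
Unset Printing Implicit Defensive.
Import Order.TTheory GRing.Theory Num.Theory.
Import numFieldNormedType.Exports.
Local Open Scope classical_set_scope.
Local Open Scope ring_scope.

(** The terminal constraint is replaced by a penalty: with the terminal value
    Q^n(T), the Riccati equation solves the problem in which X(T) is free and a
    remaining position is charged a quadratic price that grows like n |X(T)|^2.
    The value of this problem increases to the value of the liquidation
    problem, and its optimal states converge to the optimal state.

    Everything rests on one identity. The Riccati drift is the one for which the
    derivative of z^T Q z along the state equation is a complete square up to
    the cost ([square_completion]), so that, for every control and every
    n at least the largest entry of gamma,

      E[z(T)^T Q^n(T) z(T); A] + 2 E[accumulated cost; A]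
        = E[z(t)^T Q^n(t) z(t); A] + E[squared deviation from the n-th law; A]

    for all events A of F_t ([verification]). Here the cost is not the running
    cost, which is indefinite, but a nonnegative one that differs from it by the
    time derivative of the energy (1/2) Y^T gamma^-1 Y stored in the impact
    ([running_costE]). When X(T) = 0 the terminal term cancels the stored
    energy, and the conditional cost of an admissible control is the value form
    of Q^n(t) plus half the deviation ([admissible_cost]).

    The stochastic part of the identity is small. The states have absolutely
    continuous paths, so the product of a bounded Ito process with them obeys a
    product rule that comes from pathwise integration by parts and Fubini's
    theorem ([product_rule]), once an Ito integral over [u, T] is known to be
    orthogonal to F_u ([ito_mean0]).

    For the limit, the n-th feedback law is realised by a linear differential
    equation with bounded random coefficients ([linear_ode],
    [feedback_control]). The identity, applied to the optimal control of the
    m-th problem in the n-th one, shows that the values increase with n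
    ([riccati_compare]); liquidation at constant speed bounds them
    ([reference_control], [riccati_value_bounded]). Applied to the difference of
    two optimal states, which starts at zero, it bounds the squared distance of
    their controls in L^2 by the difference of the values ([feedback_dist]).
    Along a subsequence on which the values converge fast, the controls
    therefore converge for almost every path, and the states uniformly
    ([ae_convergent]). The limit solves the state equation ([limit_dynamics]),
    follows the feedback law of Q = lim Q^n by construction, and liquidates
    because the penalties stay bounded ([limit_liquidates]).

    Finally, no admissible control costs less than the value form of any
    Q^n(t), hence of Q(t) ([value_le_cost]); the limit control deviates from the
    n-th law by no more than what is left for the values to grow ([limit_gap]),
    so that its cost is exactly the value form of Q(t) ([value_eq_cost]).
    Conversely the deviations of an optimal control from the n-th laws tend to
    zero, and Fatou's lemma leaves it no choice but the feedback law of Q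
    ([optimal_feedback]). *)

(** * Integrable real-valued functions *)

Notation L1 mu D f := (integrable mu D (EFin \o f)) (only parsing).

Section integrable_real.
Context d (X : measurableType d) (R : realType).
Variables (mu : {measure set X -> \bar R}) (D : set X).
Hypothesis mD : measurable D.
Implicit Types f g : X -> R.

Lemma L1_measurable f : L1 mu D f -> measurable_fun D f.
Proof. by move/measurable_int/measurable_EFinP. Qed.

Lemma L1D f g : L1 mu D f -> L1 mu D g -> L1 mu D (fun x => f x + g x).
Proof. by move=> hf hg; exact: (integrableD mD hf hg). Qed.

Lemma L1N f : L1 mu D f -> L1 mu D (fun x => - f x).
Proof. by move=> hf; exact: (integrableN hf). Qed.

Lemma L1B f g : L1 mu D f -> L1 mu D g -> L1 mu D (fun x => f x - g x).
Proof. by move=> hf hg; exact: (integrableB mD hf hg). Qed.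

Lemma L1Z k f : L1 mu D f -> L1 mu D (fun x => k * f x).
Proof. by move=> hf; exact: (integrableZl mD k hf). Qed.

Lemma L1_0 : L1 mu D (fun=> 0).
Proof. exact: integrable0. Qed.

Lemma L1_sum I (s : seq I) (h : I -> X -> R) :
  (forall i, L1 mu D (h i)) -> L1 mu D (fun x => \sum_(i <- s) h i x).
Proof.
move=> hh; elim: s => [|i s ih].
  apply: eq_integrable L1_0 => // x _ /=; by rewrite big_nil.
apply: eq_integrable (L1D (hh i) ih) => // x _ /=; by rewrite big_cons.
Qed.

Lemma L1_norm f : L1 mu D f -> L1 mu D (fun x => `|f x|).
Proof. by move/integrable_norm. Qed.

Lemma L1_le f g : measurable_fun D f -> (forall x, D x -> `|f x| <= g x) ->
  L1 mu D g -> L1 mu D f.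
Proof.
move=> mf fg; apply: le_integrable => //; first exact/measurable_EFinP.
move=> x Dx /=; rewrite lee_fin (le_trans (fg x Dx))//; exact: ler_norm.
Qed.

Lemma L1_le_ae f g : measurable_fun D f ->
  {ae mu, forall x, D x -> `|f x| <= g x} -> L1 mu D g -> L1 mu D f.
Proof.
move=> mf fg hg; apply/integrableP; split; first exact/measurable_EFinP.
have /integrableP[_] := L1_norm hg; apply: le_lt_trans.
have mg := L1_measurable hg.
apply: ae_ge0_le_integral => //.
- by apply: measurableT_comp => //; exact/measurable_EFinP.
- apply: measurableT_comp => //; apply/measurable_EFinP.
  exact: measurableT_comp.
apply: filterS fg => x h Dx /=; rewrite lee_fin (le_trans (h Dx))//.
by rewrite (le_trans (ler_norm _))// ler_norm.
Qed.

Lemma L1_eq_ae f g : measurable_fun D g ->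
  {ae mu, forall x, D x -> f x = g x} -> L1 mu D f -> L1 mu D g.
Proof.
move=> mg fg hf; apply: L1_le_ae mg _ (L1_norm hf).
by apply: filterS fg => x h Dx; rewrite (h Dx).
Qed.

Lemma Rint_eq_ae f g : measurable_fun D f -> measurable_fun D g ->
  {ae mu, forall x, D x -> f x = g x} ->
  \int[mu]_(x in D) f x = \int[mu]_(x in D) g x.
Proof.
move=> mf mg fg; congr fine; apply: ae_eq_integral => //.
- exact/measurable_EFinP.
- exact/measurable_EFinP.
- by apply: filterS fg => x h Dx /=; rewrite (h Dx).
Qed.

Lemma RintE f : L1 mu D f ->
  (\int[mu]_(x in D) (f x)%:E = (\int[mu]_(x in D) f x)%R%:E)%E.
Proof. by move=> hf; rewrite /Rintegral fineK//; exact: integrable_fin_num. Qed.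

Lemma RintN f : L1 mu D f ->
  \int[mu]_(x in D) (- f x) = - \int[mu]_(x in D) f x.
Proof.
move=> hf; rewrite -mulN1r -RintegralZl//.
by apply: eq_Rintegral => x _; rewrite mulN1r.
Qed.

Lemma Rint_sum I (s : seq I) (h : I -> X -> R) :
  (forall i, L1 mu D (h i)) ->
  \int[mu]_(x in D) (\sum_(i <- s) h i x)
  = \sum_(i <- s) \int[mu]_(x in D) h i x.
Proof.
move=> hh; elim: s => [|i s ih].
  rewrite big_nil (@eq_Rintegral _ _ _ mu D (fun=> 0)); first by rewrite Rintegral_cst// mul0r.
  by move=> x _; rewrite big_nil.
rewrite big_cons -ih -RintegralD//; last exact: L1_sum.
by apply: eq_Rintegral => x _; rewrite big_cons.
Qed.

Lemma Rint_le_ae f g : L1 mu D f -> L1 mu D g ->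
  {ae mu, forall x, D x -> f x <= g x} ->
  \int[mu]_(x in D) f x <= \int[mu]_(x in D) g x.
Proof.
move=> hf hg fg; rewrite -subr_ge0 -RintegralB//.
pose h x := Num.max 0 (g x - f x).
have mgf : measurable_fun D (fun x => g x - f x).
  by apply: measurable_funB; exact: L1_measurable.
rewrite (@Rint_eq_ae _ h) //.
- by apply: Rintegral_ge0 => x _; rewrite /h le_max lexx.
- exact: measurable_maxr.
apply: filterS fg => x h' Dx; rewrite /h; apply/esym/max_idPr.
by rewrite subr_ge0 h'.
Qed.

Lemma L1_mulb f g K : L1 mu D f -> measurable_fun D g ->
  {ae mu, forall x, D x -> `|g x| <= K} -> L1 mu D (fun x => g x * f x).
Proof.
move=> hf mg gK; apply: (L1_le_ae _ _ (L1Z K (L1_norm hf))).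
  by apply: measurable_funM => //; exact: L1_measurable hf.
by apply: filterS gK => x h Dx; rewrite normrM ler_wpM2r// h.
Qed.

Lemma L1_sqrM f g : measurable_fun D f -> measurable_fun D g ->
  L1 mu D (fun x => f x ^+ 2) -> L1 mu D (fun x => g x ^+ 2) ->
  L1 mu D (fun x => f x * g x).
Proof.
move=> mf mg hf hg; apply: L1_le (L1D hf hg); first exact: measurable_funM.
move=> x _; rewrite normrM -(real_normK (num_real (f x))).
rewrite -(real_normK (num_real (g x))).
have := sqr_ge0 (`|f x| - `|g x|); have := mulr_ge0 (normr_ge0 (f x)) (normr_ge0 (g x)).
by rewrite !expr2; nra.
Qed.

Lemma L1_sqrD f g : measurable_fun D f -> measurable_fun D g ->
  L1 mu D (fun x => f x ^+ 2) -> L1 mu D (fun x => g x ^+ 2) ->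
  L1 mu D (fun x => (f x + g x) ^+ 2).
Proof.
move=> mf mg hf hg; apply: L1_le (L1Z 2 (L1D hf hg)).
  by apply: measurable_funX; exact: measurable_funD.
move=> x _; rewrite ger0_norm ?sqr_ge0//.
by have := sqr_ge0 (f x - g x); rewrite !expr2; nra.
Qed.

Lemma Rint0_ae f : L1 mu D f -> (forall x, D x -> 0 <= f x) ->
  \int[mu]_(x in D) f x <= 0 -> {ae mu, forall x, D x -> f x = 0}.
Proof.
move=> hf f0 If.
have If0 : \int[mu]_(x in D) f x = 0.
  by apply/eqP; rewrite eq_le If Rintegral_ge0.
have /(ae_eq_integral_abs mu mD) : measurable_fun D (EFin \o f).
  exact: measurable_int hf.
case=> /(_ _) h _; have /h : (\int[mu]_(x in D) `|(EFin \o f) x| = 0)%E.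
  rewrite -[RHS]/(0%:E) -If0 -RintE//; apply: eq_integral => x /set_mem Dx /=.
  by rewrite ger0_norm// f0.
by apply: filterS => x /= h' Dx; have [] := h' Dx.
Qed.

(** Convergence is only assumed almost everywhere, so the measurability of the
    limit has to be a hypothesis; the integrals are compared with a convergent
    sequence of bounds instead of having limits themselves. *)
Lemma Rfatou (f_ : nat -> X -> R) f (c_ : nat -> R) c :
  (forall n, L1 mu D (f_ n)) -> (forall n x, D x -> 0 <= f_ n x) ->
  measurable_fun D f -> (forall x, D x -> 0 <= f x) ->
  {ae mu, forall x, D x -> f_ n x @[n --> \oo] --> f x} ->
  (forall n, \int[mu]_(x in D) f_ n x <= c_ n) -> c_ n @[n --> \oo] --> c ->
  L1 mu D f /\ \int[mu]_(x in D) f x <= c.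
Proof.
move=> hf_ f_0 mf f0 ff Ic cc.
have mf_ n : measurable_fun D (EFin \o f_ n) by exact: measurable_int (hf_ n).
have key : (\int[mu]_(x in D) (f x)%:E <= c%:E)%E.
  (* only the limit function is known to be measurable, so the integral of f is
     compared with that of the suprema of the tail infima *)
  apply: (@le_trans _ _ (\int[mu]_(x in D) limn_einf (fun n => (f_ n x)%:E))%E).
    apply: ae_ge0_le_integral => //.
    - exact/measurable_EFinP.
    - move=> x Dx; rewrite limn_einf_lim; apply: lime_ge.
        exact: is_cvg_einfs.
      apply: nearW => n; apply: le_ereal_inf_tmp => _ [k /= nk <-].
      by rewrite lee_fin f_0.
    - rewrite (_ : (fun x => _) = fun x => - limn_esup (fun n => - (f_ n x)%:E))%E//.
      apply: measurableT_comp => //; apply: measurable_fun_limn_esup => n.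
      by apply: measurableT_comp => //; exact: mf_.
    apply: filterS ff => x h Dx.
    have /cvg_limn_einf_sup[-> _] // : (f_ n x)%:E @[n --> \oo] --> (f x)%:E.
    by apply: cvg_EFin; [exact: nearW|exact: h].
  apply: le_trans.
    by apply: (fatou mu mD mf_) => n x Dx; rewrite lee_fin f_0.
  have /cvg_limn_einf_sup[<- _] : (c_ n)%:E @[n --> \oo] --> c%:E.
    by apply: cvg_EFin; [exact: nearW|exact: cc].
  rewrite !limn_einf_lim; apply: lee_lim; [exact: is_cvg_einfs|exact: is_cvg_einfs|].
  apply: nearW => n; apply: le_ereal_inf_tmp => _ [k /= nk <-].
  apply: (@le_trans _ _ (\int[mu]_(x in D) (f_ k x)%:E)%E).
    by apply: ereal_inf_lbound; exists k.
  by rewrite RintE// lee_fin.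
have hf : L1 mu D f.
  apply/integrableP; split; first exact/measurable_EFinP.
  rewrite (eq_integral (fun x => (f x)%:E)); last first.
    by move=> x /set_mem Dx /=; rewrite ger0_norm// f0.
  exact: le_lt_trans key (ltry _).
by split=> //; rewrite -lee_fin -RintE.
Qed.

End integrable_real.

Lemma L1_cst d (X : measurableType d) (R : realType)
    (mu : {measure set X -> \bar R}) (D : set X) (k : R) :
  measurable D -> (mu D < +oo)%E -> L1 mu D (fun=> k).
Proof.
move=> mD muD; apply: measurable_bounded_integrable => //.
by exists `|k|; split; [exact: num_real|move=> M kM x _ /=; exact: ltW].
Qed.

(** On a space of finite measure, a bound almost everywhere suffices. *)
Lemma L1_bounded d (X : measurableType d) (R : realType)
    (mu : {measure set X -> \bar R}) (D : set X) (f : X -> R) (K : R) :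
  measurable D -> (mu D < +oo)%E -> measurable_fun D f ->
  {ae mu, forall x, D x -> `|f x| <= K} -> L1 mu D f.
Proof. by move=> mD muD mf fK; exact: (L1_le_ae mD mf fK (L1_cst K mD muD)). Qed.

(** * Fubini's theorem and absolutely continuous functions *)

Section fubini_rectangle.
Context d1 d2 (X : measurableType d1) (Y : measurableType d2) (R : realType).
Variable m1 : {sigma_finite_measure set X -> \bar R}.
Variable m2 : {sigma_finite_measure set Y -> \bar R}.
Variables (D : set X) (A : set Y).
Hypotheses (mD : measurable D) (mA : measurable A).
Variable f : X -> Y -> R.
Hypothesis hf : L1 (m1 \x m2)%E (D `*` A) (fun p => f p.1 p.2).

Let mDA : measurable (D `*` A). Proof. exact: measurableX. Qed.

Let g := (EFin \o (fun p : X * Y => f p.1 p.2)) \_ (D `*` A).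

Let hg : integrable (m1 \x m2)%E setT g.
Proof. exact: ((integrable_mkcond _ mDA).1 hf). Qed.

Let gE1 x : D x -> (fun y => g (x, y)) = (EFin \o f x) \_ A.
Proof.
move=> Dx; apply/funext => y; rewrite /g !patchE /=.
by have [Ay|nAy] := pselect (A y); [rewrite !mem_set|
  rewrite !memNset//= => -[]].
Qed.

Let gE1N x : ~ D x -> (fun y => g (x, y)) = fun=> 0%E.
Proof.
by move=> nDx; apply/funext => y; rewrite /g !patchE /= memNset//= => -[].
Qed.

Let gE2 y : A y -> (fun x => g (x, y)) = (EFin \o f^~ y) \_ D.
Proof.
move=> Ay; apply/funext => x; rewrite /g !patchE /=.
by have [Dx|nDx] := pselect (D x); [rewrite !mem_set|
  rewrite !memNset//= => -[]].
Qed.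

Let gE2N y : ~ A y -> (fun x => g (x, y)) = fun=> 0%E.
Proof.
by move=> nAy; apply/funext => x; rewrite /g !patchE /= memNset//= => -[].
Qed.

Lemma fubini_ae1 : {ae m1, forall x, D x -> L1 m2 A (f x)}.
Proof.
have := ae_integrable1 hg; apply: filterS => x h Dx.
by apply/(integrable_mkcond _ mA); rewrite -gE1.
Qed.

Lemma fubini_ae2 : {ae m2, forall y, A y -> L1 m1 D (f^~ y)}.
Proof.
have := ae_integrable2 hg; apply: filterS => y h Ay.
by apply/(integrable_mkcond _ mD); rewrite -gE2.
Qed.

Let F1 : fubini_F m2 g = (fun x => \int[m2]_(y in A) (f x y)%:E)%E \_ D.
Proof.
apply/funext => x; rewrite /fubini_F patchE; case: ifPn => [/set_mem Dx|/negP nDx].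
  by rewrite gE1// -integral_mkcond.
by rewrite gE1N ?integral0// => Dx; apply/nDx/mem_set.
Qed.

Let F2 : fubini_G m1 g = (fun y => \int[m1]_(x in D) (f x y)%:E)%E \_ A.
Proof.
apply/funext => y; rewrite /fubini_G patchE; case: ifPn => [/set_mem Ay|/negP nAy].
  by rewrite gE2// -integral_mkcond.
by rewrite gE2N ?integral0// => Dx; apply/nAy/mem_set.
Qed.

Let iF1 : integrable m1 D (fun x => \int[m2]_(y in A) (f x y)%:E)%E.
Proof. by apply/(integrable_mkcond _ mD); rewrite -F1; exact: integrable_fubini_F. Qed.

Let swapG : integrable m2 setT (fubini_G m1 g).
Proof.
apply/integrableP; split; first exact: measurable_fubini_G hg.
have := (integrable21ltyP _ _ (measurable_int _ hg)).1 hg.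
apply: le_lt_trans; apply: ge0_le_integral => //.
- by apply: measurableT_comp => //; exact: measurable_fubini_G hg.
- apply: (measurable_fun_fubini_tonelli_G (abse \o g)) => //.
    by apply: measurableT_comp => //; exact: measurable_int hg.
  by move=> ? /=; exact: abse_ge0.
- move=> y _; apply: le_abse_integral => //.
  by apply: measurableT_comp (measurable_int _ hg) _ => //; exact: measurable_pair2.
Qed.

Let iF2 : integrable m2 A (fun y => \int[m1]_(x in D) (f x y)%:E)%E.
Proof. by apply/(integrable_mkcond _ mA); rewrite -F2. Qed.

Let fineI d (Z : measurableType d) (m : {measure set Z -> \bar R}) (B : set Z)
    (h : Z -> \bar R) : measurable B -> integrable m B h ->
  L1 m B (fine \o h) /\ (\int[m]_(z in B) h z)%E = (\int[m]_(z in B) fine (h z))%:E.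
Proof.
move=> mB hh.
have e : {ae m, forall z, B z -> (EFin \o (fine \o h)) z = h z}.
  have := integrable_ae mB hh; apply: filterS => z hz Bz /=.
  by rewrite fineK//; exact: hz.
have mh := measurable_int _ hh.
have mfh : measurable_fun B (EFin \o (fine \o h)).
  by apply/measurable_EFinP; apply: measurableT_comp.
have ih : L1 m B (fine \o h).
  apply/integrableP; split=> //; have /integrableP[_] := hh.
  apply: le_lt_trans; apply: ae_ge0_le_integral => //.
  - exact: measurableT_comp.
  - exact: measurableT_comp.
  by apply: filterS e => z hz Bz; rewrite hz.
split=> //; rewrite -RintE//; apply: ae_eq_integral => //.
by apply: filterS e => z hz Bz; rewrite -(hz Bz).
Qed.

Lemma fubini_L1_1 : L1 m1 D (fun x => \int[m2]_(y in A) f x y).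
Proof. by have [] := fineI mD iF1. Qed.

Lemma fubini_L1_2 : L1 m2 A (fun y => \int[m1]_(x in D) f x y).
Proof. by have [] := fineI mA iF2. Qed.

Lemma fubini_Rint1 : \int[m1]_(x in D) \int[m2]_(y in A) f x y =
  \int[(m1 \x m2)%E]_(p in D `*` A) f p.1 p.2.
Proof.
have [_ e] := fineI mD iF1.
apply: EFin_inj; rewrite -e -(RintE mDA hf).
rewrite [RHS]integral_mkcond -/g -(integral12_prod_meas1 hg).
by rewrite integral_mkcond -F1.
Qed.

Lemma fubini_Rint2 : \int[m2]_(y in A) \int[m1]_(x in D) f x y =
  \int[(m1 \x m2)%E]_(p in D `*` A) f p.1 p.2.
Proof.
have [_ e] := fineI mA iF2.
apply: EFin_inj; rewrite -e -(RintE mDA hf).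
rewrite [RHS]integral_mkcond -/g -(integral21_prod_meas1 hg).
by rewrite integral_mkcond -F2.
Qed.

End fubini_rectangle.

(** The integral is that of the positive part minus that of the negative part,
    both of which are measurable by Tonelli's theorem. *)
Lemma measurable_Rint_section d1 d2 (X : measurableType d1)
    (Y : measurableType d2) (R : realType)
    (m : {sigma_finite_measure set X -> \bar R}) (D : set X) (f : X -> Y -> R) :
  measurable D -> measurable_fun (D `*` setT) (fun p : X * Y => f p.1 p.2) ->
  measurable_fun setT (fun y => \int[m]_(x in D) f x y).
Proof.
move=> mD mf.
pose g := (EFin \o (fun p : X * Y => f p.1 p.2)) \_ (D `*` setT).
have mg : measurable_fun setT g.
  apply/(measurable_restrictT _ (measurableX mD measurableT)).
  exact/measurable_EFinP.
rewrite (_ : (fun y => _) = fine \o (fun y => \int[m]_x g^\+ (x, y)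
    - \int[m]_x g^\- (x, y))%E).
  apply: measurableT_comp => //; apply: emeasurable_funB.
  - apply: (measurable_fun_fubini_tonelli_G g^\+%E) => //.
    exact: measurable_funepos.
  - apply: (measurable_fun_fubini_tonelli_G g^\-%E) => //.
    exact: measurable_funeneg.
apply/funext => y; rewrite /Rintegral /= integral_mkcond [in LHS]integralE.
by congr (fine (_ - _)); apply: eq_integral => x _;
  rewrite ?funeposE ?funenegE /g !patchE /=;
  (have [Dx|nDx] := pselect (D x); [rewrite !mem_set|rewrite !memNset//= => -[]]).
Qed.

(** A process with continuous paths is jointly measurable: it is the limit of
    its step approximations along a grid. *)
Lemma measurable_caratheodory d' (X : measurableType d') (R : realType)
    (a b : R) (f : R -> X -> R) : a <= b ->
  (forall u, a <= u <= b -> measurable_fun setT (f u)) ->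
  (forall w, {within `[a, b], continuous (fun u => f u w)}) ->
  measurable_fun (`[a, b] `*` setT) (fun p : measurableTypeR R * X => f p.1 p.2).
Proof.
move=> ab mf cf.
have mD : measurable (`[a, b] `*` [set: X] : set (measurableTypeR R * X)).
  exact: measurableX.
have [ltab|] := ltP a b; last first.
  move=> ba; have {ba ab} ab : b = a by apply/eqP; rewrite eq_le ba ab.
  apply: (@eq_measurable_fun _ _ _ _ _ (fun p : measurableTypeR R * X => f a p.2)).
    move=> [u w] /set_mem [/= + _]; rewrite ab in_itv/= => /andP[au ua].
    by have -> : u = a by apply/eqP; rewrite eq_le au ua.
  apply: measurable_funTS; apply: measurableT_comp => //.
  by apply: mf; rewrite lexx ab lexx.
pose h n := (b - a) / n.+1%:R.
have h0 n : 0 < h n by rewrite divr_gt0// subr_gt0.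
pose J n k := `[a + h n * k%:R, a + h n * k.+1%:R[%classic : set R.
pose F n (p : measurableTypeR R * X) := \sum_(k < n.+2)
  \1_(J n k) p.1 * f (Num.min b (a + h n * k%:R)) p.2.
apply: (@measurable_fun_cvg _ _ _ _ F).
  move=> n; apply: measurable_sum => k; apply: measurable_funM.
    apply: measurable_funTS; apply: measurableT_comp => //.
    by apply: measurable_indic; exact: measurable_itv.
  apply: measurable_funTS; apply: measurableT_comp => //.
  apply: mf; rewrite le_min ab ge_min lexx/= andbT.
  by rewrite lerDl mulr_ge0// ltW.
move=> [u w] [/= + _]; rewrite in_itv/= => /andP[au ub].
(* the grid point preceding u *)
pose k n := Num.truncn ((u - a) / h n).
pose g n := a + h n * (k n)%:R.
have kP n : g n <= u < a + h n * (k n).+1%:R.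
  have ua0 : 0 <= (u - a) / h n by rewrite divr_ge0 ?subr_ge0// ltW.
  have /andP[h1 h2] := truncn_itv ua0.
  rewrite /g -lerBrDl -ltrBlDl mulrC -ler_pdivlMr// h1/=.
  by rewrite mulrC -ltr_pdivrMr.
have kn n : (k n < n.+2)%N.
  rewrite ltnS -(ler_nat R); have /andP[+ _] := kP n.
  rewrite /g -lerBrDl mulrC -ler_pdivlMr// => /le_trans; apply.
  rewrite ler_pdivrMr// /h mulrC divfK ?pnatr_eq0//.
  by rewrite lerD2r.
have FE n : F n (u, w) = f (g n) w.
  rewrite /F (bigD1 (Ordinal (kn n)))//= big1 ?addr0.
    rewrite indicE mem_set; last by rewrite /J/= in_itv/= -/(g n) kP.
    rewrite mul1r (min_idPr _)// -/(g n).
    by have /andP[+ _] := kP n => /le_trans; apply.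
  move=> i ik; rewrite indicE memNset ?mul0r// /J/= in_itv/= => /andP[i1 i2].
  move/negP: ik; apply; apply/eqP/val_inj => /=; apply/eqP.
  have /andP[k1 k2] := kP n; rewrite /g in k1.
  have := le_lt_trans i1 k2; have := le_lt_trans k1 i2.
  by rewrite !ltrD2l !ltr_pM2l// !ltr_nat !ltnS eqn_leq => -> ->.
rewrite (_ : F ^~ (u, w) = (fun u => f u w) \o g); last by apply/funext => n; exact: FE.
have gab n : `[a, b]%classic (g n).
  rewrite /= in_itv/= lerDl mulr_ge0 ?(ltW (h0 n))//=.
  by have /andP[+ _] := kP n => /le_trans; apply.
have gu : g n @[n --> \oo] --> u.
  apply/cvgrPdist_le => e e0; near=> n.
  have /andP[k1 k2] := kP n.
  rewrite ger0_norm ?subr_ge0// lerBlDr (le_trans (ltW k2))//.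
  rewrite /g -natr1 mulrDr mulr1 addrA addrC lerD2r.
  rewrite /h ler_pdivrMr// mulrC -ler_pdivrMr//.
  rewrite (@le_trans _ _ n%:R)// ?ler_nat//.
  near: n; exact: nbhs_infty_ger.
have := cf w; rewrite continuous_subspace_in => /(_ u).
rewrite inE/= in_itv/= au ub => /(_ isT) cu.
apply: (cvg_comp g (fun u => f u w) _ cu).
rewrite /nbhs /= => B /=.
rewrite -nbhs_subspace_in; last by rewrite /= in_itv/= au ub.
rewrite /within/= => nB; have := gu _ nB.
by move=> h'; have : \forall n \near \oo, g n \in `[a, b] -> B (g n) by []; apply: filterS => n; apply; have := gab n.
Unshelve. all: by end_near. Qed.

Lemma two_mulr_le (R : realFieldType) (c x : R) : `|x| * (2 * c) <= c ^+ 2 + x ^+ 2.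
Proof.
rewrite -(real_normK (num_real x)); move: (`|x|) => z.
by have := sqr_ge0 (z - c); rewrite !expr2; lra.
Qed.

Lemma sqrD_le2 (R : realType) (c b a : R) : b ^+ 2 <= a ->
  (c + b) ^+ 2 <= 2 * c ^+ 2 + 2 * a.
Proof. by have := sqr_ge0 (b - c); rewrite !expr2; nra. Qed.

Section absolutely_continuous.
Context (R : realType).
Local Notation mu := (@lebesgue_measure R).
Local Notation RR := (measurableTypeR R).
Implicit Types (a b s u : R) (f g : R -> R).

Lemma lebesgue_itv_lty a b : (mu `[a, b] < +oo)%E.
Proof. by rewrite lebesgue_measure_itv/=; case: ifPn => // _; rewrite -EFinB ltry. Qed.

Lemma L1_itvS a b s u f : a <= s -> u <= b ->
  L1 mu `[a, b] f -> L1 mu `[s, u] f.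
Proof.
move=> as_ ub; apply: integrableS => //.
by move=> v /=; rewrite !in_itv/= => /andP[sv vu]; rewrite (le_trans as_ sv) (le_trans vu ub).
Qed.

Lemma Rint_itv_split a s b f : a <= s <= b -> L1 mu `[a, b] f ->
  \int[mu]_(u in `[a, b]) f u
  = \int[mu]_(u in `[a, s]) f u + \int[mu]_(u in `[s, b]) f u.
Proof.
move=> /andP[as_ sb] hf.
have := @Rintegral_itvB _ f (BLeft a) (BRight b) s hf; rewrite !bnd_simp.
move=> /(_ as_ sb); rewrite Rintegral_itv_obnd_cbnd.
  by move=> <-; rewrite addrC subrK.
apply: integrableS hf => // u /=; rewrite !in_itv/= => /andP[su ->].
by rewrite (le_trans as_ (ltW su)).
Qed.

(** Absolute continuity with a chosen density f'. Paths of the state are of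
    this kind, and so are their products, with the density of the product rule
    ([AC_mul]). *)
Definition is_AC a b f f' : Prop := forall s, a <= s <= b ->
  L1 mu `[a, s] f' /\ f s = f a + \int[mu]_(u in `[a, s]) f' u.

Lemma AC_L1 a b f f' : a <= b -> is_AC a b f f' -> L1 mu `[a, b] f'.
Proof. by move=> ab /(_ b); rewrite ab lexx => /(_ isT)[]. Qed.

Lemma AC_intro a b f f' c : L1 mu `[a, b] f' -> a <= b ->
  (forall s, a <= s <= b -> f s = c + \int[mu]_(u in `[a, s]) f' u) ->
  is_AC a b f f'.
Proof.
move=> hf ab fE s /andP[as_ sb]; split; first exact: L1_itvS hf.
have fa : f a = c by rewrite fE ?lexx// set_itv1 Rintegral_set1 addr0.
by rewrite fa fE// as_.
Qed.

Lemma AC_le a b f f' s : a <= s <= b -> is_AC a b f f' ->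
  `|f s| <= `|f a| + \int[mu]_(u in `[a, b]) `|f' u|.
Proof.
move=> /andP[as_ sb] hf; have ab := le_trans as_ sb.
have [|hs ->] := hf s; first by rewrite as_.
apply: (le_trans (ler_normD _ _)); rewrite lerD2l.
apply: (le_trans (le_normr_Rintegral _ hs)) => //.
rewrite (@Rint_itv_split a s b) ?as_//; last by apply: L1_norm; exact: AC_L1 hf.
by rewrite lerDl; apply: Rintegral_ge0.
Qed.

Lemma AC_continuous a b f f' : a <= b -> is_AC a b f f' ->
  {within `[a, b], continuous f}.
Proof.
move=> ab hf; have := parameterized_integral_continuous ab (AC_L1 ab hf).
rewrite /parameterized_integral => hc.
apply: (@subspace_eq_continuous _ _ _ (fun s => f a + \int[mu]_(u in `[a, s]) f' u)).
  by move=> s; rewrite inE/= in_itv/= => /hf[_ <-].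
by move=> s; apply: cvgD; [exact: cvg_cst|exact: hc].
Qed.

Lemma AC_measurable a b f f' : a <= b -> is_AC a b f f' ->
  measurable_fun (`[a, b] : set RR) f.
Proof.
move=> ab hf; apply: subspace_continuous_measurable_fun => //.
exact: AC_continuous hf.
Qed.

Lemma AC_mul_L1 a b f f' g : a <= b -> is_AC a b f f' -> L1 mu `[a, b] g ->
  L1 mu `[a, b] (fun u => f u * g u).
Proof.
move=> ab hf hg.
apply: (@L1_mulb _ _ _ _ _ _ _ _ (`|f a| + \int[mu]_(u in `[a, b]) `|f' u|) hg).
- by [].
- exact: AC_measurable hf.
- by apply: aeW => u /=; rewrite in_itv/= => uab; exact: AC_le.
Qed.

Lemma prod_L1 a b f g : L1 mu `[a, b] f -> L1 mu `[a, b] g ->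
  L1 (mu \x mu)%E (`[a, b] `*` `[a, b]) (fun p => f p.1 * g p.2).
Proof.
move=> hf hg.
pose F := f \_ `[a, b]; pose G := g \_ `[a, b].
have hF : L1 mu setT F.
  by rewrite /F -restrict_EFin; exact: ((integrable_mkcond _ _).1 hf).
have hG : L1 mu setT G.
  by rewrite /G -restrict_EFin; exact: ((integrable_mkcond _ _).1 hg).
have mFG : measurable_fun setT (fun p : RR * RR => F p.1 * G p.2).
  by apply: measurable_funM; apply: measurableT_comp => //;
    exact: (L1_measurable (mu := mu)).
have mD : measurable (`[a, b]%classic `*` `[a, b]%classic : set (RR * RR)).
  exact: measurableX.
have : L1 (mu \x mu)%E setT (fun p => F p.1 * G p.2).
  apply/(integrable12ltyP mu mu); first exact/measurable_EFinP.
  rewrite [X in (X < _)%E](_ : _ =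
      \int[mu]_x ((\int[mu]_y `|G y|)%:E * (`|F x|)%:E))%E; last first.
    apply: eq_integral => x _.
    transitivity (\int[mu]_y ((`|F x|)%:E * (`|G y|)%:E))%E.
      by apply: eq_integral => y _; rewrite /= normrM EFinM.
    rewrite ge0_integralZl//.
      by rewrite RintE; [rewrite muleC|exact: measurableT|exact: L1_norm hG].
    by apply/measurable_EFinP; apply: measurableT_comp => //; exact: (L1_measurable (mu := mu)).
  rewrite integralZl//; last exact: L1_norm.
  by rewrite RintE// ?ltry//; exact: L1_norm.
move=> hT; have := integrableS measurableT mD (@subsetT _ _) hT.
apply: eq_integrable => //= -[u v] /set_mem[/= uab vab].
by rewrite /F /G !patchE !mem_set.
Qed.

(** Integration by parts: integrating f' u * g' v over the square and cutting it
    along its diagonal gives one of the two integrals on each side. *)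
Lemma AC_mul a b f f' g g' : is_AC a b f f' -> is_AC a b g g' ->
  is_AC a b (fun u => f u * g u) (fun u => f' u * g u + f u * g' u).
Proof.
move=> hf hg s /andP[as_ sb].
have hf' : L1 mu `[a, s] f' by have [] := hf s; rewrite ?as_.
have hg' : L1 mu `[a, s] g' by have [] := hg s; rewrite ?as_.
have hfs : is_AC a s f f'.
  by move=> u /andP[au us]; apply: hf; rewrite au (le_trans us).
have hgs : is_AC a s g g'.
  by move=> u /andP[au us]; apply: hg; rewrite au (le_trans us).
have i1 : L1 mu `[a, s] (fun u => f' u * g u).
  rewrite (_ : (fun u => _) = fun u => g u * f' u); first exact: AC_mul_L1 hgs hf'.
  by apply/funext => u; rewrite mulrC.
have i2 : L1 mu `[a, s] (fun u => f u * g' u) by exact: AC_mul_L1 hfs hg'.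
split; first exact: L1D.
rewrite RintegralD//.
set D : set RR := `[a, s]%classic.
have mD : measurable D by exact: measurable_itv.
have mDD : measurable (D `*` D : set (RR * RR)) by exact: measurableX.
have iF := prod_L1 hf' hg'.
pose low (p : RR * RR) := \1_[set q : RR * RR | q.2 <= q.1] p : R.
have mlow : measurable_fun setT low.
  apply: measurable_indic; rewrite -[X in measurable X]setTI.
  by apply: measurable_fun_le.
have low1 p : `|low p| <= 1 by rewrite /low indicE; case: (_ \in _); rewrite ?normr1 ?normr0.
have iL : L1 (mu \x mu)%E (D `*` D) (fun p => low p * (f' p.1 * g' p.2)).
  apply: (L1_mulb mDD iF); first exact: measurable_funTS.
  by apply: aeW => p _; exact: low1.
have iU : L1 (mu \x mu)%E (D `*` D) (fun p => (1 - low p) * (f' p.1 * g' p.2)).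
  apply: (@L1_mulb _ _ _ _ _ _ _ _ 1 iF); [by []| |].
    by apply: measurable_funB => //; exact: measurable_funTS.
  by apply: aeW => p _; rewrite /low indicE; case: (_ \in _);
    rewrite ?subrr ?subr0 ?normr1 ?normr0.
have eL : \int[(mu \x mu)%E]_(p in D `*` D) (low p * (f' p.1 * g' p.2))
    = \int[mu]_(u in D) (f' u * g u) - g a * \int[mu]_(u in D) f' u.
  rewrite -(@fubini_Rint1 _ _ _ _ _ mu mu D D _ _ (fun u v => low (u, v) * (f' u * g' v)))//.
  rewrite -RintegralZl// -RintegralB//; last exact: L1Z.
  apply: eq_Rintegral => u /set_mem; rewrite /D/= in_itv/= => /andP[au us].
  have [hu gu] : L1 mu `[a, u] g' /\ g u = g a + \int[mu]_(v in `[a, u]) g' v.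
    by apply: hgs; rewrite au.
  rewrite gu mulrDr [g a * _]mulrC addrAC subrr add0r -RintegralZl//.
  rewrite [RHS]Rintegral_mkcond [LHS]Rintegral_mkcond.
  apply: eq_Rintegral => v _; rewrite !patchE /low indicE /=.
  have [vu|uv] := leP v u.
    rewrite (mem_set (_ : [set q : RR * RR | q.2 <= q.1] (u, v)))// mul1r.
    rewrite (_ : (v \in D) = (v \in `[a, u]%classic))//.
    by rewrite /D !mem_setE !in_itv/= vu (le_trans vu us).
  rewrite (memNset (_ : ~ [set q : RR * RR | q.2 <= q.1] (u, v))) ?mul0r//; last first.
    by move=> /=; rewrite leNgt uv.
  have vau : (v \in `[a, u]%classic) = false.
    by rewrite memNset//= in_itv/= => /andP[_]; rewrite leNgt uv.
  by rewrite vau; case: ifP.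
have eU : \int[(mu \x mu)%E]_(p in D `*` D) ((1 - low p) * (f' p.1 * g' p.2))
    = \int[mu]_(v in D) (f v * g' v) - f a * \int[mu]_(v in D) g' v.
  rewrite -(@fubini_Rint2 _ _ _ _ _ mu mu D D _ _ (fun u v => (1 - low (u, v)) * (f' u * g' v)))//.
  rewrite -RintegralZl// -RintegralB//; last exact: L1Z.
  apply: eq_Rintegral => v /set_mem; rewrite /D/= in_itv/= => /andP[av vs].
  have [hv fv] : L1 mu `[a, v] f' /\ f v = f a + \int[mu]_(u in `[a, v]) f' u.
    by apply: hfs; rewrite av.
  rewrite fv mulrDl addrAC subrr add0r -RintegralZr//.
  rewrite -(@Rintegral_itv_bndo_bndc _ (BLeft a) v); last first.
    have hv' : L1 mu `[a, v] (fun u => f' u * g' v).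
      rewrite (_ : (fun u => _) = fun u => g' v * f' u); first exact: L1Z.
      by apply/funext => u; rewrite mulrC.
    apply: (integrableS _ _ _ hv') => //.
    by move=> u /=; rewrite !in_itv/= => /andP[-> /ltW].
  rewrite [RHS]Rintegral_mkcond [LHS]Rintegral_mkcond.
  apply: eq_Rintegral => u _; rewrite !patchE /low indicE /=.
  have [vu|uv] := leP v u.
    rewrite (mem_set (_ : [set q : RR * RR | q.2 <= q.1] (u, v)))// subrr mul0r.
    have uav : (u \in `[a, v[%classic) = false.
      by rewrite memNset//= in_itv/= => /andP[_]; rewrite ltNge vu.
    by rewrite uav; case: ifP.
  rewrite (memNset (_ : ~ [set q : RR * RR | q.2 <= q.1] (u, v))); last first.
    by move=> /=; rewrite leNgt uv.
  rewrite subr0 mul1r (_ : (u \in D) = (u \in `[a, v[%classic))//.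
  by rewrite /D !mem_setE !in_itv/= uv (ltW (lt_le_trans uv vs)).
have eF : \int[(mu \x mu)%E]_(p in D `*` D) (f' p.1 * g' p.2)
    = (\int[mu]_(u in D) f' u) * \int[mu]_(v in D) g' v.
  rewrite -(@fubini_Rint1 _ _ _ _ _ mu mu D D _ _ (fun u v => f' u * g' v))//.
  rewrite -RintegralZr//; apply: eq_Rintegral => u _.
  by rewrite RintegralZl.
have : \int[(mu \x mu)%E]_(p in D `*` D) (f' p.1 * g' p.2) =
    \int[(mu \x mu)%E]_(p in D `*` D) (low p * (f' p.1 * g' p.2))
    + \int[(mu \x mu)%E]_(p in D `*` D) ((1 - low p) * (f' p.1 * g' p.2)).
  by rewrite -RintegralD//; apply: eq_Rintegral => p _; rewrite -mulrDl subrKC mul1r.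
rewrite eF eL eU => e.
have [_ ->] : L1 mu `[a, s] f' /\ f s = f a + \int[mu]_(u in `[a, s]) f' u.
  by apply: hf; rewrite as_.
have [_ ->] : L1 mu `[a, s] g' /\ g s = g a + \int[mu]_(u in `[a, s]) g' u.
  by apply: hg; rewrite as_.
by rewrite -/D mulrDl !mulrDr e; ring.
Qed.

(** Cauchy-Schwarz against the constant 1, from the inequality
    2 |f| <= c + f^2 / c with the optimal constant c. *)
Lemma Rint_norm_sqr a b f : a <= b -> measurable_fun (`[a, b] : set RR) f ->
  L1 mu `[a, b] (fun u => f u ^+ 2) -> L1 mu `[a, b] f /\
  (\int[mu]_(u in `[a, b]) `|f u|) ^+ 2
    <= (b - a) * \int[mu]_(u in `[a, b]) f u ^+ 2.
Proof.
move=> ab mf hf2; set D : set RR := `[a, b]%classic.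
have mD : measurable D by exact: measurable_itv.
have c1 k : L1 mu D (fun=> k) by apply: L1_cst => //; exact: (lebesgue_itv_lty a b).
have muD : fine (mu D) = b - a.
  rewrite lebesgue_measure_itv/= lte_fin; case: ltP => //.
  by move=> ba; apply/eqP; rewrite eq_sym subr_eq0 eq_le ab ba.
have hf : L1 mu D f.
  apply: (L1_le mD mf _ (L1D mD (c1 1) hf2)) => // u _.
  by have := two_mulr_le 1 (f u); have := normr_ge0 (f u); move: (`|f u|) => x; rewrite expr1n; lra.
split=> //; set I := \int[mu]_(u in D) `|f u|; set J := \int[mu]_(u in D) f u ^+ 2.
have I0 : 0 <= I by apply: Rintegral_ge0.
have J0 : 0 <= J by apply: Rintegral_ge0 => u _; exact: sqr_ge0.
have key c : 2 * c * I <= c ^+ 2 * (b - a) + J.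
  rewrite -muD -Rintegral_cst// -RintegralD// /I -RintegralZl//; last exact: L1_norm.
  apply: le_Rintegral => //; [exact/L1Z/L1_norm|exact: L1D|].
  by move=> u _; rewrite mulrC; exact: two_mulr_le.
have [ba|ba] := ltP a b; last first.
  have e : b - a = 0 by apply/eqP; rewrite subr_eq0 eq_le ab ba.
  have k0 := key (J + 1); rewrite e mulr0 add0r in k0.
  rewrite e mul0r.
  have : I <= 0.
    rewrite leNgt; apply/negP => Ip; have k1 := key ((J + 1) / I).
    rewrite e mulr0 add0r -mulrA divfK ?gt_eqF// in k1; lra.
  move=> I1; have I00 : I = 0 by apply/eqP; rewrite eq_le I1 I0.
  by rewrite I00 expr0n.
have ba0 : 0 < b - a by rewrite subr_gt0.
have k1 := key (I / (b - a)).
have e1 : 2 * (I / (b - a)) * I = 2 * (I ^+ 2 / (b - a)) by field; rewrite gt_eqF.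
have e2 : (I / (b - a)) ^+ 2 * (b - a) = I ^+ 2 / (b - a) by field; rewrite gt_eqF.
rewrite e1 e2 in k1.
by rewrite mulrC -ler_pdivrMr//; lra.
Qed.

End absolutely_continuous.

(** * Centred normal laws *)

Section density.
Context d (X : measurableType d) (R : realType).
Variables (nu mu : {measure set X -> \bar R}) (h : X -> R).
Hypotheses (mh : measurable_fun setT h) (h0 : forall x, 0 <= h x).
Hypothesis nuE : forall A, measurable A -> (nu A = \int[mu]_(x in A) (h x)%:E)%E.

Import HBNNSimple.

(** A measure given by a density integrates nonnegative functions through it;
    this passes from indicators to simple functions and to their increasing
    limits. *)
Lemma ge0_integral_density (f : X -> \bar R) : measurable_fun setT f ->
  (forall x, 0 <= f x)%E ->
  (\int[nu]_x f x = \int[mu]_x (f x * (h x)%:E))%E.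
Proof.
move=> mf f0.
pose f_ := nnsfun_approx measurableT mf.
have cf x : EFin \o f_^~ x @ \oo --> f x by exact: cvg_nnsfun_approx.
transitivity (lim (\int[nu]_x (f_ n x)%:E @[n --> \oo])%E).
  rewrite -monotone_convergence//=.
  - by apply: eq_integral => x _; apply/esym/cvg_lim => //=; exact: cf.
  - by move=> n; exact/measurable_EFinP/measurable_funTS.
  - by move=> n ? _; rewrite lee_fin.
  - by move=> ? _ ? ? mn; rewrite lee_fin; exact/lefP/nd_nnsfun_approx.
rewrite [RHS](_ : _ = lim (\int[mu]_x ((f_ n x)%:E * (h x)%:E) @[n --> \oo])%E).
  apply: congr_lim; apply/funext => n /=.
  rewrite integralT_nnsfun sintegralE.
  under [RHS]eq_integral do rewrite fimfunE -EFinM mulr_fsuml// -fsumEFin//.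
  rewrite ge0_integral_fsum//; last 2 first.
  - move=> r; apply/measurable_EFinP; apply: measurable_funM => //.
    by apply: measurable_funM => //; exact: measurable_indic.
  - move=> r x _; rewrite lee_fin mulr_ge0//.
    have [r0|r0] := leP 0 r; first by rewrite mulr_ge0.
    by rewrite preimage_nnfun0// indicE in_set0 mulr0.
  apply: eq_fsbigr => r _; rewrite nuE//.
  have [r0|r0] := leP 0 r; last first.
    rewrite preimage_nnfun0// integral_set0 mule0 integral0_eq// => x _.
    by rewrite indicE in_set0 mulr0 mul0r.
  under [RHS]eq_integral do rewrite -mulrA EFinM.
  rewrite ge0_integralZl//; last 2 first.
  - apply/measurable_EFinP; apply: measurable_funM => //; exact: measurable_indic.
  - by move=> x _; rewrite lee_fin mulr_ge0.
  congr (_ * _)%E; rewrite integral_mkcond; apply: eq_integral => x _.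
  by rewrite patchE indicE; case: ifP => _; rewrite ?mul1r ?mul0r.
rewrite -monotone_convergence//=.
- apply: eq_integral => x _; apply/esym/cvg_lim => //.
  by apply: cvgeZr => //; exact: cf.
- move=> n; apply/measurable_EFinP; apply: measurable_funM => //.
- by move=> n x _; rewrite lee_fin mulr_ge0.
- move=> x _ m n mn; rewrite lee_fin ler_wpM2r//; exact/lefP/nd_nnsfun_approx.
Qed.

End density.

Section normal_law.
Context (R : realType).
Local Notation mu := (@lebesgue_measure R).
Local Notation RR := (measurableTypeR R).

(** The first moment is dominated by the mass of a wider normal law, since
    half of the Gaussian exponent absorbs the factor |x|. *)
Lemma normal_fun_moment1 (s : R) : 0 < s -> exists K, forall x : R,
  `|x| * normal_pdf 0 s x <= K * normal_pdf 0 (Num.sqrt 2 * s) x.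
Proof.
move=> s0; set r := Num.sqrt 2 * s.
have r0 : 0 < r by rewrite mulr_gt0// sqrtr_gt0.
have r2 : r ^+ 2 = 2 * s ^+ 2 by rewrite exprMn sqr_sqrtr.
have s20 : 0 < s ^+ 2 by rewrite exprn_gt0.
pose c := Num.max 1 (4 * s ^+ 2).
have c1 : 1 <= c by rewrite le_max lexx.
have c4 : 4 * s ^+ 2 <= c by rewrite le_max lexx orbT.
exists (normal_peak s * c / normal_peak r) => x.
rewrite !normal_pdfE ?gt_eqF//.
rewrite [leRHS]mulrA divfK; last by rewrite gt_eqF// normal_peak_gt0// gt_eqF.
rewrite mulrCA -!mulrA ler_pM2l; last by rewrite normal_peak_gt0// gt_eqF.
rewrite /normal_fun !subr0 r2.
(* x^2 / (4 s^2) is both the excess in the exponent and what dominates |x| *)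
set y := x ^+ 2 / (4 * s ^+ 2).
have -> : - x ^+ 2 / (s ^+ 2 *+ 2) = - y - y.
  by rewrite /y -mulr_natr; field; rewrite gt_eqF.
have -> : - x ^+ 2 / ((2 * s ^+ 2) *+ 2) = - y.
  by rewrite /y -mulr_natr; field; rewrite gt_eqF.
rewrite expRD mulrA ler_wpM2r ?expR_ge0//.
rewrite expRN ler_pdivrMr ?expR_gt0//.
have y0 : 0 <= y by rewrite divr_ge0 ?sqr_ge0// ltW// mulr_gt0.
apply: (@le_trans _ _ (c * (1 + y))); last first.
  by rewrite ler_wpM2l ?(le_trans _ c1)// expR_ge1Dx.
have xx : `|x| <= 1 + x ^+ 2.
  by have := two_mulr_le 1 x; have := normr_ge0 x; move: (`|x|) => z; rewrite expr1n; lra.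
apply: (le_trans xx); rewrite mulrDr mulr1 lerD//.
rewrite -[leLHS](@divfK _ (4 * s ^+ 2)) ?gt_eqF ?mulr_gt0// -/y mulrC.
by rewrite ler_wpM2r.
Qed.

(** A random variable Z whose law is a centred normal one and that is independent
    of the event A, whose probability is c. *)
Section law.
Context d (X : measurableType d) (Q : {measure set X -> \bar R}).
Variables (A : set X) (Z : X -> R) (s : R) (c : R).
Hypotheses (mA : measurable A) (mZ : measurable_fun setT Z) (s0 : 0 < s).
Hypothesis c0 : 0 <= c.
Hypothesis lawZ : forall B : set R, measurable B ->
  Q (A `&` Z @^-1` B) = (c%:E * normal_prob 0 s B)%E.

Let h x := c * normal_pdf 0 s x.

Let mh : measurable_fun (setT : set RR) h.
Proof. by apply: measurable_funM => //; exact: measurable_normal_pdf. Qed.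

Let h0 x : 0 <= h x. Proof. by rewrite mulr_ge0 ?normal_pdf_ge0. Qed.

Let law_integral (g : RR -> \bar R) : measurable_fun setT g ->
  (forall x, 0 <= g x)%E ->
  (\int[Q]_(x in A) g (Z x) = \int[mu]_x (g x * (h x)%:E))%E.
Proof.
move=> mg g0.
have mZ' : measurable_fun setT (Z : X -> RR) by exact: mZ.
have nuE (B : set RR) : measurable B ->
    (pushforward (mrestr Q mA) (Z : X -> RR) B = \int[mu]_(x in B) (h x)%:E)%E.
  move=> mB; rewrite /pushforward /mrestr setIC lawZ// /normal_prob -ge0_integralZl//.
  - by apply/measurable_EFinP; apply: measurable_funTS; exact: measurable_normal_pdf.
  - by move=> x _; rewrite lee_fin normal_pdf_ge0.
rewrite -(ge0_integral_density (nu := pushforward (mrestr Q mA) (Z : X -> RR)) mh h0 nuE mg g0).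
transitivity (\int[mrestr Q mA]_x g (Z x))%E; last first.
  by rewrite ge0_integral_pushforward// ?preimage_setT.
have mgZ : measurable_fun setT (g \o Z) by exact: (measurableT_comp mg mZ').
rewrite (@ge0_integral_density _ _ _ (mrestr Q mA) Q \1_A)//; last first.
  by move=> B mB; rewrite integral_indic// /mrestr setIC.
rewrite integral_mkcond; apply: eq_integral => x _.
by rewrite patchE indicE; case: ifP => _; rewrite ?mule1 ?mule0.
Qed.

Lemma normal_L1 : L1 Q A Z.
Proof.
apply/integrableP; split; first exact/measurable_EFinP/measurable_funTS.
have mabs : measurable_fun (setT : set RR) (fun x : RR => (`|x|)%:E).
  by apply/measurable_EFinP; exact: normr_measurable.
have [K hK] := normal_fun_moment1 s0.
rewrite (law_integral mabs); last by move=> x; rewrite lee_fin.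
have hi : L1 mu setT (normal_pdf 0 (Num.sqrt 2 * s)) by exact: integrable_normal_pdf.
have /integrableP[_] := L1Z measurableT (c * K) hi.
apply: le_lt_trans; apply: ge0_le_integral => //.
- by move=> x _; rewrite -EFinM lee_fin mulr_ge0.
- by apply: emeasurable_funM => //; exact/measurable_EFinP.
- do 2 apply: measurableT_comp => //.
  by apply: measurable_funM => //; exact: measurable_normal_pdf.
- move=> x _; rewrite -EFinM lee_fin /h mulrCA -mulrA (le_trans _ (ler_norm _))//.
  by rewrite ler_wpM2l.
Qed.

(** The density is even and Lebesgue measure is invariant under x |-> - x. *)
Lemma normal_mean0 : \int[Q]_(x in A) Z x = 0.
Proof.
have iZ := normal_L1.
have sym (g : RR -> \bar R) : measurable_fun setT g -> (forall x, 0 <= g x)%E ->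
    (\int[mu]_x g x = \int[mu]_x g (- x)%R)%E.
  move=> mg g0.
  have mN : measurable_fun setT (-%R : RR -> RR) by exact: oppr_measurable.
  transitivity (\int[pushforward mu (-%R : RR -> RR)]_x g x)%E.
    by apply: eq_measure_integral => B mB _; first [exact: lebesgue_measureN | exact/esym/lebesgue_measureN].
  by rewrite ge0_integral_pushforward// ?preimage_setT.
have mid : measurable_fun (setT : set RR) (EFin : RR -> \bar R).
  by apply/measurable_EFinP; exact: measurable_id.
rewrite /Rintegral integralE.
rewrite (_ : (fun x => (Z x)%:E)^\+%E = fun x => (fun r : RR => r%:E)^\+%E (Z x)); last first.
  by apply/funext => x; rewrite !funeposE.
rewrite (_ : (fun x => (Z x)%:E)^\-%E = fun x => (fun r : RR => r%:E)^\-%E (Z x)); last first.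
  by apply/funext => x; rewrite !funenegE.
rewrite !law_integral//; [|exact: measurable_funeneg|exact: measurable_funepos].
have mF : measurable_fun (setT : set RR) (fun x : RR => (fun r : RR => r%:E)^\+%E x * (h x)%:E)%E.
  by apply: emeasurable_funM; [exact: measurable_funepos|exact/measurable_EFinP].
rewrite (sym _ mF); last by move=> x; rewrite mule_ge0// lee_fin.
rewrite (eq_integral (fun x : RR => (fun r : RR => r%:E)^\-%E x * (h x)%:E)%E).
  by case: (\int[mu]_x _)%E => //= r; rewrite subrr.
move=> x _; rewrite /= funeposE funenegE /h !normal_pdfE ?gt_eqF//.
by rewrite /normal_fun !subr0 sqrrN.
Qed.

End law.
End normal_law.

(** * The Brownian filtration and the Ito integral *)

Section filtration.
Context (R : realType) (disp : measure_display) (Omega : measurableType disp).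
Variables (P : probability Omega R) (W : R -> Omega -> R) (T : R).
Hypothesis hW : is_brownian P W T.
Hypothesis hF : full_filtration P W T.
Local Notation mu := (@lebesgue_measure R).
Local Notation RR := (measurableTypeR R).
Local Notation FF s := (<<s filtration_gen P W s>>).
Local Notation Fm s f := (measurable_fun setT (f : filtered P W s -> R)).
Implicit Types (s t u : R) (Z eta : Omega -> R).

Lemma filtration_mono s t : s <= t -> FF s `<=` FF t.
Proof.
move=> st; apply: sub_sigma_algebra2 => A [[u [/andP[u0 us] hu]]|hA]; last by right.
by left; exists u; rewrite u0 (le_trans us st).
Qed.

Lemma filtration_measurable s : s <= T -> FF s `<=` measurable.
Proof. by move=> sT A /(filtration_mono sT)/hF. Qed.

Lemma filtration_negligible s A : P.-negligible A -> FF s A.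
Proof. by move=> hA; apply: sub_sigma_algebra; right. Qed.

Lemma Fm_le s t (f : Omega -> R) : s <= t -> Fm s f -> Fm t f.
Proof. by move=> st mf _ B mB; apply: (filtration_mono st); exact: mf. Qed.

Lemma Fm_measurable s (f : Omega -> R) : s <= T -> Fm s f -> measurable_fun setT f.
Proof. by move=> sT mf _ B mB; apply: (filtration_measurable sT); exact: mf. Qed.

Lemma Fm_T (f : Omega -> R) : measurable_fun setT f -> Fm T f.
Proof. by move=> mf _ B mB; apply/hF; exact: mf. Qed.

(** The filtration contains the null sets, so measurability with respect to it
    only depends on the class modulo null sets. *)
Lemma Fm_ae s (f g : Omega -> R) : {ae P, forall w, f w = g w} -> Fm s g -> Fm s f.
Proof.
move=> fg mg _ B mB; rewrite setTI.
pose N : set (filtered P W s) := ~` [set w | f w = g w].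
have mN (A : set (filtered P W s)) : A `<=` N -> measurable A.
  by move=> AN; apply: filtration_negligible; apply: negligibleS fg.
rewrite (_ : f @^-1` B = ((g @^-1` B) `\` N) `|` ((f @^-1` B) `&` N) :> set (filtered P W s)).
  apply: measurableU; last by apply: mN; exact: subIsetr.
  apply: measurableD; last exact: mN.
  by rewrite -[X in measurable X]setTI; exact: mg.
apply/seteqP; split=> w /=.
  move=> Bf; have [e|ne] := pselect (f w = g w); last by right.
  by left; rewrite -e; split=> //; apply.
by move=> [[Bg /contrapT ->]|[]].
Qed.

Lemma measurable_ae (f g : Omega -> R) : {ae P, forall w, f w = g w} ->
  measurable_fun setT g -> measurable_fun setT f.
Proof. by move=> fg /Fm_T mg; apply: (@Fm_measurable T) => //; exact: Fm_ae mg. Qed.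

Lemma Fm_indic s (A : set Omega) : FF s A -> Fm s (\1_A).
Proof. by move=> FA; exact: (@measurable_indic _ (filtered P W s)). Qed.

(** ** Joint measurability *)

Definition jmeas (a b : R) (f : R -> Omega -> R) : Prop :=
  measurable_fun ((`[a, b] : set RR) `*` [set: Omega])
    (fun p : RR * Omega => f p.1 p.2).

(** Progressive measurability refers to the sigma-algebra of F_s, joint
    measurability to the one of Omega; the former implies the latter because
    F_s is contained in F_T. *)
Lemma jmeas_filtered a b s (f : R -> Omega -> R) : s <= T ->
  measurable_fun ((`[a, b] : set RR) `*` [set: filtered P W s])
    (fun p : RR * filtered P W s => f p.1 p.2) -> jmeas a b f.
Proof.
move=> sT mf.
have mh : measurable_fun setT
    (fun p : RR * Omega => (p.1, p.2) : RR * filtered P W s).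
  apply: measurable_fun_pair; first exact: measurable_fst.
  move=> _ B mB; have mB' : measurable (B : set Omega) := filtration_measurable sT mB.
  have := @measurable_snd _ _ RR Omega measurableT _ mB'; exact.
have := @measurable_comp _ _ _ _ _ _ _ _ ((`[a, b] : set RR) `*` [set: Omega])
  (fun p : RR * Omega => (p.1, p.2) : RR * filtered P W s) _ _ mf.
apply.
- exact: measurableX.
- by move=> _ [p [p1 _] <-].
- exact: measurable_funTS.
Qed.

Lemma progressive_jmeas f : progressive P W T f -> 0 <= T -> jmeas 0 T f.
Proof. by move=> pf T0; apply: (@jmeas_filtered _ _ T) => //; apply: pf; rewrite T0 lexx. Qed.

Lemma jmeasS a b a' b' f : a <= a' -> b' <= b -> jmeas a b f -> jmeas a' b' f.
Proof.
move=> aa bb; apply: measurable_funS; first exact: measurableX.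
move=> [u w] [/=]; rewrite !in_itv/= => /andP[u1 u2] _; split=> //=.
by rewrite (le_trans aa u1) (le_trans u2 bb).
Qed.

Lemma progressive_adapted f s : progressive P W T f -> 0 <= s <= T -> Fm s (f s).
Proof.
move=> pf hs; have mf := pf s hs; have /andP[s0 sT] := hs.
have := @measurable_comp _ _ _ _ _ _ _ _ setT
  (fun w : filtered P W s => (s, w) : R * filtered P W s) _ _ mf.
apply.
- exact: measurableX.
- by move=> _ [w _ <-]; split=> //=; rewrite in_itv/= s0 lexx.
- exact: measurable_pair1.
Qed.

Lemma continuous_progressive a f s : adapted P W a T f ->
  continuous_paths a T f -> a <= s <= T ->
  measurable_fun ((`[a, s] : set RR) `*` [set: filtered P W s])
    (fun p : RR * filtered P W s => f p.1 p.2).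
Proof.
move=> af cf /andP[as_ sT]; apply: measurable_caratheodory => //.
  move=> u /andP[au us]; apply: (Fm_le us); apply: af.
  by rewrite au (le_trans us).
move=> w; apply: continuous_subspaceW (cf w) => u /=; rewrite !in_itv/= => /andP[-> us].
exact: le_trans us sT.
Qed.

Lemma continuous_jmeas a f : a <= T -> adapted P W a T f ->
  continuous_paths a T f -> jmeas a T f.
Proof.
by move=> aT af cf; apply: (@jmeas_filtered _ _ T) => //;
  apply: continuous_progressive => //; rewrite aT lexx.
Qed.

(** ** Orthogonality *)

Lemma Rint_P_cst (c : R) : \int[P]_w c = c.
Proof.
have := Rintegral_cst P (@measurableT _ Omega) c; rewrite /= => ->.
by have := probability_setT P => /= ->; rewrite mulr1.
Qed.

Lemma Rint_indic (Z : Omega -> R) (A : set Omega) : measurable A ->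
  \int[P]_w (\1_A w * Z w) = \int[P]_(w in A) Z w.
Proof.
move=> mA; rewrite [RHS]Rintegral_mkcond; apply: eq_Rintegral => w _.
by rewrite patchE indicE; case: ifP; rewrite ?mul1r ?mul0r.
Qed.

Lemma L1_indic (Z : Omega -> R) (A : set Omega) : measurable A ->
  L1 P setT Z -> L1 P setT (fun w => \1_A w * Z w).
Proof.
move=> mA iZ; apply: (@L1_mulb _ _ _ _ _ _ _ _ 1 iZ); [by []|exact: measurable_indic|].
by apply: aeW => w _; rewrite indicE; case: (_ \in _); rewrite ?normr1 ?normr0.
Qed.

Import HBNNSimple.

(** Simple functions first; a measurable eta is the limit of simple ones below
    it, and eta |Z| dominates. *)
Let orthogonal_ge0 s Z eta : s <= T -> L1 P setT Z ->
  (forall A, FF s A -> \int[P]_(w in A) Z w = 0) ->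
  Fm s eta -> (forall w, 0 <= eta w) -> L1 P setT (fun w => eta w * Z w) ->
  \int[P]_w (eta w * Z w) = 0.
Proof.
move=> sT iZ Z0 meta eta0 ietaZ.
have meta' : measurable_fun setT (EFin \o eta : filtered P W s -> \bar R).
  exact/measurable_EFinP.
pose g := nnsfun_approx measurableT meta'.
have cg w : g n w @[n --> \oo] --> eta w.
  have : (EFin \o g^~ w) n @[n --> \oo] --> (eta w)%:E.
    by apply: (cvg_nnsfun_approx measurableT meta') => // ? _; rewrite lee_fin.
  by move/fine_cvg.
have leg n w : g n w <= eta w.
  have nd : nondecreasing_seq (g^~ w).
    by move=> a b ab; exact/lefP/nd_nnsfun_approx.
  have cv : cvgn (g^~ w) by apply/cvg_ex; exists (eta w); exact: cg.
  by have := nondecreasing_cvgn_le nd cv n; rewrite (cvg_lim _ (cg w)).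
have mgO n (r : R) : FF s (g n @^-1` [set r]).
  have mgn : measurable_fun setT (g n) by exact: measurable_funP.
  by have := mgn measurableT _ (measurable_set1 r); rewrite setTI.
have mg n : measurable_fun setT (g n : Omega -> R).
  by apply: (@Fm_measurable s) => //; exact: measurable_funP.
have ig n : L1 P setT (fun w => g n w * Z w).
  apply: (L1_le _ _ _ (L1_norm ietaZ)) => //.
    by apply: measurable_funM => //; exact: L1_measurable iZ.
  by move=> w _; rewrite !normrM ler_wpM2r// !ger0_norm.
have Ig n : \int[P]_w (g n w * Z w) = 0.
  have gE w : g n w * Z w = \sum_(r <- finmap.enum_fset (fset_set (range (g n))))
      r * (\1_(g n @^-1` [set r]) w * Z w).
    rewrite {1}fimfunE fsbig_finite//= mulr_suml.
    by apply: eq_bigr => r _; rewrite mulrA.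
  rewrite (@eq_Rintegral _ _ _ P setT (fun w => \sum_(r <- finmap.enum_fset (fset_set (range (g n))))
      r * (\1_(g n @^-1` [set r]) w * Z w))); last by move=> w _; rewrite gE.
  have mr r : measurable (g n @^-1` [set r] : set Omega) by exact: filtration_measurable (mgO n r).
  rewrite Rint_sum//; last by move=> r; apply: L1Z => //; exact: L1_indic.
  rewrite big1// => r _; rewrite RintegralZl//; last exact: L1_indic.
  by rewrite Rint_indic// Z0 ?mulr0.
have mZ := L1_measurable iZ.
have [] := @dominated_convergence _ _ _ P setT measurableT
  (fun n => EFin \o (fun w => g n w * Z w)) (EFin \o (fun w => eta w * Z w))
  (EFin \o (fun w => `|eta w * Z w|)).
- by move=> n; exact: measurable_int (ig n).
- exact: measurable_int ietaZ.
- apply: aeW => w _; apply: cvg_EFin; first exact: nearW.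
  by apply: cvgMl; exact: cg.
- exact: L1_norm.
- apply: aeW => w n _; rewrite /= lee_fin !normrM ler_wpM2r// !ger0_norm//.
move=> _ _; rewrite (_ : [sequence _]_n = cst 0%E); last first.
  by apply/funext => n /=; rewrite RintE// Ig.
rewrite RintE// => /(cvg_unique (@ereal_hausdorff R)) /(_ (cvg_cst _)).
by case=> ->.
Qed.

(** What is orthogonal to the indicators of a sigma-algebra is orthogonal to
    its measurable functions. *)
Lemma Fm_orthogonal s Z eta A : s <= T -> L1 P setT Z ->
  (forall B, FF s B -> \int[P]_(w in B) Z w = 0) ->
  Fm s eta -> L1 P setT (fun w => eta w * Z w) -> FF s A ->
  \int[P]_(w in A) (eta w * Z w) = 0.
Proof.
move=> sT iZ Z0 meta ietaZ FA.
have mA : measurable A by exact: filtration_measurable FA.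
rewrite -Rint_indic//.
pose eta1 w := Num.max 0 (\1_A w * eta w); pose eta2 w := Num.max 0 (- (\1_A w * eta w)).
have mAeta : Fm s (fun w => \1_A w * eta w).
  by apply: measurable_funM => //; exact: Fm_indic.
have m1 : Fm s eta1 by exact: measurable_maxr.
have m2 : Fm s eta2 by apply: measurable_maxr => //; exact: measurableT_comp.
have iAe := L1_indic mA ietaZ.
have i1 : L1 P setT (fun w => eta1 w * Z w).
  apply: (L1_le _ _ _ (L1_norm iAe)) => //.
    by apply: measurable_funM; [exact: Fm_measurable m1|exact: L1_measurable iZ].
  move=> w _; rewrite mulrA !normrM ler_wpM2r// /eta1 -normrM.
  by rewrite ger0_norm ?le_max ?lexx// ge_max normr_ge0 ler_norm.
have i2 : L1 P setT (fun w => eta2 w * Z w).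
  apply: (L1_le _ _ _ (L1_norm iAe)) => //.
    by apply: measurable_funM; [exact: Fm_measurable m2|exact: L1_measurable iZ].
  move=> w _; rewrite mulrA !normrM ler_wpM2r// /eta2 -normrM.
  by rewrite ger0_norm ?le_max ?lexx// ge_max normr_ge0 -normrN ler_norm.
rewrite (@eq_Rintegral _ _ _ P setT (fun w => eta1 w * Z w - eta2 w * Z w)); last first.
  move=> w _; rewrite -mulrBl mulrA /eta1 /eta2; congr (_ * _).
  set e := _ * eta w; have [e0|e0] := leP 0 e.
    by rewrite (max_idPl _) ?subr0// oppr_le0.
  by rewrite (max_idPr _) ?opprK ?add0r// oppr_ge0 ltW.
rewrite RintegralB// (orthogonal_ge0 sT iZ Z0 m1)//; last by move=> w; rewrite le_max lexx.
by rewrite (orthogonal_ge0 sT iZ Z0 m2) ?subrr//; move=> w; rewrite le_max lexx.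
Qed.

(** ** Brownian increments and Ito integrals have conditional mean zero *)

Lemma brownian_adapted s : 0 <= s <= T -> Fm s (W s).
Proof.
move=> /andP[s0 sT] _ B mB; rewrite setTI; apply: sub_sigma_algebra; left.
by exists s; rewrite s0 lexx; split=> //; exists B.
Qed.

(** By independence, the increment has the same normal law on every event of
    F_s up to the factor P(A). *)
Lemma increment_L1 s t : 0 <= s -> s <= t -> t <= T ->
  L1 P setT (increment W s t) /\
  forall A, FF s A -> \int[P]_(w in A) increment W s t w = 0.
Proof.
move=> s0 st tT.
have [<-{t st tT}|st'] := eqVneq s t.
  have e : increment W s s = fun=> 0 by apply/funext => w; rewrite /increment subrr.
  rewrite e; split=> [|A _]; first exact: L1_0.
  by rewrite Rintegral_mkcond (_ : _ \_ _ = fun=> 0) ?Rintegral_cst ?mul0r//;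
    apply/funext => w; rewrite patchE; case: ifP.
have {st'} st' : s < t by rewrite lt_neqAle st' st.
have [_ _ hind hlaw] := hW.
have mI : measurable_fun setT (increment W s t).
  apply: measurable_funB.
    by apply: (@Fm_measurable t) => //; apply: brownian_adapted; rewrite (le_trans s0 st).
  by apply: (@Fm_measurable s); [exact: le_trans tT|apply: brownian_adapted; rewrite s0 (le_trans st)].
have sg : 0 < Num.sqrt (t - s) by rewrite sqrtr_gt0 subr_gt0.
have key A : FF s A -> L1 P A (increment W s t) /\
    \int[P]_(w in A) increment W s t w = 0.
  move=> FA; have mA := filtration_measurable (le_trans st tT) FA.
  have c0 : 0 <= fine (P A) by rewrite fine_ge0.
  have law (B : set R) : measurable B -> P (A `&` increment W s t @^-1` B) =
      ((fine (P A))%:E * normal_prob 0 (Num.sqrt (t - s)) B)%E.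
    by move=> mB; rewrite hind// hlaw// fineK// fin_num_measure.
  split; first exact: (normal_L1 mA mI sg c0 law).
  exact: (normal_mean0 mA mI sg c0 law).
split; last by move=> A /key[].
by have [] := key setT; first exact: (@measurableT _ (filtered P W s)).
Qed.

(** For simple integrands this is the independence of increments, and the
    property passes to the limit in L^2. *)
Lemma ito_mean0 a f I : 0 <= a <= T -> is_ito_integral P W a T f I ->
  L1 P setT I /\ forall A, FF a A -> \int[P]_(w in A) I w = 0.
Proof.
move=> /andP[a0 aT] [mI [m [tau [phi [hs _ hI]]]]].
pose S k := simple_integral W (m k) (tau k) (phi k).
have hS k : L1 P setT (S k) /\ forall A, FF a A -> \int[P]_(w in A) S k w = 0.
  have [htau hmono hphi] := hs k.
  have term (j : 'I_(m k)) :
      L1 P setT (fun w => phi k j w * increment W (tau k j) (tau k j.+1) w) /\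
      forall A, FF a A ->
        \int[P]_(w in A) (phi k j w * increment W (tau k j) (tau k j.+1) w) = 0.
    have /andP[t1 t2] := htau j (ltnW (ltn_ord j)).
    have /andP[t3 t4] := htau j.+1 (ltn_ord j).
    have [mphi [K hK]] := hphi j (ltn_ord j).
    have [i1 i0] := increment_L1 (le_trans a0 t1) (hmono _ (ltn_ord j)) t4.
    have i2 : L1 P setT (fun w => phi k j w * increment W (tau k j) (tau k j.+1) w).
      apply: (@L1_mulb _ _ _ _ _ _ _ _ K i1) => //; first exact: (Fm_measurable t2).
      by apply: aeW => w _.
    split=> // A FA; apply: (Fm_orthogonal t2 i1 i0 mphi i2).
    exact: filtration_mono FA.
  split; first by apply: L1_sum => // j; have [] := term j.
  move=> A FA; have mA := filtration_measurable aT FA.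
  rewrite /S /simple_integral Rint_sum//; last first.
    by move=> j; have [h _] := term j; exact: integrableS h.
  by rewrite big1// => j _; have [_ ->] := term j.
have mS k : measurable_fun setT (S k) by have [/L1_measurable] := hS k.
(* the L^2 convergence, in a form with real numbers *)
have conv (e : R) : 0 < e -> exists k, L1 P setT (fun w => (I w - S k w) ^+ 2) /\
    \int[P]_w (I w - S k w) ^+ 2 <= e.
  move=> e0; have /fine_cvgP[h1 h2] := hI.
  have /cvgrPdist_le/(_ _ e0) h3 := h2.
  have [k _ /(_ _ (leqnn _))[h4 h5]] : \forall k \near \oo,
      (\int[P]_w ((I w - S k w) ^+ 2)%:E)%E \is a fin_num /\
      `|0 - fine (\int[P]_w ((I w - S k w) ^+ 2)%:E)%E| <= e.
    by near=> k; split; near: k.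
  exists k; split; last by move: h5; rewrite sub0r normrN => /ler_normlP[].
  apply/integrableP; split.
    by apply/measurable_EFinP; apply: measurable_funX; exact: measurable_funB.
  rewrite (eq_integral (fun w => ((I w - S k w) ^+ 2)%:E)); last first.
    by move=> w _ /=; rewrite ger0_norm ?sqr_ge0.
  by rewrite -ge0_fin_numE// integral_ge0// => w _; rewrite lee_fin sqr_ge0.
have P1 : (P setT < +oo)%E by rewrite probability_setT ltry.
have iB k : L1 P setT (fun w => (I w - S k w) ^+ 2) -> L1 P setT (fun w => I w - S k w).
  move=> h; apply: (L1_le _ _ _ (L1D measurableT (L1_cst 1 measurableT P1) h)) => //.
    exact: measurable_funB.
  move=> w _; have := two_mulr_le 1 (I w - S k w); rewrite expr1n.
  by have := normr_ge0 (I w - S k w); move: (`|I w - S k w|) ((I w - S k w) ^+ 2) => z z'; lra.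
have [k0 [h0 _]] := conv _ ltr01.
have [i0 _] := hS k0.
have iI : L1 P setT I.
  rewrite (_ : I = fun w => (I w - S k0 w) + S k0 w); first exact: L1D (iB _ h0) i0.
  by apply/funext => w; rewrite subrK.
split=> // A FA; have mA := filtration_measurable aT FA.
apply/eqP; rewrite -normr_le0; apply/ler_addgt0Pr => e e0; rewrite add0r.
have [k [h1 h2]] := conv (e ^+ 2) (exprn_gt0 _ e0).
have [iSk /(_ _ FA) Sk0] := hS k.
have iA g : L1 P setT g -> L1 P A g by exact: integrableS.
rewrite -[X in `|X|]subr0 -Sk0 -RintegralB//; [|exact: iA|exact: iA].
apply: (le_trans (le_normr_Rintegral mA (iA _ (iB _ h1)))).
apply: (@le_trans _ _ (\int[P]_w `|I w - S k w|)).
  rewrite Rintegral_mkcond; apply: le_Rintegral => //.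
  - rewrite -restrict_EFin; apply/(integrable_mkcond _ mA)/iA.
    exact/L1_norm/iB.
  - exact/L1_norm/iB.
  - by move=> w _; rewrite patchE; case: ifP => _; [exact: lexx|exact: normr_ge0].
have : \int[P]_w (`|I w - S k w| * (2 * e)) <= \int[P]_w (e ^+ 2 + (I w - S k w) ^+ 2).
  apply: le_Rintegral => //.
  - rewrite (_ : (fun w => _) = fun w => 2 * e * `|I w - S k w|); last first.
      by apply/funext => w; rewrite mulrC.
    exact/L1Z/L1_norm/iB.
  - exact: L1D (L1_cst _ _ _) h1.
  - by move=> w _; exact: two_mulr_le.
rewrite RintegralZr//; last exact/L1_norm/iB.
rewrite RintegralD//; last exact: L1_cst.
rewrite Rint_P_cst.
move: h2; set J := \int[P]_w `|_|; set J2 := \int[P]_w _ ^+ 2 => h2 h3.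
rewrite -(ler_pM2r (_ : 0 < 2 * e)) ?mulr_gt0//.
apply: (le_trans h3); rewrite mulrCA -expr2 mulr_natl mulr2n.
by rewrite lerD2l.
Unshelve. all: by end_near. Qed.

End filtration.

(** * A product rule for bounded Ito processes *)

Section ae_product.
Context (R : realType) (disp : measure_display) (Omega : measurableType disp).
Variable P : probability Omega R.
Local Notation mu := (@lebesgue_measure R).
Local Notation RR := (measurableTypeR R).
Local Notation nu := (mu \x P)%E.

Lemma ae_prod_snd (Q : Omega -> Prop) : {ae P, forall w, Q w} ->
  {ae nu, forall p : RR * Omega, Q p.2}.
Proof.
move=> [N [mN N0 QN]]; exists (setT `*` N); split.
- exact: measurableX.
- transitivity (mu setT * P N)%E; first exact: product_measure1E.
  by rewrite N0 mule0.
- by move=> [u w] /= h; split=> //; exact: QN.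
Qed.

(** A null set of the product has null sections, by Tonelli's theorem applied
    to its indicator. *)
Lemma ae_prod_section (Q : RR * Omega -> Prop) : {ae nu, forall p, Q p} ->
  {ae P, forall w, {ae mu, forall s, Q (s, w)}}.
Proof.
move=> [N [mN N0 QN]].
have mI : measurable_fun setT (fun p : RR * Omega => (\1_N p : R)%:E).
  by apply/measurable_EFinP; exact: measurable_indic.
have I0 p : (0 <= (\1_N p : R)%:E)%E by rewrite lee_fin.
have := fubini_tonelli2 (m1 := mu) (m2 := P) _ mI I0.
have -> : (\int[nu]_z (\1_N z)%:E = 0)%E by rewrite integral_indic// setIT; exact: N0.
move=> e.
have mG := measurable_fun_fubini_tonelli_G (m1 := mu) _ mI I0.
have /(ae_eq_integral_abs P measurableT mG) : (\int[P]_w `|fubini_G mu (fun p => (\1_N p : R)%:E) w| = 0)%E.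
  rewrite e; apply: eq_integral => w _; rewrite gee0_abs//.
  by apply: integral_ge0 => s _; exact: I0.
apply: filterS => w /(_ I) /= hw.
exists (ysection N w); split.
- exact: measurable_ysection.
- rewrite -hw /fubini_G.
  rewrite (eq_integral (fun s => (\1_(ysection N w) s : R)%:E)).
    by rewrite integral_indic ?setIT//; exact: measurable_ysection.
  move=> s _; rewrite !indicE; congr (_%:R%:E).
  by rewrite ysectionE.
- by move=> s /= h; rewrite ysectionE/=; exact: QN.
Qed.

End ae_product.

Section product_rule.
Context (R : realType) (disp : measure_display) (Omega : measurableType disp).
Variables (P : probability Omega R) (W : R -> Omega -> R) (T : R).
Hypothesis hF : full_filtration P W T.
Local Notation mu := (@lebesgue_measure R).
Local Notation RR := (measurableTypeR R).
Local Notation nu := (mu \x P)%E.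
Local Notation FF s := (<<s filtration_gen P W s>>).
Local Notation Fm s f := (measurable_fun setT (f : filtered P W s -> R)).

Lemma jmeas_section1 a b (f : R -> Omega -> R) s : jmeas a b f -> a <= s <= b ->
  measurable_fun setT (f s).
Proof.
move=> mf asb; have := @measurable_comp _ _ _ _ _ _ _ _ setT
  (fun w : Omega => (s, w) : RR * Omega) _ _ mf.
apply.
- exact: measurableX.
- by move=> _ [w _ <-]; split=> //=; rewrite in_itv/=.
- exact: measurable_pair1.
Qed.

Lemma jmeas_section2 a b (f : R -> Omega -> R) w : jmeas a b f ->
  measurable_fun (`[a, b] : set RR) (f^~ w).
Proof.
move=> mf; have := @measurable_comp _ _ _ _ _ _ _ _ (`[a, b] : set RR)
  (fun s : RR => (s, w) : RR * Omega) _ _ mf.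
apply.
- exact: measurableX.
- by move=> _ [s sab <-].
- by apply: measurable_funTS; exact: measurable_pair2.
Qed.

(** The process q stands for an entry of the Riccati solution, -D for its drift
    and a for a product of two coordinates of the state. That q is an Ito process
    enters only through [hmart]: q T + (integral of D over [u, T]) - q u, which is
    the Ito integral over [u, T], has conditional mean zero given F_u. *)
Section statement.
Variables (t : R) (q D a a' : R -> Omega -> R) (alpha K : R).
Hypothesis (t0 : 0 <= t) (tT : t <= T).
Hypothesis mq : jmeas t T q.
Hypothesis qK : {ae P, forall w, forall s, t <= s <= T -> `|q s w| <= K}.
Hypothesis mD : jmeas t T D.
Hypothesis DK : forall s w, t <= s <= T -> `|D s w| <= K.
Hypothesis hmart : forall u, t <= u <= T -> forall A, FF u A ->
  \int[P]_(w in A) (q T w + \int[mu]_(s in `[u, T]) D s w - q u w) = 0.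
Hypothesis ada' : adapted P W t T a'.
Hypothesis ia' : L1 nu (`[t, T] `*` setT) (fun p => a' p.1 p.2).
Hypothesis ma : jmeas t T a.
Hypothesis ia : L1 nu (`[t, T] `*` setT) (fun p => a p.1 p.2).
Hypothesis haa' : {ae P, forall w, is_AC t T (a^~ w) (a'^~ w) /\ a t w = alpha}.

Let mDT : measurable ((`[t, T] : set RR) `*` [set: Omega]).
Proof. exact: measurableX. Qed.

Let tt : t <= t <= T. Proof. by rewrite lexx. Qed.
Let TT : t <= T <= T. Proof. by rewrite lexx andbT. Qed.

Let mq1 s : t <= s <= T -> measurable_fun setT (q s).
Proof. exact: jmeas_section1. Qed.

Let iD w : L1 mu `[t, T] (D^~ w).
Proof.
apply: (@L1_bounded _ _ _ _ _ _ K) => //; first exact: (lebesgue_itv_lty t T).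
  exact: jmeas_section2.
by apply: aeW => s /=; rewrite in_itv/=; exact: DK.
Qed.

Let H u w := \int[mu]_(s in `[u, T]) D s w.

Let hH w : is_AC t T (H^~ w) (fun s => - D s w).
Proof.
apply: (@AC_intro _ _ _ _ _ (H t w)) => //; first exact: L1N.
move=> s ts; rewrite RintN//; last first.
  by apply: L1_itvS (iD w) => //; have /andP[] := ts.
by rewrite /H (Rint_itv_split ts (iD w)) addrAC subrr add0r.
Qed.

Let H_le u w : t <= u <= T -> `|H u w| <= K * (T - t).
Proof.
move=> tu; have /andP[tu1 uT] := tu; have iu := L1_itvS tu1 (lexx T) (iD w).
have K0 : 0 <= K by apply: le_trans (DK w tt).
apply: (le_trans (le_normr_Rintegral _ iu)) => //.
apply: (@le_trans _ _ (\int[mu]_(s in `[u, T]) K)).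
  apply: le_Rintegral => //; first exact: L1_norm.
    by apply: L1_cst => //; exact: (lebesgue_itv_lty u T).
  move=> s /=; rewrite in_itv/= => /andP[us sT]; apply: DK.
  by rewrite (le_trans tu1 us).
rewrite Rintegral_cst//= ler_wpM2l//.
by rewrite lebesgue_measure_itv/= lte_fin; case: ifP => _ /=;
  rewrite ?subr_ge0// lerD2l lerN2.
Qed.

Let mH : jmeas t T H.
Proof.
apply: measurable_caratheodory => //; last by move=> w; exact: AC_continuous (hH w).
move=> u /andP[tu uT]; apply: (measurable_Rint_section mu) => //.
by apply: (jmeasS tu (lexx T)); exact: mD.
Qed.

Let Z u w := q T w + H u w - q u w.

Let mZ : jmeas t T Z.
Proof.
apply: measurable_funB => //; apply: measurable_funD => //.
apply: measurable_funTS; apply: measurableT_comp; first exact: mq1.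
exact: measurable_snd.
Qed.

Let Z_le : {ae P, forall w, forall s, t <= s <= T -> `|Z s w| <= 2 * K + K * (T - t)}.
Proof.
apply: filterS qK => w h s ts; rewrite /Z.
have -> : 2 * K + K * (T - t) = K + K * (T - t) + K by ring.
apply: (le_trans (ler_normB _ _)); apply: lerD; last exact: h.
apply: (le_trans (ler_normD _ _)); apply: lerD; [exact: h|exact: H_le].
Qed.

Let P1 : (P setT < +oo)%E. Proof. by rewrite probability_setT ltry. Qed.

Let iZ s : t <= s <= T -> L1 P setT (Z s).
Proof.
move=> ts; apply: (@L1_bounded _ _ _ _ _ _ (2 * K + K * (T - t))) => //.
  exact: jmeas_section1 mZ ts.
by apply: filterS Z_le => w h _; exact: h.
Qed.

Let nuZ : {ae nu, forall p : RR * Omega, (`[t, T] `*` setT) p ->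
  `|Z p.1 p.2| <= 2 * K + K * (T - t)}.
Proof.
apply: filterS (ae_prod_snd Z_le) => -[s w] /= h [/=].
by rewrite in_itv/= => ts _; exact: h.
Qed.

Let nuq : {ae nu, forall p : RR * Omega, (`[t, T] `*` setT) p -> `|q p.1 p.2| <= K}.
Proof.
apply: filterS (ae_prod_snd qK) => -[s w] /= h [/=].
by rewrite in_itv/= => ts _; exact: h.
Qed.

Let ia'Z : L1 nu (`[t, T] `*` setT) (fun p => Z p.1 p.2 * a' p.1 p.2).
Proof. exact: (L1_mulb mDT ia' mZ nuZ). Qed.

Let ia'q : L1 nu (`[t, T] `*` setT) (fun p => q p.1 p.2 * a' p.1 p.2).
Proof. exact: (L1_mulb mDT ia' mq nuq). Qed.

Let iaD : L1 nu (`[t, T] `*` setT) (fun p => D p.1 p.2 * a p.1 p.2).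
Proof.
apply: (L1_mulb mDT ia mD (K := K)); apply: aeW => -[s w] [/=].
by rewrite in_itv/= => ts _; exact: DK.
Qed.

Let rest p := q p.1 p.2 * a' p.1 p.2 - D p.1 p.2 * a p.1 p.2.

Let irest : L1 nu (`[t, T] `*` setT) rest. Proof. exact: L1B. Qed.

Let iaT : L1 P setT (fun w => q T w * a T w).
Proof.
have iaT : L1 P setT (a T).
  apply: (@L1_le_ae _ _ _ _ _ _ _ (fun w => `|alpha| + \int[mu]_(s in `[t, T]) `|a' s w|)) => //.
  - exact: jmeas_section1 ma TT.
  - apply: filterS haa' => w [h <-] _; exact: AC_le TT h.
  - apply: L1D => //; first exact: L1_cst.
    exact: (fubini_L1_2 (m1 := mu) (m2 := P) (f := fun s w => `|a' s w|)
      (measurable_itv _) measurableT (L1_norm ia')).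
apply: (L1_mulb _ iaT (mq1 TT)) => //.
by apply: filterS qK => w h _; exact: h.
Qed.

Let iqt : L1 P setT (q t).
Proof.
apply: (@L1_bounded _ _ _ _ _ _ K) => //; first exact: mq1.
by apply: filterS qK => w h _; exact: h.
Qed.

(** Pathwise integration by parts reduces the claim to the orthogonality of
    a' u to the conditionally centred Z u, for almost every time u. *)
Lemma product_rule A : FF t A ->
  [/\ L1 P setT (fun w => q T w * a T w), L1 P setT (q t),
      L1 nu (`[t, T] `*` setT) (fun p => q p.1 p.2 * a' p.1 p.2 - D p.1 p.2 * a p.1 p.2) &
      \int[P]_(w in A) (q T w * a T w) = alpha * \int[P]_(w in A) q t w
      + \int[nu]_(p in `[t, T] `*` A) (q p.1 p.2 * a' p.1 p.2 - D p.1 p.2 * a p.1 p.2)].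
Proof.
move=> FA; split=> //.
have mA : measurable A by exact: (filtration_measurable hF tT FA).
have mDA : measurable ((`[t, T] : set RR) `*` A) by exact: measurableX.
have sDA : (`[t, T] `*` A) `<=` ((`[t, T] : set RR) `*` [set: Omega]).
  by move=> [s w] [].
have sA f : L1 P setT f -> L1 P A f by exact: integrableS.
have sN f : L1 nu (`[t, T] `*` setT) f -> L1 nu (`[t, T] `*` A) f.
  exact: integrableS.
have zero : \int[nu]_(p in `[t, T] `*` A) (Z p.1 p.2 * a' p.1 p.2) = 0.
  have := fubini_Rint1 (m1 := mu) (m2 := P) (D := `[t, T]) (A := A)
    (f := fun s w => Z s w * a' s w) (measurable_itv _) mA (sN _ ia'Z).
  move=> <-.
  have ae1 := fubini_ae1 (m1 := mu) (m2 := P) (f := fun s w => Z s w * a' s w)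
    (measurable_itv _) measurableT ia'Z.
  rewrite (@Rint_eq_ae _ _ _ mu _ _ _ (fun=> 0))//.
  - by rewrite Rintegral_cst ?mul0r.
  - apply: L1_measurable.
    exact: (fubini_L1_1 (m1 := mu) (m2 := P) (f := fun s w => Z s w * a' s w) _ mA (sN _ ia'Z)).
  apply: filterS ae1 => s h st.
  have ts : t <= s <= T by move: st; rewrite /= in_itv.
  have /andP[ts1 sT] := ts.
  rewrite (@eq_Rintegral _ _ _ P A (fun w => a' s w * Z s w)); last first.
    by move=> w _; rewrite mulrC.
  apply: (Fm_orthogonal hF sT (iZ ts)).
  - by move=> B FB; exact: hmart.
  - exact: ada'.
  - rewrite (_ : (fun w => _) = fun w => Z s w * a' s w); first exact: h.
    by apply/funext => w; rewrite mulrC.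
  - exact: filtration_mono FA.
have f2 g : L1 nu (`[t, T] `*` A) (fun p => g p.1 p.2) ->
    L1 P A (fun w => \int[mu]_(s in `[t, T]) g s w) /\
    \int[P]_(w in A) \int[mu]_(s in `[t, T]) g s w = \int[nu]_(p in `[t, T] `*` A) g p.1 p.2.
  move=> ig; split.
    exact: (fubini_L1_2 (m1 := mu) (m2 := P) (f := g) (measurable_itv _) mA ig).
  exact: (fubini_Rint2 (m1 := mu) (m2 := P) (f := g) (measurable_itv _) mA ig).
have [i1 e1] := f2 (fun s w => Z s w * a' s w) (sN _ ia'Z).
have [i2 e2] := f2 (fun s w => q s w * a' s w - D s w * a s w) (sN _ irest).
rewrite -e2 -[RHS]addr0 -zero -e1.
have z0 : alpha * \int[P]_(w in A) Z t w = 0 by rewrite hmart ?mulr0.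
rewrite -[RHS]addr0 -z0 -!RintegralZl//; [|exact/sA/iZ|exact: sA].
rewrite -!RintegralD//; last first.
- exact/sA/L1Z.
- by apply: L1D => //; exact/sA/L1Z.
- exact/sA/L1Z/iZ.
- by do 2 (apply: L1D => //); exact/sA/L1Z.
have ia'Zw := fubini_ae2 (m1 := mu) (m2 := P) (f := fun s w => a' s w)
   (measurable_itv _) measurableT ia'.
have mrhs : L1 P A (fun w => alpha * q t w
    + \int[mu]_(s in `[t, T]) (q s w * a' s w - D s w * a s w)
    + \int[mu]_(s in `[t, T]) (Z s w * a' s w) + alpha * Z t w).
  apply: (L1D mA); last exact/sA/L1Z/iZ.
  by apply: (L1D mA) => //; apply: (L1D mA) => //; exact/sA/L1Z.
apply: (@Rint_eq_ae _ _ _ P A) => //.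
- exact: L1_measurable (sA _ iaT).
- exact: L1_measurable mrhs.
apply: filterS3 haa' qK ia'Zw => w [hw at_] qw ia'w Aw.
have {ia'w} ia'w := ia'w Logic.I.
have mqw : measurable_fun (`[t, T] : set RR) (q^~ w) by exact: jmeas_section2.
have j1 : L1 mu `[t, T] (fun s => q s w * a' s w).
  apply: (@L1_mulb _ _ _ _ _ _ _ _ K ia'w) => //.
  by apply: aeW => s /=; rewrite in_itv/= => ts; exact: qw.
have j2 : L1 mu `[t, T] (fun s => D s w * a s w).
  rewrite (_ : (fun s => _) = fun s => a s w * D s w); last first.
    by apply/funext => s; rewrite mulrC.
  exact: (AC_mul_L1 tT hw (iD w)).
have j3 : L1 mu `[t, T] (fun s => a' s w * H s w).
  rewrite (_ : (fun s => _) = fun s => H s w * a' s w); last first.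
    by apply/funext => s; rewrite mulrC.
  exact: (AC_mul_L1 tT (hH w) ia'w).
have [_] := AC_mul hw (hH w) TT.
have [_ aT] := hw T TT.
rewrite at_ in aT *.
have -> : H T w = 0 by rewrite /H set_itv1 Rintegral_set1.
rewrite mulr0 (@eq_Rintegral _ _ _ mu `[t, T] (fun s => a' s w * H s w - D s w * a s w)); last first.
  by move=> s _; rewrite mulrN [a s w * _]mulrC.
rewrite RintegralB// => e.
rewrite RintegralB//.
rewrite (@eq_Rintegral _ _ _ mu `[t, T] (fun s => q T w * a' s w + a' s w * H s w - q s w * a' s w)
   (fun s => Z s w * a' s w)); last first.
  by move=> s _; rewrite /Z; ring.
rewrite RintegralB//; last by apply: L1D => //; exact: L1Z.
rewrite RintegralD//; last exact: L1Z.
rewrite RintegralZl//.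
move: e aT; rewrite /Z.
move: (\int[mu]_(x in _) a' x w) (\int[mu]_(x in _) (a' x w * H x w)).
move: (\int[mu]_(x in _) (D x w * a x w)) (\int[mu]_(x in _) (q x w * a' x w)).
move: (a T w) (H t w) (q t w) (q T w) => x1 x2 x3 x4 x5 x6 x7 x8 e ->.
have -> : x8 = x5 - alpha * x2.
  by rewrite -[LHS]subr0 e; ring.
by ring.
Qed.

End statement.
End product_rule.

(** * Quadratic forms and completion of the square *)

Section quadratic_forms.
Context (R : realType).

Definition quad (m : nat) (A : 'M[R]_m) (u : 'cV[R]_m) : R := (u^T *m A *m u) 0 0.

Lemma bilinE m n (A : 'M[R]_(m, n)) (u : 'cV[R]_m) (v : 'cV[R]_n) :
  (u^T *m A *m v) 0 0 = \sum_i \sum_j A i j * (u i 0 * v j 0).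
Proof.
rewrite mxE exchange_big /=; apply: eq_bigr => j _.
rewrite mxE mulr_suml; apply: eq_bigr => i _.
by rewrite mxE mulrAC mulrC mulrA -mulrA mulrCA mulrA.
Qed.

Lemma quadE m (A : 'M[R]_m) u : quad A u = \sum_i \sum_j A i j * (u i 0 * u j 0).
Proof. exact: bilinE. Qed.

Lemma pd_psd m (A : 'M[R]_m) : pdmx A -> psdmx A.
Proof.
move=> [sA pA]; split=> // u; have [->|u0] := eqVneq u 0; last exact/ltW/pA.
by rewrite mulmx0 mxE.
Qed.

Lemma pd_unit m (A : 'M[R]_m) : pdmx A -> A \in unitmx.
Proof.
move=> [sA pA]; rewrite -row_free_unit -kermx_eq0; apply/eqP/row_matrixP => i.
rewrite row0; apply/eqP; apply: contraT => r0.
have rA : row i (kermx A) *m A = 0 by rewrite -row_mul mulmx_ker row0.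
have := pA (row i (kermx A))^T; rewrite trmxK rA mul0mx mxE ltxx => -> //.
by apply: contra r0 => /eqP r0; rewrite -[row _ _]trmxK r0 trmx0.
Qed.

Lemma addmx00 (A B : 'M[R]_1) : (A + B) 0 0 = A 0 0 + B 0 0.
Proof. by rewrite mxE. Qed.

Lemma oppmx00 (A : 'M[R]_1) : (- A) 0 0 = - A 0 0.
Proof. by rewrite mxE. Qed.

Lemma quadD m (A : 'M[R]_m) (u v : 'cV[R]_m) :
  quad A (u + v) = quad A u + (u^T *m A *m v) 0 0 + (v^T *m A *m u) 0 0 + quad A v.
Proof.
have tD : (u + v)^T = u^T + v^T by exact: linearD.
by rewrite /quad tD !mulmxDl !mulmxDr !addmx00 !addrA.
Qed.

Lemma quadZ m (A : 'M[R]_m) k (u : 'cV[R]_m) : quad A (k *: u) = k ^+ 2 * quad A u.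
Proof.
have tZ : (k *: u)^T = k *: u^T by exact: linearZ.
by rewrite /quad tZ -!scalemxAl -scalemxAr scalerA mxE expr2.
Qed.

(** Cauchy-Schwarz for the form of A, applied to u and to A^-1 e_i. *)
Lemma pd_coord_le m (A : 'M[R]_m) (u : 'cV[R]_m) i : pdmx A ->
  0 < invmx A i i /\ u i 0 ^+ 2 <= invmx A i i * quad A u.
Proof.
move=> pdA; have uA := pd_unit pdA; have [sA pA] := pdA.
have [_ psA] := pd_psd pdA.
pose e : 'cV[R]_m := delta_mx i 0; pose v := invmx A *m e.
have Av : A *m v = e by rewrite mulmxA mulmxV// mul1mx.
have vA : v^T *m A = e^T by rewrite -[LHS]trmxK trmx_mul trmxK sA Av.
have eu (w : 'cV[R]_m) : (e^T *m w) 0 0 = w i 0.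
  by rewrite /e trmx_delta -rowE mxE.
have ue (w : 'cV[R]_m) : (w^T *m e) 0 0 = w i 0 by rewrite /e -colE !mxE.
have vi : v i 0 = invmx A i i by rewrite /v /e -colE mxE.
have ve : v != 0.
  apply/eqP => v0; have := Av; rewrite v0 mulmx0 => /matrixP/(_ i 0).
  by rewrite !mxE !eqxx => /eqP; rewrite eq_sym oner_eq0.
have v0 : 0 < invmx A i i by have := pA v ve; rewrite vA eu vi.
split=> //; have := psA (u + - (u i 0 / invmx A i i) *: v); rewrite -/(quad _ _).
set k := - _; have tZ : (k *: v)^T = k *: v^T by exact: linearZ.
rewrite quadD quadZ tZ -!scalemxAl -scalemxAr -[u^T *m A *m v]mulmxA Av vA.
rewrite {2}/quad vA eu [X in _ + X + _]mxE [X in _ + X + _ + _]mxE ue eu vi.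
rewrite /k sqrrN; set c := invmx A i i in vi v0 *.
have -> : quad A u + - (u i 0 / c) * u i 0 + - (u i 0 / c) * u i 0 + (u i 0 / c) ^+ 2 * c
  = quad A u - u i 0 ^+ 2 / c by field; rewrite gt_eqF.
by rewrite subr_ge0 ler_pdivrMr// mulrC.
Qed.

End quadratic_forms.

Section completion.
Context (R : realType) (d : nat) (Lambda : 'M[R]_d) (gamma : 'rV[R]_d).
Local Notation G := (diag_mx gamma).
Hypothesis pdL : pdmx Lambda.
Hypothesis g0 : forall i, 0 < gamma 0 i.

Lemma gamma_unit : G \in unitmx.
Proof.
by rewrite unitmxE det_diag unitfE prodf_seq_neq0; apply/allP => i _; rewrite gt_eqF ?g0.
Qed.

Lemma invmx_gamma : invmx G = diag_mx (\row_i (gamma 0 i)^-1).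
Proof.
rewrite -[RHS]mul1mx -(mulVmx gamma_unit) -mulmxA mulmx_diag.
rewrite (_ : diag_mx _ = 1%:M) ?mulmx1//; apply/matrixP => i j; rewrite !mxE.
by case: eqVneq => [->|_]; rewrite ?mulr1n ?mulr0n// mulfV// gt_eqF.
Qed.

(** The rate at which the resilience of the impact dissipates energy. *)
Definition dissipation (r : 'rV[R]_d) (Y : 'cV[R]_d) : R :=
  \sum_i (gamma 0 i)^-1 * (r 0 i * Y i 0 ^+ 2).

(** The running cost up to the time derivative of the energy 1/2 Y^T gamma^-1
    Y stored in the impact; the bilinear term Y^T xi is absorbed, which leaves
    a nonnegative cost. *)
Definition kcost (r : 'rV[R]_d) (S : 'M[R]_d) (xi X Y : 'cV[R]_d) : R :=
  2^-1 * quad Lambda xi + 2^-1 * quad S X + dissipation r Y.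

Definition energy (Y : 'cV[R]_d) : R := \sum_i (gamma 0 i)^-1 * Y i 0 ^+ 2.

(** The right-hand side of the state equation for (X, Y). *)
Definition velocity (r : 'rV[R]_d) (xi Y : 'cV[R]_d) : 'cV[R]_(d + d) :=
  col_mx (- xi) (- (diag_mx r *m Y) + G *m xi).

Lemma dissipation_ge0 (r : 'rV[R]_d) Y : (forall i, 0 <= r 0 i) -> 0 <= dissipation r Y.
Proof.
move=> r0; apply: sumr_ge0 => i _; apply: mulr_ge0; first by rewrite invr_ge0 ltW.
by apply: mulr_ge0 => //; exact: sqr_ge0.
Qed.

Lemma kcost_ge (r : 'rV[R]_d) S xi X Y : (forall i, 0 <= r 0 i) -> psdmx S ->
  2^-1 * quad Lambda xi <= kcost r S xi X Y.
Proof.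
move=> r0 [_ pS]; rewrite /kcost -addrA lerDl addr_ge0//.
  by rewrite mulr_ge0//; exact: pS.
exact: dissipation_ge0.
Qed.

Lemma dissipationE r Y :
  (Y^T *m (invmx G *m diag_mx r + diag_mx r *m invmx G) *m Y) 0 0 = 2 * dissipation r Y.
Proof.
rewrite invmx_gamma !mulmx_diag bilinE mulr_sumr; apply: eq_bigr => i _.
rewrite (bigD1 i)//= big1 ?addr0.
  by rewrite !mxE eqxx !mulr1n; ring.
move=> j ij; rewrite !mxE (eq_sym i) (negPf ij) !mulr0n addr0 mul0r//.
Qed.

(** With B the column block of -1 and gamma, the feedback is -v for v =
    Lambda^-1 B^T Q z, and the quadratic term of the Riccati drift is -v^T
    Lambda v. Together with the control cost xi^T Lambda xi and the terms of
    the derivative that are linear in xi it makes up the square of xi + v; all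
    other terms cancel. *)
Lemma square_completion (r : 'rV[R]_d) (S : 'M[R]_d) (Q : 'M[R]_(d + d))
    (xi X Y : 'cV[R]_d) : Q^T = Q ->
  let z := col_mx X Y in let z' := velocity r xi Y in
  (z'^T *m Q *m z) 0 0 + (z^T *m Q *m z') 0 0
    - (z^T *m riccati_drift Lambda gamma r S Q *m z) 0 0
  = quad Lambda (xi - feedback Lambda gamma Q X Y) - 2 * kcost r S xi X Y.
Proof.
move=> sQ z z'; have [sL _] := pdL; have uL := pd_unit pdL.
pose B : 'M[R]_(d + d, d) := col_mx (- 1%:M) G.
pose C : 'M[R]_(d + d) := block_mx 0 0 0 (- diag_mx r).
have BT : B^T = row_mx (- 1%:M) G by rewrite tr_col_mx linearN/= trmx1 tr_diag_mx.
have CT : C^T = C by rewrite tr_block_mx !trmx0 linearN/= tr_diag_mx.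
have z'E : z' = B *m xi + C *m z.
  rewrite /z' /velocity /B /C /z mul_col_mx mul_block_col add_col_mx.
  by rewrite !mul0mx !addr0 add0r mulNmx mul1mx mulNmx addrC.
pose v := invmx Lambda *m B^T *m Q *m z.
have vE : xi - feedback Lambda gamma Q X Y = xi + v.
  by rewrite /feedback /v BT opprK.
have Lv : Lambda *m v = B^T *m Q *m z by rewrite /v !mulmxA mulmxV// mul1mx.
have vL : v^T *m Lambda = z^T *m Q *m B.
  by rewrite -[LHS]trmxK trmx_mul trmxK sL Lv !trmx_mul trmxK sQ mulmxA.
have vLv : v^T *m Lambda *m v = z^T *m (Q *m B *m invmx Lambda *m B^T *m Q) *m z.
  by rewrite vL /v !mulmxA.
set S2 := block_mx S 0 0 (invmx G *m diag_mx r + diag_mx r *m invmx G).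
have zS : (z^T *m S2 *m z) 0 0 = quad S X + 2 * dissipation r Y.
  rewrite /z /S2 tr_col_mx mul_row_block !mulmx0 addr0 add0r mul_row_col addmx00.
  by rewrite dissipationE.
have kE : 2 * kcost r S xi X Y = quad Lambda xi + (z^T *m S2 *m z) 0 0.
  by rewrite zS /kcost; field.
have t1 : z'^T *m Q *m z = xi^T *m (Lambda *m v) + z^T *m C *m Q *m z.
  by rewrite z'E linearD/= !trmx_mul CT !mulmxDl Lv !mulmxA.
have t2 : z^T *m Q *m z' = v^T *m Lambda *m xi + z^T *m Q *m C *m z.
  by rewrite z'E mulmxDr vL !mulmxA.
have t3 : z^T *m riccati_drift Lambda gamma r S Q *m z = - (v^T *m Lambda *m v)
    + z^T *m Q *m C *m z + z^T *m C *m Q *m z + z^T *m S2 *m z.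
  rewrite vLv /riccati_drift -/B -/C -BT -/S2 !mulmxDr !mulmxDl mulmxN mulNmx.
  by rewrite !mulmxA.
rewrite vE kE quadD t1 t2 t3 !addmx00 oppmx00 mulmxA /quad.
by ring.
Qed.

End completion.

(** * Matrix-valued functions with entries in a ring of functions *)

(** One closure argument serves for matrix expressions over measurable
    functions, over bounded functions and over convergent sequences; the
    latter are functions on [option nat] with the limit at [None]. *)
Record function_ring (R : realType) (X : Type) (S : (X -> R) -> Prop) : Prop := {
  function_ring_cst : forall c, S (fun=> c);
  function_ringD : forall f g, S f -> S g -> S (fun x => f x + g x);
  function_ringM : forall f g, S f -> S g -> S (fun x => f x * g x) }.

Section entries.
Context (R : realType) (X : Type) (S : (X -> R) -> Prop).
Hypothesis hS : function_ring S.

Definition entries m n (f : X -> 'M[R]_(m, n)) : Prop :=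
  forall i j, S (fun x => f x i j).

Let eqS (f g : X -> R) : f =1 g -> S f -> S g.
Proof. by move=> /funext ->. Qed.

Lemma function_ring_sum (I : Type) (s : seq I) (h : I -> X -> R) :
  (forall i, S (h i)) -> S (fun x => \sum_(i <- s) h i x).
Proof.
move=> hh; elim: s => [|i s ih].
  by apply: eqS (function_ring_cst hS 0) => x; rewrite big_nil.
by apply: eqS (function_ringD hS (hh i) ih) => x; rewrite big_cons.
Qed.

Lemma entries_cst m n (A : 'M[R]_(m, n)) : entries (fun=> A).
Proof. by move=> i j; exact: function_ring_cst. Qed.

Lemma entries_add m n (f g : X -> 'M[R]_(m, n)) :
  entries f -> entries g -> entries (fun x => f x + g x).
Proof.
by move=> hf hg i j; apply: eqS (function_ringD hS (hf i j) (hg i j)) => x; rewrite mxE.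
Qed.

Lemma entries_mul m n p (f : X -> 'M[R]_(m, n)) (g : X -> 'M[R]_(n, p)) :
  entries f -> entries g -> entries (fun x => f x *m g x).
Proof.
move=> hf hg i j; apply: (@eqS (fun x => \sum_k f x i k * g x k j)).
  by move=> x; rewrite mxE.
by apply: function_ring_sum => k; exact: function_ringM.
Qed.

Lemma entries_opp m n (f : X -> 'M[R]_(m, n)) :
  entries f -> entries (fun x => - f x).
Proof.
move=> hf i j; apply: eqS (function_ringM hS (function_ring_cst hS (-1)) (hf i j)) => x.
by rewrite mulN1r mxE.
Qed.

Lemma entries_tr m n (f : X -> 'M[R]_(m, n)) :
  entries f -> entries (fun x => (f x)^T).
Proof. by move=> hf i j; apply: eqS (hf j i) => x; rewrite mxE. Qed.

Lemma entries_col m1 m2 n (f : X -> 'M[R]_(m1, n)) (g : X -> 'M[R]_(m2, n)) :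
  entries f -> entries g -> entries (fun x => col_mx (f x) (g x)).
Proof.
move=> hf hg i j; rewrite -(splitK i); case: (fintype.split i) => k /=.
  by apply: eqS (hf k j) => x; rewrite col_mxEu.
by apply: eqS (hg k j) => x; rewrite col_mxEd.
Qed.

Lemma entries_row m n1 n2 (f : X -> 'M[R]_(m, n1)) (g : X -> 'M[R]_(m, n2)) :
  entries f -> entries g -> entries (fun x => row_mx (f x) (g x)).
Proof.
move=> hf hg i j; rewrite -(splitK j); case: (fintype.split j) => k /=.
  by apply: eqS (hf i k) => x; rewrite row_mxEl.
by apply: eqS (hg i k) => x; rewrite row_mxEr.
Qed.

Lemma entries_block m1 m2 n1 n2 (f1 : X -> 'M[R]_(m1, n1)) (f2 : X -> 'M[R]_(m1, n2))
    (f3 : X -> 'M[R]_(m2, n1)) (f4 : X -> 'M[R]_(m2, n2)) :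
  entries f1 -> entries f2 -> entries f3 -> entries f4 ->
  entries (fun x => block_mx (f1 x) (f2 x) (f3 x) (f4 x)).
Proof. by move=> h1 h2 h3 h4; apply: entries_col; apply: entries_row. Qed.

Lemma entries_diag n (f : X -> 'rV[R]_n) :
  entries f -> entries (fun x => diag_mx (f x)).
Proof.
move=> hf i j; apply: (@eqS (fun x => f x 0 i *+ (i == j))) => [x|].
  by rewrite mxE.
by case: (i == j); [exact: hf|exact: function_ring_cst].
Qed.

Lemma entries_quad n (A : X -> 'M[R]_n) (u : X -> 'cV[R]_n) :
  entries A -> entries u -> S (fun x => quad (A x) (u x)).
Proof.
by move=> hA hu; apply: entries_mul => //; apply: entries_mul => //; exact: entries_tr.
Qed.

Variables (d : nat) (Lambda : 'M[R]_d) (gamma : 'rV[R]_d).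

Lemma entries_riccati (r : X -> 'rV[R]_d) (Sg : X -> 'M[R]_d) (Q : X -> 'M[R]_(d + d)) :
  entries r -> entries Sg -> entries Q ->
  entries (fun x => riccati_drift Lambda gamma (r x) (Sg x) (Q x)).
Proof.
move=> hr hSg hQ; have hd := entries_diag hr; have h0 := @entries_cst d d 0.
have hC : entries (fun x => block_mx 0 0 0 (- diag_mx (r x)) : 'M[R]_(d + d)).
  by apply: entries_block => //; exact: entries_opp.
rewrite /riccati_drift; apply: entries_add; last first.
  by apply: entries_block => //; apply: entries_add; apply: entries_mul => //; exact: entries_cst.
apply: entries_add; last exact: entries_mul.
apply: entries_add; last exact: entries_mul.
apply: entries_opp; do 4 (apply: entries_mul => //; try exact: entries_cst).
Qed.

Lemma entries_feedback (Q : X -> 'M[R]_(d + d)) (x y : X -> 'cV[R]_d) :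
  entries Q -> entries x -> entries y ->
  entries (fun p => feedback Lambda gamma (Q p) (x p) (y p)).
Proof.
move=> hQ hx hy; apply: entries_opp; apply: entries_mul; last exact: entries_col.
by apply: entries_mul => //; exact: entries_cst.
Qed.

End entries.

Section function_rings.
Context (R : realType).

Lemma measurable_function_ring d (X : measurableType d) (D : set X) :
  function_ring (fun f : X -> R => measurable_fun D f).
Proof.
split=> [c|f g|f g]; [exact: measurable_cst|exact: measurable_funD|exact: measurable_funM].
Qed.

Lemma bounded_function_ring (X : Type) (D : set X) :
  function_ring (fun f : X -> R => exists K, forall x, D x -> `|f x| <= K).
Proof.
split=> [c|f g [K hK] [L hL]|f g [K hK] [L hL]].
- by exists `|c|.
- exists (K + L) => x Dx; apply: (le_trans (ler_normD _ _)).
  by rewrite lerD ?hK ?hL.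
- by exists (K * L) => x Dx; rewrite normrM ler_pM ?hK ?hL.
Qed.

Lemma cvg_function_ring :
  function_ring (fun f : option nat -> R => f (Some n) @[n --> \oo] --> f None).
Proof. by split=> [c|f g|f g]; [exact: cvg_cst|exact: cvgD|exact: cvgM]. Qed.

End function_rings.

(** * A damped linear equation *)

Section pathwise.
Context (R : realType).
Local Notation mu := (@lebesgue_measure R).
Implicit Types (t T g : R) (Y r xi : R -> R).

(** If a exceeded the bound then a >= b, and dividing the hypothesis by a
    would give a <= b + 2 g I. *)
Lemma sqr_le_bound (a b g I : R) : 0 <= g -> 0 <= I -> 0 <= a -> 0 <= b ->
  a ^+ 2 <= b ^+ 2 + 2 * g * a * I -> a <= b + 2 * g * I.
Proof.
move=> g0 I0 a0 b0 key.
rewrite leNgt; apply/negP => h.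
have gI : 0 <= g * I by exact: mulr_ge0.
have ab : b <= a by apply: ltW; apply: le_lt_trans h; rewrite lerDl -mulrA mulr_ge0.
have a1 : 0 < a by apply: le_lt_trans h; rewrite addr_ge0// -mulrA mulr_ge0.
have h1 : a * (b + 2 * g * I) < a * a by rewrite ltr_pM2l.
have h2 : b * b <= a * b by rewrite ler_wpM2r.
by move: key h1 h2; rewrite !expr2; nra.
Qed.

(** Since r >= 0, the resilience can only decrease Y^2; the bound follows at a
    time where Y^2 is maximal. *)
Lemma resilience_bound t T Y r xi g : t <= T -> 0 <= g ->
  (forall s, t <= s <= T -> 0 <= r s) -> L1 mu `[t, T] xi ->
  is_AC t T Y (fun s => - (r s * Y s) + g * xi s) ->
  forall s, t <= s <= T ->
  `|Y s| <= `|Y t| + 2 * g * \int[mu]_(u in `[t, T]) `|xi u|.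
Proof.
move=> tT g0 r0 ixi hY; set I := \int[mu]_(u in _) _.
have hYY := AC_mul hY hY.
have [c cT cmax] := EVT_max tT (AC_continuous tT hYY).
have ct : t <= c <= T by move: cT; rewrite in_itv.
have /andP[tc cT'] := ct.
have Ymax s : t <= s <= T -> `|Y s| <= `|Y c|.
  move=> ts; rewrite -ler_sqr ?nnegrE// !real_normK ?num_real//.
  by have := cmax s; rewrite in_itv/= ts !expr2 => /(_ isT).
have I0 : 0 <= I by apply: Rintegral_ge0.
have [i1 YYc] := hYY c ct.
have key : `|Y c| ^+ 2 <= `|Y t| ^+ 2 + 2 * g * `|Y c| * I.
  rewrite !real_normK ?num_real// expr2 YYc -expr2 lerD2l.
  apply: (@le_trans _ _ (\int[mu]_(u in `[t, c]) (2 * g * `|Y c| * `|xi u|))).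
    apply: le_Rintegral => //.
      by apply: L1Z => //; apply: L1_norm; exact: L1_itvS ixi.
    move=> u; rewrite /= in_itv/= => /andP[tu uc].
    have tuT : t <= u <= T by rewrite tu (le_trans uc).
    have rY : 0 <= r u * Y u ^+ 2 by rewrite mulr_ge0 ?sqr_ge0 ?r0.
    have : xi u * Y u <= `|xi u| * `|Y c|.
      by rewrite (le_trans (ler_norm _))// normrM ler_wpM2l// Ymax.
    move/(ler_wpM2l g0); rewrite expr2 in rY.
    move: rY; clear; move: (`|Y c|) (`|xi u|) (Y u) (xi u) (r u) => a b e f h.
    by lra.
  rewrite RintegralZl//; last by apply: L1_norm; exact: L1_itvS ixi.
  rewrite ler_wpM2l ?mulr_ge0//.
  rewrite /I (@Rint_itv_split _ t c T)// ?ct//; last exact: L1_norm.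
  by rewrite lerDl; apply: Rintegral_ge0.
move=> s ts; apply: (le_trans (Ymax _ ts)).
exact: sqr_le_bound.
Qed.

End pathwise.

(** * Square-integrable processes *)

Section processes.
Context (R : realType) (disp : measure_display) (Omega : measurableType disp).
Variable (P : probability Omega R).
Local Notation mu := (@lebesgue_measure R).
Local Notation RR := (measurableTypeR R).
Local Notation nu := (mu \x P)%E.

(** The square-integrability of a process is expressed by an iterated
    integral, the estimates by integrals over the product. *)
Lemma tonelli a b (h : R -> Omega -> R) : jmeas a b h -> (forall s w, 0 <= h s w) ->
  (\int[P]_w \int[mu]_(s in `[a, b]) (h s w)%:E
   = \int[nu]_(p in `[a, b] `*` setT) (h p.1 p.2)%:E)%E.
Proof.
move=> mh h0; pose D := (`[a, b] : set RR) `*` [set: Omega].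
have mD : measurable D by exact: measurableX.
pose g := (EFin \o (fun p : RR * Omega => h p.1 p.2)) \_ D.
have mg : measurable_fun setT g.
  by apply/(measurable_restrictT _ mD)/measurable_EFinP; exact: mh.
have g0 p : (0 <= g p)%E by rewrite /g patchE; case: ifP => // _; rewrite lee_fin.
rewrite [RHS]integral_mkcond -/g (fubini_tonelli2 g mg g0).
apply: eq_integral => w _; rewrite /fubini_G [LHS]integral_mkcond.
apply: eq_integral => s _.
rewrite /g !patchE; congr (if _ then _ else _).
by apply/idP/idP => /set_mem; [move=> h'; apply: mem_set; split|case=> h' _; exact: mem_set].
Qed.

Lemma L2F_jmeas W a b f : L2F P W a b f -> jmeas a b f.
Proof. by case. Qed.

Lemma jmeas_sqr a b (f : R -> Omega -> R) : jmeas a b f -> jmeas a b (fun s w => f s w ^+ 2).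
Proof. by move=> mf; apply: measurable_funX. Qed.

Lemma L2F_L1 W a b f : L2F P W a b f ->
  L1 nu (`[a, b] `*` setT) (fun p => f p.1 p.2 ^+ 2).
Proof.
move=> [_ mf lf]; have mf2 := @jmeas_sqr a b f mf.
apply/integrableP; split; first by apply/measurable_EFinP; exact: mf2.
rewrite (eq_integral (fun p : RR * Omega => (f p.1 p.2 ^+ 2)%:E)); last first.
  by move=> p _ /=; rewrite ger0_norm ?sqr_ge0.
by rewrite -(tonelli mf2)// => s w; exact: sqr_ge0.
Qed.

Lemma L2F_intro W a b f : adapted P W a b f -> jmeas a b f ->
  L1 nu (`[a, b] `*` setT) (fun p => f p.1 p.2 ^+ 2) -> L2F P W a b f.
Proof.
move=> af mf lf; split=> //; rewrite (tonelli (jmeas_sqr mf)); last by move=> s w; exact: sqr_ge0.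
have /integrableP[_] := lf; rewrite (eq_integral (fun p : RR * Omega => (f p.1 p.2 ^+ 2)%:E))//.
by move=> p _ /=; rewrite ger0_norm ?sqr_ge0.
Qed.

Lemma L1_snd a b (J : Omega -> R) : L1 P setT J ->
  L1 nu ((`[a, b] : set RR) `*` setT) (fun p => J p.2).
Proof.
move=> iJ.
have mJ : jmeas a b (fun _ w => `|J w|).
  apply: measurable_funTS; apply: (@measurableT_comp _ _ _ _ Omega _ (fun w => `|J w|)).
    by apply: measurableT_comp => //; exact: L1_measurable iJ.
  exact: measurable_snd.
apply/integrableP; split.
  apply/measurable_EFinP; apply: measurable_funTS; apply: measurableT_comp.
    exact: L1_measurable iJ.
  exact: measurable_snd.
rewrite (eq_integral (fun p : RR * Omega => (`|J p.2|)%:E))//.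
have := tonelli mJ (fun s w => normr_ge0 (J w)) => /= <-.
have /integrableP[_] := L1Z measurableT (fine (mu `[a, b])) (L1_norm iJ).
apply: le_lt_trans; apply: ge0_le_integral => //.
- by move=> w _; apply: integral_ge0.
- have -> : (fun w => \int[mu]_(s in `[a, b]) (`|J w|)%:E)%E
      = fun w => (\int[mu]_(s in `[a, b]) `|J w|)%:E.
    apply/funext => w; rewrite RintE//; apply: L1_cst => //.
    exact: (lebesgue_itv_lty a b).
  by apply/measurable_EFinP; exact: (measurable_Rint_section mu).
- do 2 apply: measurableT_comp => //; apply: measurable_funM => //.
  by apply: measurableT_comp => //; exact: L1_measurable iJ.
- move=> w _; rewrite integral_cst//=.
  rewrite (le_trans _ (_ : (`|J w| * fine (mu `[a, b]))%:E <= _)%E)//.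
    rewrite EFinM fineK// ge0_fin_numE//; exact: (lebesgue_itv_lty a b).
  by rewrite lee_fin mulrC ler_norm.
Qed.

End processes.

(** * Truncation *)

Section clip.
Context (R : realType).

(** Coefficients that are bounded almost everywhere are truncated, so that
    bounds which are needed at every point are available at no cost. *)
Definition clip (K x : R) : R := Num.max (- K) (Num.min K x).

Lemma clip_le K x : 0 <= K -> `|clip K x| <= K.
Proof.
move=> K0; rewrite ler_norml /clip le_max lexx/= ge_max ge_min lexx/= andbT.
by rewrite (le_trans _ K0)// oppr_le0.
Qed.

Lemma clip_id K x : `|x| <= K -> clip K x = x.
Proof. by rewrite ler_norml /clip => /andP[h1 h2]; rewrite (min_idPr h2) (max_idPr h1). Qed.

Lemma measurable_clip d (X : measurableType d) (D : set X) K (f : X -> R) :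
  measurable_fun D f -> measurable_fun D (fun x => clip K (f x)).
Proof. by move=> mf; apply: measurable_maxr => //; exact: measurable_minr. Qed.

End clip.

(** * Geometric bounds *)

Section geometric.
Context (R : realType).
Implicit Types (C x : R).

Lemma half_exp_gt0 k : 0 < (2^-1 : R) ^+ k.
Proof. by rewrite exprn_gt0// invr_gt0. Qed.

Lemma cvg_half_exp C : C * 2^-1 ^+ k @[k --> \oo] --> 0.
Proof. by have := @cvg_geometric R C 2^-1; apply; rewrite ger0_norm// invf_lt1// ltr1n. Qed.

(** Equalities between limits are obtained in this form, from bounds that hold
    along the sequence. *)
Lemma half_exp_small C x : (forall k, `|x| <= C * 2^-1 ^+ k) -> x = 0.
Proof.
move=> h; apply/eqP; rewrite -normr_le0.
rewrite -(cvg_lim (@Rhausdorff R) (cvg_half_exp C)); apply: limr_ge; last exact: nearW.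
exact: cvgP (cvg_half_exp C).
Qed.

(** The sequences u k - 2 C / 2^k and u k + 2 C / 2^k are monotone and enclose
    the limit. *)
Lemma geometric_cauchy (u : nat -> R) C : 0 <= C -> (forall k, `|u k.+1 - u k| <= C * 2^-1 ^+ k) ->
  exists l, u k @[k --> \oo] --> l /\ forall k, `|l - u k| <= 2 * C * 2^-1 ^+ k.
Proof.
move=> C0 hu.
have h2 k : 2 * C * 2^-1 ^+ k.+1 = C * 2^-1 ^+ k :> R.
  by rewrite exprS; field.
have h3 k : 2 * C * 2^-1 ^+ k = C * 2^-1 ^+ k + C * 2^-1 ^+ k by ring.
pose lo k := u k - 2 * C * 2^-1 ^+ k; pose up k := u k + 2 * C * 2^-1 ^+ k.
have lo_nd : nondecreasing_seq lo.
  apply/nondecreasing_seqP => k; rewrite /lo h2 h3.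
  by have := hu k; rewrite ler_norml => /andP[h _]; lra.
have up_ni : nonincreasing_seq up.
  apply/nonincreasing_seqP => k; rewrite /up h2 h3.
  by have := hu k; rewrite ler_norml => /andP[_ h]; lra.
have lo_up k : lo k <= up k.
  have := half_exp_gt0 k; have : 0 <= 2 * C * 2^-1 ^+ k.
    by rewrite !mulr_ge0// ltW// half_exp_gt0.
  by rewrite /lo /up; lra.
have cl : cvgn lo.
  apply: nondecreasing_is_cvgn => //; exists (up 0%N) => _ [k _ <-].
  by rewrite (le_trans (lo_up k))// up_ni.
have cu' : u k @[k --> \oo] --> limn lo.
  rewrite (_ : u = fun k => lo k + 2 * C * 2^-1 ^+ k); last first.
    by apply/funext => k; rewrite /lo subrK.
  by rewrite -[X in _ --> X]addr0; apply: cvgD => //; exact: cvg_half_exp.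
have cup : up k @[k --> \oo] --> limn lo.
  by rewrite -[X in _ --> X]addr0; apply: cvgD => //; exact: cvg_half_exp.
exists (limn lo); split=> // k; rewrite ler_norml.
have := nondecreasing_cvgn_le lo_nd cl k.
have := nonincreasing_cvgn_ge up_ni (cvgP _ cup) k; rewrite (cvg_lim (@Rhausdorff R) cup).
by move: (limn lo); rewrite /lo /up => l hu' hl; apply/andP; split; lra.
Qed.

Local Notation mu := (@lebesgue_measure R).

(** The estimate behind the weighted norm in which Picard's iteration
    contracts. *)
Lemma expR_integral (c a b : R) : 0 < c -> a <= b ->
  L1 mu `[a, b] (fun u => expR (c * u)) /\
  \int[mu]_(u in `[a, b]) expR (c * u) <= c^-1 * expR (c * b).
Proof.
move=> c0 ab.
have cE : continuous (fun u : R => expR (c * u)).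
  move=> u; apply: continuous_comp; last exact: continuous_expR.
  exact: mulrl_continuous.
have iE : L1 mu `[a, b] (fun u => expR (c * u)).
  apply: continuous_compact_integrable; first exact: segment_compact.
  exact: continuous_subspaceT.
split=> //; have [->|ab'] := eqVneq a b.
  by rewrite set_itv1 Rintegral_set1 mulr_ge0 ?invr_ge0 ?expR_ge0// ltW.
have {}ab' : a < b by rewrite lt_neqAle ab'.
have dF (u : R) : is_derive u (1 : R) (fun u => c^-1 * expR (c * u)) (expR (c * u)).
  have h1 : is_derive u (1 : R) (c \*: (@id R)) (c *: (1 : R)) by exact: is_deriveZ.
  have h2 := @is_derive1_comp R (@expR R) (c \*: (@id R)) u _ _ (is_derive_expR _) h1.
  have h3 := is_deriveZ c^-1 h2.
  apply: (is_derive_eq h3); rewrite /GRing.scale /= mulr1 [X in c^-1 * X]mulrC mulrA mulVf ?mul1r//.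
  by rewrite gt_eqF.
pose F u := c^-1 * expR (c * u).
rewrite /Rintegral (@continuous_FTC2 R (fun u => expR (c * u)) F a b ab').
- by rewrite -EFinB /= /F lerBlDr lerDl mulr_ge0 ?invr_ge0 ?expR_ge0// ltW.
- exact: continuous_subspaceT.
- split.
  + by move=> u _; exact: (@ex_derive _ _ _ _ _ _ _ (dF u)).
  + by apply/cvg_at_right_filter; apply: cvgMr; exact: cE.
  + by apply/cvg_at_left_filter; apply: cvgMr; exact: cE.
- by move=> u _; rewrite derive1E (@derive_val _ _ _ _ _ _ _ (dF u)).
Qed.

End geometric.

(** * Linear differential equations with random coefficients *)

Section linear_ode.
Context (R : realType) (disp : measure_display) (Omega : measurableType disp).
Variables (P : probability Omega R) (W : R -> Omega -> R) (T : R).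
Hypothesis hF : full_filtration P W T.
Local Notation mu := (@lebesgue_measure R).
Local Notation RR := (measurableTypeR R).
Local Notation Fm s f := (measurable_fun setT (f : filtered P W s -> R)).
Variables (m : nat) (t K : R) (A : R -> Omega -> 'M[R]_m) (b z0 : 'cV[R]_m).
Hypotheses (t0 : 0 <= t) (tT : t <= T) (K0 : 0 <= K).
Hypothesis pA : entrywise (progressive P W T) A.
Hypothesis bA : forall s w i j, `|A s w i j| <= K.
Implicit Types (z : R -> Omega -> 'cV[R]_m).

Let field z s w : 'cV[R]_m := A s w *m z s w + b.

Let step z s w : 'cV[R]_m :=
  \col_i (z0 i 0 + \int[mu]_(u in `[t, s]) field z u w i 0).

Let good z := [/\ entrywise (adapted P W t T) z, entrywise (continuous_paths t T) z
  & exists2 C, 0 <= C & forall s w i, t <= s <= T -> `|z s w i 0| <= C].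

Let fieldE z s w i : field z s w i 0 = \sum_j A s w i j * z s w j 0 + b i 0.
Proof. by rewrite /field !mxE. Qed.

Let field_sub z z' s w i : field z s w i 0 - field z' s w i 0
  = \sum_j A s w i j * (z s w - z' s w) j 0.
Proof.
rewrite !fieldE opprD addrACA subrr addr0 -sumrB; apply: eq_bigr => j _.
by rewrite !mxE mulrBr.
Qed.

Let mulA_le C (v : 'cV[R]_m) s w i : (forall j, `|v j 0| <= C) ->
  `|\sum_j A s w i j * v j 0| <= m%:R * K * C.
Proof.
move=> hv; apply: (le_trans (ler_norm_sum _ _ _)).
apply: (@le_trans _ _ (\sum_(j < m) K * C)).
  by apply: ler_sum => j _; rewrite normrM ler_pM.
by rewrite sumr_const card_ord -(mulr_natl (K * C)) mulrA.
Qed.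

Let measurable_path (z : R -> Omega -> R) s w : continuous_paths t T z -> t <= s <= T ->
  measurable_fun (`[t, s] : set RR) (z^~ w).
Proof.
move=> cz /andP[ts sT]; apply: subspace_continuous_measurable_fun => //.
apply: continuous_subspaceW (cz w) => u /=; rewrite !in_itv/= => /andP[-> us].
exact: le_trans us sT.
Qed.

Let measurable_A i j w s : t <= s <= T -> measurable_fun (`[t, s] : set RR) (fun u => A u w i j).
Proof.
move=> /andP[ts sT].
have := progressive_jmeas hF (pA i j) (le_trans t0 tT).
move=> /(jmeasS t0 sT) h.
exact: (jmeas_section2 w h).
Qed.

Let field_L1 z C : (forall i w, measurable_fun (`[t, T] : set RR) (fun s => z s w i 0)) ->
  (forall s w i, t <= s <= T -> `|z s w i 0| <= C) -> forall s w i, t <= s <= T ->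
  L1 mu `[t, s] (fun u => field z u w i 0).
Proof.
move=> mz zC s w i ts; have /andP[ts' sT] := ts.
have mts : measurable (`[t, s] : set RR) by exact: measurable_itv.
rewrite (_ : (fun u => _) = fun u => \sum_j A u w i j * z u w j 0 + b i 0); last first.
  by apply/funext => u; rewrite fieldE.
apply: (L1D mts); last first.
  by apply: L1_cst => //; exact: (lebesgue_itv_lty t s).
apply: (@L1_bounded _ _ _ _ _ _ (m%:R * K * C) mts).
- exact: (lebesgue_itv_lty t s).
- apply: measurable_sum => j; apply: measurable_funM; first exact: measurable_A.
  apply: measurable_funS (mz j w) => // u /=; rewrite !in_itv/= => /andP[-> us].
  exact: le_trans us sT.
- apply: aeW => u /=; rewrite in_itv/= => /andP[tu us]; apply: mulA_le => j.
  by apply: zC; rewrite tu (le_trans us sT).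
Qed.

Let good_L1 z : good z -> forall s w i, t <= s <= T ->
  L1 mu `[t, s] (fun u => field z u w i 0).
Proof.
move=> [_ cz [C C0 hC]]; apply: field_L1 hC => i w.
by apply: (measurable_path w (cz i 0)); rewrite tT lexx.
Qed.

Let field_progressive z s i : good z -> t <= s <= T ->
  measurable_fun ((`[t, s] : set RR) `*` [set: filtered P W s])
    (fun p : RR * filtered P W s => field z p.1 p.2 i 0).
Proof.
move=> [az cz _] ts; have /andP[ts' sT] := ts.
rewrite (_ : (fun p : RR * filtered P W s => _) =
  fun p => \sum_j A p.1 p.2 i j * z p.1 p.2 j 0 + b i 0); last first.
  by apply/funext => p; rewrite fieldE.
apply: measurable_funD => //; apply: measurable_sum => j; apply: measurable_funM.
  have := pA i j (t := s); rewrite (le_trans t0 ts') sT => /(_ isT).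
  apply: measurable_funS; first exact: measurableX.
  by move=> -[u w] [/=]; rewrite !in_itv/= => /andP[tu ->] _; rewrite (le_trans t0 tu).
exact: (continuous_progressive (az j 0) (cz j 0) ts).
Qed.

Let step_AC z w i : good z -> is_AC t T (fun s => step z s w i 0) (fun s => field z s w i 0).
Proof.
move=> gz; apply: (@AC_intro _ _ _ _ _ (z0 i 0)) => //.
  by apply: good_L1 => //; rewrite tT lexx.
by move=> s ts; rewrite mxE.
Qed.

Let step_good z : good z -> good (step z).
Proof.
move=> gz; have [az cz [C C0 hC]] := gz; split.
- move=> i j s ts; rewrite (ord1 j).
  rewrite (_ : (fun w => _) = fun w => z0 i 0 + \int[mu]_(u in `[t, s]) field z u w i 0); last first.
    by apply/funext => w; rewrite mxE.
  apply: measurable_funD => //.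
  exact: (measurable_Rint_section mu _ (field_progressive i gz ts)).
- move=> i j w; rewrite (ord1 j); exact: AC_continuous (step_AC w i gz).
- pose B := (m%:R * K * C + \sum_i `|b i 0|) * (T - t) + \sum_i `|z0 i 0|.
  have sum_le (v : 'cV[R]_m) i : `|v i 0| <= \sum_i `|v i 0|.
    by rewrite (bigD1 i)//= lerDl sumr_ge0.
  have sum0 (v : 'cV[R]_m) : 0 <= \sum_i `|v i 0| by exact: sumr_ge0.
  have c0 : 0 <= m%:R * K * C by rewrite !mulr_ge0.
  have B0 : 0 <= (m%:R * K * C + \sum_i `|b i 0|) * (T - t).
    by apply: mulr_ge0; [exact: addr_ge0|rewrite subr_ge0].
  exists B; first exact: addr_ge0.
  move=> s w i ts; apply: (le_trans (AC_le ts (step_AC w i gz))).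
  rewrite /B addrC lerD//; last first.
    by rewrite mxE set_itv1 Rintegral_set1 addr0.
  have TT : t <= T <= T by rewrite tT lexx.
  rewrite -[T - t]/(fine (T - t)%:E).
  have mtT : measurable (`[t, T] : set RR) by exact: measurable_itv.
  apply: (@le_trans _ _ (\int[mu]_(u in `[t, T]) (m%:R * K * C + \sum_i `|b i 0|))).
    apply: le_Rintegral => //.
    + by apply: L1_norm; exact: good_L1.
    + by apply: L1_cst => //; exact: (lebesgue_itv_lty t T).
    + move=> u; rewrite /= in_itv/= => tu; rewrite fieldE (le_trans (ler_normD _ _))//.
      by rewrite lerD//; apply: mulA_le => j; exact: hC.
  by rewrite Rintegral_cst//= lebesgue_measure_itv/= lte_fin; case: ltP => h //=;
    rewrite mulr0.
Qed.

Let Z k := iter k step (fun _ _ => z0).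

Let Z_good k : good (Z k).
Proof.
elim: k => [|k ih]; last exact: step_good.
split.
- by move=> i j s ts.
- by move=> i j w s; exact: cvg_cst.
- exists (\sum_i `|z0 i 0|); first exact: sumr_ge0.
  by move=> s w i _; rewrite /Z/= (bigD1 i)//= lerDl sumr_ge0.
Qed.

Let c := 2 * (m%:R * K) + 1.

Let c_gt0 : 0 < c. Proof. by rewrite ltr_wpDl// !mulr_ge0. Qed.

(** In the weighted uniform norm sup_s e^(-c s) |z s| the Picard iteration is
    a contraction of ratio m K / c <= 1/2, where m K bounds the norm of the
    coefficient matrix. *)
Let Z_step : exists2 C, 0 <= C & forall k s w i, t <= s <= T ->
  `|Z k.+1 s w i 0 - Z k s w i 0| <= C * 2^-1 ^+ k * expR (c * s).
Proof.
have [_ _ [C C0 hC]] := Z_good 1; have [_ _ [C' C'0 hC']] := Z_good 0.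
exists (C + C'); first exact: addr_ge0.
have E1 s : t <= s <= T -> 1 <= expR (c * s).
  move=> /andP[ts _]; rewrite -expR0 ler_expR mulr_ge0 ?(ltW c_gt0)//.
  exact: le_trans t0 ts.
elim=> [|k ih] s w i ts.
  apply: (@le_trans _ _ (C + C')).
    by rewrite (le_trans (ler_normB _ _))// lerD//; [exact: hC|exact: hC'].
  by rewrite expr0 mulr1 ler_peMr ?addr_ge0 ?E1.
have iz k' := good_L1 (Z_good k') w i ts.
have /andP[ts' sT] := ts; have mts : measurable (`[t, s] : set RR) by exact: measurable_itv.
rewrite [Z k.+2]/(step (Z k.+1)) [Z k.+1 in X in _ - X]/(step (Z k)) !mxE.
rewrite opprD addrACA subrr add0r -RintegralB//.
have [iE leE] := expR_integral c_gt0 ts'.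
have iB := L1B mts (iz k.+1) (iz k).
apply: (le_trans (le_normr_Rintegral _ iB)) => //.
apply: (@le_trans _ _ (\int[mu]_(u in `[t, s]) (m%:R * K * ((C + C') * 2^-1 ^+ k) * expR (c * u)))).
  apply: le_Rintegral => //; [exact: L1_norm|exact: (L1Z mts)|].
  move=> u; rewrite /= in_itv/= => /andP[tu us].
  rewrite field_sub -mulrA; apply: mulA_le => j.
  rewrite [X in `|X|](_ : _ = Z k.+1 u w j 0 - Z k u w j 0); last by rewrite mxE [X in _ + X]mxE.
  by apply: ih; rewrite tu (le_trans us).
rewrite RintegralZl// exprS.
apply: (@le_trans _ _ (m%:R * K * ((C + C') * 2^-1 ^+ k) * (c^-1 * expR (c * s)))).
  by rewrite ler_wpM2l ?mulr_ge0 ?addr_ge0// ltW// half_exp_gt0.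
rewrite mulrA ler_wpM2r ?expR_ge0//.
have g0 : 0 <= (C + C') * 2^-1 ^+ k.
  by rewrite mulr_ge0 ?addr_ge0// ltW// half_exp_gt0.
have -> : m%:R * K * ((C + C') * 2^-1 ^+ k) / c = (C + C') * 2^-1 ^+ k * (m%:R * K / c) by ring.
have -> : (C + C') * (2^-1 * 2^-1 ^+ k) = (C + C') * 2^-1 ^+ k * 2^-1 by ring.
rewrite ler_wpM2l// ler_pdivrMr// /c.
by have := mulr_ge0 (ler0n R m) K0; move: (m%:R * K) => e; lra.
Qed.

(** Picard iteration, path by path: the iterates are adapted, and they
    converge uniformly in time at a geometric rate that does not depend on the
    path. *)
Theorem linear_ode : exists z, [/\ entrywise (adapted P W t T) z,
  entrywise (continuous_paths t T) z,
  exists C, forall s w i, t <= s <= T -> `|z s w i 0| <= C &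
  forall w s i, t <= s <= T -> L1 mu `[t, s] (fun u => (A u w *m z u w + b) i 0) /\
    z s w i 0 = z0 i 0 + \int[mu]_(u in `[t, s]) (A u w *m z u w + b) i 0].
Proof.
have [C1 C10 hC1] := Z_step.
pose C := C1 * expR (c * T).
have C0 : 0 <= C by rewrite mulr_ge0// expR_ge0.
have Zd k s w i : t <= s <= T -> `|Z k.+1 s w i 0 - Z k s w i 0| <= C * 2^-1 ^+ k.
  move=> ts; apply: (le_trans (hC1 k s w i ts)); rewrite /C mulrAC.
  rewrite ler_wpM2r ?(ltW (half_exp_gt0 _ _))// ler_wpM2l// ler_expR ler_pM2l//.
  by have /andP[] := ts.
have /choice[l hl] : forall p : R * Omega * 'I_m, exists l, t <= p.1.1 <= T ->
    Z k p.1.1 p.1.2 p.2 0 @[k --> \oo] --> l /\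
    forall k, `|l - Z k p.1.1 p.1.2 p.2 0| <= 2 * C * 2^-1 ^+ k.
  move=> [[s w] i]; have [ts|nts] := pselect (t <= s <= T); last by exists 0.
  have [l hl] := geometric_cauchy C0 (fun k => Zd k s w i ts).
  by exists l.
pose z s w : 'cV[R]_m := \col_i l (s, w, i).
have zE s w i : z s w i 0 = l (s, w, i) by rewrite mxE.
have zc s w i : t <= s <= T -> Z k s w i 0 @[k --> \oo] --> z s w i 0.
  by move=> ts; rewrite zE; exact: (hl (s, w, i) ts).1.
have zd k s w i : t <= s <= T -> `|z s w i 0 - Z k s w i 0| <= 2 * C * 2^-1 ^+ k.
  by move=> ts; rewrite zE; exact: (hl (s, w, i) ts).2.
have [_ _ [C' C'0 hC']] := Z_good 0.
have zb s w i : t <= s <= T -> `|z s w i 0| <= 2 * C + C'.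
  move=> ts; rewrite -[z s w i 0](subrK (Z 0 s w i 0)) (le_trans (ler_normD _ _))//.
  by rewrite lerD ?hC'// -[2 * C]mulr1 -(expr0 2^-1) zd.
have mz i w : measurable_fun (`[t, T] : set RR) (fun s => z s w i 0).
  apply: (@measurable_fun_cvg _ _ _ _ (fun k s => Z k s w i 0)).
    move=> k; have [_ cz _] := Z_good k.
    by apply: (measurable_path w (cz i 0)); rewrite tT lexx.
  by move=> s /=; rewrite in_itv/=; exact: zc.
have iz := field_L1 mz zb.
have eq s w i : t <= s <= T ->
    z s w i 0 = z0 i 0 + \int[mu]_(u in `[t, s]) field z u w i 0.
  move=> ts; apply/eqP; rewrite -subr_eq0; apply/eqP.
  have /andP[ts' sT] := ts; have mts : measurable (`[t, s] : set RR) by exact: measurable_itv.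
  pose B := m%:R * K * (2 * C) * fine (mu `[t, s]).
  apply: (@half_exp_small _ (2 * C + B)) => k.
  have izk := good_L1 (Z_good k) w i ts; have izz := iz s w i ts.
  have -> : z s w i 0 - (z0 i 0 + \int[mu]_(u in `[t, s]) field z u w i 0)
      = (z s w i 0 - Z k.+1 s w i 0)
        + \int[mu]_(u in `[t, s]) (field (Z k) u w i 0 - field z u w i 0).
    have Zs : Z k.+1 s w i 0 = z0 i 0 + \int[mu]_(u in `[t, s]) field (Z k) u w i 0.
      by rewrite [Z k.+1]/(step (Z k)) mxE.
    by rewrite RintegralB// Zs; ring.
  rewrite (le_trans (ler_normD _ _))// mulrDl lerD//.
    rewrite (le_trans (zd k.+1 s w i ts))// exprS mulrCA -[leRHS]mul1r ler_wpM2r//.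
      by rewrite !mulr_ge0// ltW// half_exp_gt0.
    by rewrite invf_le1// ler1n.
  have iB := L1B mts izk izz.
  apply: (le_trans (le_normr_Rintegral _ iB)) => //.
  apply: (@le_trans _ _ (\int[mu]_(u in `[t, s]) (m%:R * K * (2 * C * 2^-1 ^+ k)))).
    apply: le_Rintegral => //; first exact: L1_norm.
      by apply: L1_cst => //; exact: (lebesgue_itv_lty t s).
    move=> u; rewrite /= in_itv/= => /andP[tu us].
    rewrite field_sub; apply: mulA_le => j.
    rewrite [X in `|X|](_ : _ = Z k u w j 0 - z u w j 0); last by rewrite mxE [X in _ + X]mxE.
    by rewrite distrC zd// tu (le_trans us).
  by rewrite Rintegral_cst// /B [leRHS]mulrAC mulrA.
exists z; split.
- move=> i j s ts; rewrite (ord1 j).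
  apply: (@measurable_fun_cvg _ _ _ _ (fun k (w : filtered P W s) => Z k s w i 0)).
    by move=> k; have [az _ _] := Z_good k; exact: az.
  by move=> w _; exact: zc.
- move=> i j w; rewrite (ord1 j).
  apply: (@AC_continuous _ _ _ _ (fun s => field z s w i 0)) => //.
  apply: (@AC_intro _ _ _ _ _ (z0 i 0)) => //; last by move=> s; exact: eq.
  by apply: iz; rewrite tT lexx.
- by exists (2 * C + C').
- by move=> w s i ts; split; [exact: iz|exact: eq].
Qed.

End linear_ode.

(** * Fast convergence *)

Section fast_convergence.
Context d (X : measurableType d) (R : realType).
Variables (mu : {measure set X -> \bar R}) (D : set X).
Hypothesis mD : measurable D.

(** The sum of the 2^k f_k is integrable, hence almost everywhere finite. *)
Lemma ae_geometric (f : nat -> X -> R) (C : R) : (forall k, L1 mu D (f k)) ->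
  (forall k x, 0 <= f k x) ->
  (forall k, \int[mu]_(x in D) f k x <= C * (2^-1 ^+ k) ^+ 2) ->
  {ae mu, forall x, D x -> exists2 c : R, 0 <= c & forall k, f k x <= c * 2^-1 ^+ k}.
Proof.
move=> hf f0 hI.
pose g k x := (2 ^+ k * f k x)%:E.
have mg k : measurable_fun D (g k).
  by apply/measurable_EFinP; apply: measurable_funM => //; exact: L1_measurable (hf k).
have g0 k x : (0 <= g k x)%E by rewrite lee_fin mulr_ge0// exprn_ge0.
have half_sum n : \sum_(0 <= k < n) 2^-1 ^+ k <= 2 - 2 * 2^-1 ^+ n :> R.
  elim: n => [|n ih]; first by rewrite big_nil expr0; lra.
  by rewrite big_nat_recr//= exprS; move: ih (half_exp_gt0 R n); lra.
have C0 : 0 <= C.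
  have := hI 0%N; rewrite expr0 expr1n mulr1; apply: le_trans.
  by apply: Rintegral_ge0 => x _; exact: f0.
have iS : mu.-integrable D (fun x => \sum_(0 <= k <oo) g k x)%E.
  apply/integrableP; split; first exact: ge0_emeasurable_sum.
  rewrite (eq_integral (fun x => \sum_(0 <= k <oo) g k x)%E); last first.
    by move=> x _; rewrite gee0_abs//; exact: nneseries_ge0.
  rewrite (integral_nneseries _ mD)//.
  apply: (@le_lt_trans _ _ (C * 2)%:E); last exact: ltry.
  apply: lime_le.
    by apply: is_cvg_nneseries => k _ _; apply: integral_ge0.
  apply: nearW => n; apply: (@le_trans _ _ (\sum_(0 <= k < n) (C * 2^-1 ^+ k)%:E)%E).
    apply: lee_sum => k _; rewrite /g RintE//; last exact: L1Z.
    rewrite lee_fin RintegralZl//.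
    apply: (@le_trans _ _ (2 ^+ k * (C * (2^-1 ^+ k) ^+ 2))); first by rewrite ler_wpM2l// exprn_ge0.
    have e : 2 ^+ k * 2^-1 ^+ k = 1 :> R by rewrite -exprMn divff ?expr1n.
    have -> : 2 ^+ k * (C * (2^-1 ^+ k) ^+ 2) = C * 2^-1 ^+ k * (2 ^+ k * 2^-1 ^+ k) by ring.
    by rewrite e mulr1.
  rewrite sumEFin lee_fin -mulr_sumr ler_wpM2l// (le_trans (half_sum n))// lerBlDr lerDl mulr_ge0//.
apply: filterS (integrable_ae mD iS) => x h Dx; have fS := h Dx.
exists (fine (\sum_(0 <= k <oo) g k x)%E); first by rewrite fine_ge0//; exact: nneseries_ge0.
move=> k; rewrite exprVn ler_pdivlMr ?exprn_gt0// mulrC -lee_fin fineK//.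
rewrite (@nneseriesD1 _ _ k)// -/(g k x) leeDl//; exact: nneseries_ge0.
Qed.

End fast_convergence.

(** Telescoping bounds the distance of f_ (k + j) to f_ k uniformly in j, and
    Fatou's lemma passes to the limit in j. *)
Lemma L1_limit d (X : measurableType d) (R : realType) (mu : {measure set X -> \bar R})
    (D : set X) (f_ : nat -> X -> R) (f : X -> R) (C : R) : measurable D -> 0 <= C ->
  (forall k, L1 mu D (f_ k)) -> measurable_fun D f ->
  {ae mu, forall x, D x -> f_ k x @[k --> \oo] --> f x} ->
  (forall k, \int[mu]_(x in D) `|f_ k.+1 x - f_ k x| <= C * 2^-1 ^+ k) ->
  L1 mu D f /\ forall k, \int[mu]_(x in D) `|f x - f_ k x| <= 2 * C * 2^-1 ^+ k.
Proof.
move=> mD C0 if_ mf cf hI.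
have iB j k : L1 mu D (fun x => `|f_ j x - f_ k x|) by apply: L1_norm; exact: L1B.
have step k j : \int[mu]_(x in D) `|f_ (k + j)%N x - f_ k x| <= 2 * C * (2^-1 ^+ k - 2^-1 ^+ (k + j)).
  elim: j => [|j ih].
    rewrite addn0 subrr mulr0 (_ : (fun x => _) = fun=> 0) ?Rintegral_cst ?mul0r//.
    by apply/funext => x; rewrite subrr normr0.
  apply: (@le_trans _ _ (\int[mu]_(x in D) (`|f_ (k + j).+1 x - f_ (k + j)%N x| + `|f_ (k + j)%N x - f_ k x|))).
    rewrite addnS; apply: le_Rintegral => //; first exact: L1D.
    by move=> x _; rewrite (le_trans _ (ler_normD _ _))// addrA subrK.
  rewrite RintegralD// addnS exprS.
  by move: ih (hI (k + j)%N); lra.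
have key k : L1 mu D (fun x => `|f x - f_ k x|) /\
    \int[mu]_(x in D) `|f x - f_ k x| <= 2 * C * 2^-1 ^+ k.
  apply: (Rfatou mD (f_ := fun j x => `|f_ (k + j)%N x - f_ k x|) (c_ := fun=> 2 * C * 2^-1 ^+ k)) => //.
  - by apply: measurableT_comp => //; apply: measurable_funB => //; exact: L1_measurable (if_ k).
  - apply: filterS cf => x h Dx; apply: cvg_norm; apply: cvgB; last exact: cvg_cst.
    have := h Dx; rewrite -(cvg_shiftn k) => h'.
    by under eq_fun do rewrite addnC.
  - move=> j; rewrite (le_trans (step k j))// ler_wpM2l ?mulr_ge0//.
    by rewrite lerBlDr lerDl ltW// half_exp_gt0.
  - exact: cvg_cst.
split; last by move=> k; exact: (key k).2.
apply: (L1_le mD mf (g := fun x => `|f x - f_ 0%N x| + `|f_ 0%N x|)).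
  by move=> x _; rewrite (le_trans _ (ler_normD _ _))// subrK.
by apply: L1D => //; [exact: (key 0%N).1|exact: L1_norm].
Qed.

(** * Comparison of conditional expectations *)

Section conditional.
Context (R : realType) (disp : measure_display) (Omega : measurableType disp).
Variables (P : probability Omega R) (W : R -> Omega -> R) (T : R).
Hypothesis hF : full_filtration P W T.
Local Notation mu := (@lebesgue_measure R).
Local Notation RR := (measurableTypeR R).
Local Notation nu := (mu \x P)%E.
Local Notation FF s := (<<s filtration_gen P W s>>).
Local Notation Fm s f := (measurable_fun setT (f : filtered P W s -> R)).

Lemma ae_prod_fst (S : RR -> Prop) : {ae mu, forall s, S s} ->
  {ae nu, forall p : RR * Omega, S p.1}.
Proof.
move=> [N [mN N0 QN]]; exists (N `*` setT); split.
- exact: measurableX.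
- transitivity (mu N * P setT)%E; first exact: product_measure1E.
  by rewrite N0 mul0e.
- by move=> [u w] /= h; split=> //; exact: QN.
Qed.

(** Tested on the event where f exceeds g, which belongs to F_s because both
    functions are measurable with respect to it. *)
Lemma Fm_le_ae s (f g : Omega -> R) : s <= T -> Fm s f -> Fm s g ->
  L1 P setT f -> L1 P setT g ->
  (forall A, FF s A -> \int[P]_(w in A) f w <= \int[P]_(w in A) g w) ->
  {ae P, forall w, f w <= g w}.
Proof.
move=> sT mf mg if_ ig h.
pose A := [set w | 0 < f w - g w].
have FA : FF s A.
  have mfg : Fm s (fun w => f w - g w) by exact: measurable_funB.
  have := mfg measurableT [set x | 0 < x] => /(_ _).
  rewrite setTI; apply.
  by rewrite (_ : [set x | _] = `]0, +oo[%classic)//; apply/seteqP; split=> x /=; rewrite in_itv/= andbT.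
have mA : measurable A by exact: (filtration_measurable hF sT FA).
have subA (k : Omega -> R) : L1 P setT k -> L1 P A k by exact: integrableS.
have iB : L1 P A (fun w => f w - g w) by apply: L1B => //; exact: subA.
have I0 : \int[P]_(w in A) (f w - g w) <= 0.
  have ifA := subA _ if_; have igA := subA _ ig.
  by rewrite RintegralB// subr_le0 h.
have := Rint0_ae mA iB (fun w hw => ltW hw) I0.
apply: filterS => w hw; rewrite leNgt; apply/negP => lt.
have wA : A w by rewrite /A/= subr_gt0.
by have := hw wA => e; move: wA; rewrite /A/= e ltxx.
Qed.

End conditional.

(** * Limits of absolutely continuous functions *)

Section AC_limit.
Context (R : realType).
Local Notation mu := (@lebesgue_measure R).
Local Notation RR := (measurableTypeR R).

(** The densities converge in L^1, so the integral equation passes to the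
    pointwise limit. The limit density is characterised almost everywhere
    only. *)
Lemma AC_limit (a b c C : R) (f_ : nat -> R -> R) (g_ : nat -> R -> R) (f g : R -> R) :
  a <= b -> 0 <= C -> (forall k, L1 mu `[a, b] (g_ k)) ->
  (forall k s, a <= s <= b -> f_ k s = c + \int[mu]_(u in `[a, s]) g_ k u) ->
  measurable_fun (`[a, b] : set RR) g ->
  {ae mu, forall u : RR, (a <= u <= b) -> g_ k u @[k --> \oo] --> g u} ->
  (forall k, \int[mu]_(u in `[a, b]) `|g_ k.+1 u - g_ k u| <= C * 2^-1 ^+ k) ->
  (forall s, a <= s <= b -> f_ k s @[k --> \oo] --> f s) ->
  L1 mu `[a, b] g /\ forall s, a <= s <= b -> f s = c + \int[mu]_(u in `[a, s]) g u.
Proof.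
move=> ab C0 ig_ fE mg cg hI cf.
have mab : measurable (`[a, b] : set RR) by exact: measurable_itv.
have cg' : {ae mu, forall u : RR, [set` `[a, b]] u -> g_ k u @[k --> \oo] --> g u}.
  by apply: filterS cg => u h /=; rewrite in_itv/=; exact: h.
have [ig hg] := L1_limit mab C0 ig_ mg cg' hI.
split=> // s /andP[as_ sb]; have asb : a <= s <= b by rewrite as_ sb.
have mas : measurable (`[a, s] : set RR) by exact: measurable_itv.
have ias := L1_itvS (lexx a) sb ig; have ias_ k := L1_itvS (lexx a) sb (ig_ k).
have cI : f_ k s @[k --> \oo] --> c + \int[mu]_(u in `[a, s]) g u.
  apply/cvgrPdist_le => e e0.
  have /cvgrPdist_le/(_ _ e0) := cvg_half_exp (2 * C : R).
  apply: filterS => k; rewrite sub0r normrN ger0_norm; last first.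
    by rewrite !mulr_ge0// ltW// half_exp_gt0.
  apply: le_trans; rewrite fE// opprD addrACA subrr add0r -RintegralB//.
  have iB := L1B mas ias (ias_ k).
  apply: (le_trans (le_normr_Rintegral _ iB)) => //.
  apply: le_trans (hg k); rewrite (@Rint_itv_split _ a s b)//; last first.
    by apply: L1_norm; exact: L1B.
  by rewrite lerDl; apply: Rintegral_ge0.
by rewrite -(cvg_lim (@Rhausdorff R) (cf s asb)) (cvg_lim (@Rhausdorff R) cI).
Qed.

End AC_limit.

(** * The terminal condition and the value form *)

Section terminal.
Context (R : realType) (d : nat) (gamma : 'rV[R]_d).
Hypothesis g0 : forall i, 0 < gamma 0 i.

(** Completing the square in the impact exhibits the penalty: the position is
    charged n - gamma_i on top of a nonnegative term. *)
Lemma riccati_terminalE n (X Y : 'cV[R]_d) :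
  quad (riccati_terminal gamma n) (col_mx X Y)
  = \sum_i ((n%:R - gamma 0 i) * X i 0 ^+ 2 + (gamma 0 i)^-1 * (gamma 0 i * X i 0 + Y i 0) ^+ 2).
Proof.
rewrite /quad /riccati_terminal invmx_gamma// tr_col_mx mul_row_block mul_row_col.
rewrite addmx00 !mulmxDl !addmx00 !mulmx1 -mulmxA mul_scalar_mx mul_mx_diag.
rewrite !mxE -!big_split /=; apply: eq_bigr => i _.
by rewrite !mxE; field; rewrite gt_eqF.
Qed.

Lemma gamma_le i : gamma 0 i <= gamma_max gamma.
Proof. by rewrite /gamma_max; apply: (le_bigmax _ (fun i => gamma 0 i)). Qed.

Lemma riccati_terminal_ge n (X Y : 'cV[R]_d) i : gamma_max gamma <= n%:R ->
  (n%:R - gamma_max gamma) * X i 0 ^+ 2 <= quad (riccati_terminal gamma n) (col_mx X Y).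
Proof.
move=> gn; rewrite riccati_terminalE (bigD1 i)//=.
have h k : 0 <= (n%:R - gamma 0 k) * X k 0 ^+ 2 + (gamma 0 k)^-1 * (gamma 0 k * X k 0 + Y k 0) ^+ 2.
  apply: addr_ge0; apply: mulr_ge0; rewrite ?sqr_ge0// ?invr_ge0 ?(ltW (g0 k))//.
  by rewrite subr_ge0 (le_trans (gamma_le k)).
rewrite -[leLHS]addr0 lerD ?sumr_ge0// -[leLHS]addr0 lerD//.
  by rewrite ler_wpM2r ?sqr_ge0// lerB// gamma_le.
by rewrite mulr_ge0 ?sqr_ge0// invr_ge0 ltW.
Qed.

Lemma riccati_terminal_ge0 n (X Y : 'cV[R]_d) : gamma_max gamma <= n%:R ->
  0 <= quad (riccati_terminal gamma n) (col_mx X Y).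
Proof.
move=> gn; rewrite riccati_terminalE; apply: sumr_ge0 => i _.
apply: addr_ge0; apply: mulr_ge0; rewrite ?sqr_ge0// ?invr_ge0 ?(ltW (g0 i))//.
by rewrite subr_ge0 (le_trans (gamma_le i)).
Qed.

Lemma riccati_terminal_mono n m (X Y : 'cV[R]_d) : (n <= m)%N ->
  quad (riccati_terminal gamma n) (col_mx X Y) <= quad (riccati_terminal gamma m) (col_mx X Y).
Proof.
move=> nm; rewrite !riccati_terminalE; apply: ler_sum => i _.
by rewrite lerD2r ler_wpM2r ?sqr_ge0// lerB// ler_nat.
Qed.

(** For a liquidating control the terminal term is the stored energy whatever
    n is, which is why the penalized identities all describe the same cost. *)
Lemma riccati_terminal0 n (Y : 'cV[R]_d) :
  quad (riccati_terminal gamma n) (col_mx 0 Y) = energy gamma Y.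
Proof.
rewrite riccati_terminalE; apply: eq_bigr => i _.
by rewrite !mxE expr0n/= !mulr0 !add0r.
Qed.

Lemma value_formE (Q : 'M[R]_(d + d)) (x y : 'cV[R]_d) :
  value_form gamma Q x y = 2^-1 * (quad Q (col_mx x y) - energy gamma y).
Proof.
rewrite /value_form -tr_col_mx mulmxBr mulmxBl addmx00 oppmx00; congr (_ * (_ - _)).
rewrite invmx_gamma// tr_col_mx mul_row_block !mulmx0 !addr0 add0r mul_row_col.
rewrite mul0mx add0r mul_mx_diag mxE; apply: eq_bigr => i _.
by rewrite !mxE; ring.
Qed.

End terminal.

(** * The controlled state *)

Section control.
Context (R : realType) (disp : measure_display) (Omega : measurableType disp).
Variables (P : probability Omega R) (W : R -> Omega -> R) (T : R) (d : nat).
Variables (Lambda : 'M[R]_d) (gamma : 'rV[R]_d).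
Variables (rho : R -> Omega -> 'rV[R]_d) (Sigma : R -> Omega -> 'M[R]_d).
Hypothesis hW : is_brownian P W T.
Hypothesis hF : full_filtration P W T.
Hypothesis T0 : 0 < T.
Hypothesis pdL : pdmx Lambda.
Hypothesis g0 : forall i, 0 < gamma 0 i.
Hypothesis rho_prog : entrywise (progressive P W T) rho.
Hypothesis rho_bd : entrywise (ess_bounded P T) rho.
Hypothesis rho0 : forall t w i, 0 <= t <= T -> 0 <= rho t w 0 i.
Hypothesis Sigma_prog : entrywise (progressive P W T) Sigma.
Hypothesis Sigma_bd : entrywise (ess_bounded P T) Sigma.
Hypothesis Sigma_psd : forall t w, 0 <= t <= T -> psdmx (Sigma t w).
Local Notation mu := (@lebesgue_measure R).
Local Notation RR := (measurableTypeR R).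
Local Notation nu := (mu \x P)%E.
Local Notation G := (diag_mx gamma).
Local Notation FF s := (<<s filtration_gen P W s>>).
Local Notation Fm s f := (measurable_fun setT (f : filtered P W s -> R)).
Implicit Types (t s : R) (x y : 'cV[R]_d) (xi X Y : R -> Omega -> 'cV[R]_d).

Let T0' : 0 <= T. Proof. exact: ltW. Qed.

Let mDT t : measurable ((`[t, T] : set RR) `*` [set: Omega]).
Proof. exact: measurableX. Qed.

Let P1 : (P setT < +oo)%E. Proof. by rewrite probability_setT ltry. Qed.

(** ** Bounds with a single constant *)

Lemma sum_ge_term m n (F : 'I_m -> 'I_n -> R) i j : (forall i j, 0 <= F i j) ->
  F i j <= \sum_i \sum_j F i j.
Proof.
move=> F0; rewrite (bigD1 i)//= (bigD1 j)//= -addrA lerDl addr_ge0//.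
  by apply: sumr_ge0.
by apply: sumr_ge0 => k _; apply: sumr_ge0.
Qed.

Lemma common_bound m n (S : 'I_m -> 'I_n -> R -> Prop) :
  (forall i j K L, K <= L -> S i j K -> S i j L) ->
  (forall i j, exists K, S i j K) -> exists2 K, 0 <= K & forall i j, S i j K.
Proof.
move=> S_le hS; have /choice[k hk] : forall ij : 'I_m * 'I_n, exists K, S ij.1 ij.2 K.
  by move=> [i j]; exact: hS.
exists (\sum_i \sum_j `|k (i, j)|).
  by apply: sumr_ge0 => i _; apply: sumr_ge0.
move=> i j; apply: S_le (hk (i, j)); apply: (le_trans (ler_norm _)).
exact: (@sum_ge_term _ _ (fun i j => `|k (i, j)|)).
Qed.

Lemma bounded_entries (X : Type) (D : set X) m n (A : X -> 'M[R]_(m, n)) :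
  entries (fun f : X -> R => exists K, forall p, D p -> `|f p| <= K) A ->
  exists2 K : R, 0 <= K & forall p, D p -> forall i j, `|A p i j| <= K.
Proof.
move=> hA; have [||K K0 hK] :=
  @common_bound _ _ (fun i j K => forall p, D p -> `|A p i j| <= K).
- by move=> i j K L KL h p Dp; exact: le_trans (h p Dp) KL.
- exact: hA.
by exists K => // p Dp i j; exact: hK.
Qed.

Lemma ess_bounded_entries m n (f : R -> Omega -> 'M[R]_(m, n)) :
  entrywise (ess_bounded P T) f -> exists2 K : R, 0 <= K &
  {ae nu, forall p : RR * Omega, 0 <= p.1 <= T -> forall i j, `|f p.1 p.2 i j| <= K}.
Proof.
move=> hf; have [||K K0 hK] := @common_bound _ _ (fun i j K =>
  {ae nu, forall p : RR * Omega, 0 <= p.1 <= T -> `|f p.1 p.2 i j| <= K}).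
- by move=> i j K L KL; apply: filterS => p h /h /le_trans; apply.
- exact: hf.
exists K => //.
have hKi i : {ae nu, forall p : RR * Omega, forall j, 0 <= p.1 <= T ->
    `|f p.1 p.2 i j| <= K} by exact: filter_forall.
by have /filter_forall := hKi; apply: filterS => p h hp i j; exact: h.
Qed.

Lemma ess_bounded_paths_entries m n (f : R -> Omega -> 'M[R]_(m, n)) :
  entrywise (ess_bounded_paths P T) f -> exists2 K : R, 0 <= K &
  {ae P, forall w s, 0 <= s <= T -> forall i j, `|f s w i j| <= K}.
Proof.
move=> hf; have [||K K0 hK] := @common_bound _ _ (fun i j K =>
  {ae P, forall w, forall s, 0 <= s <= T -> `|f s w i j| <= K}).
- by move=> i j K L KL; apply: filterS => w h s /h /le_trans; apply.
- exact: hf.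
exists K => //.
have hKi i : {ae P, forall w j, forall s, 0 <= s <= T -> `|f s w i j| <= K}.
  exact: filter_forall.
by have /filter_forall := hKi; apply: filterS => w h s hs i j; exact: h.
Qed.

(** The drift is a polynomial in the entries of its arguments. *)
Lemma riccati_drift_bounded (K : R) : exists2 K', 0 <= K' & forall (r : 'rV[R]_d)
    (S : 'M[R]_d) (Q : 'M[R]_(d + d)),
  (forall i j, `|r i j| <= K) -> (forall i j, `|S i j| <= K) ->
  (forall i j, `|Q i j| <= K) ->
  forall i j, `|riccati_drift Lambda gamma r S Q i j| <= K'.
Proof.
pose X := ('rV[R]_d * 'M[R]_d * 'M[R]_(d + d))%type.
pose D : set X := [set p : X | [/\ forall i j, `|p.1.1 i j| <= K,
  forall i j, `|p.1.2 i j| <= K & forall i j, `|p.2 i j| <= K]].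
have [|K' K'0 hK'] := @bounded_entries X D _ _
    (fun p => riccati_drift Lambda gamma p.1.1 p.1.2 p.2).
  by apply: (entries_riccati (bounded_function_ring R D)) => i j; exists K => p [].
by exists K' => // r S Q hr hS hQ; exact: (hK' ((r, S), Q)).
Qed.

Lemma feedback_bounded (K : R) : exists2 K', 0 <= K' & forall (Q : 'M[R]_(d + d)) (x y : 'cV[R]_d),
  (forall i j, `|Q i j| <= K) -> (forall i j, `|x i j| <= K) -> (forall i j, `|y i j| <= K) ->
  forall i j, `|feedback Lambda gamma Q x y i j| <= K'.
Proof.
pose X := ('M[R]_(d + d) * 'cV[R]_d * 'cV[R]_d)%type.
pose D : set X := [set p : X | [/\ forall i j, `|p.1.1 i j| <= K,
  forall i j, `|p.1.2 i j| <= K & forall i j, `|p.2 i j| <= K]].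
have [|K' K'0 hK'] := @bounded_entries X D _ _
    (fun p => feedback Lambda gamma p.1.1 p.1.2 p.2).
  by apply: (entries_feedback (bounded_function_ring R D)) => i j; exists K => p [].
by exists K' => // Q x y hQ hx hy; exact: (hK' ((Q, x), y)).
Qed.

(** ** State processes *)

Definition dynamics t x y xi X Y : Prop :=
  [/\ entrywise (L2F P W t T) xi, is_position P W T t x xi X
    & is_impact P W T gamma rho t y xi Y].

Definition state X Y (s : R) (w : Omega) : 'cV[R]_(d + d) := col_mx (X s w) (Y s w).

Definition state_velocity xi Y (s : R) (w : Omega) : 'cV[R]_(d + d) :=
  velocity gamma (rho s w) (xi s w) (Y s w).

Lemma impact_driftE xi Y s w i : impact_drift gamma rho xi Y s w i 0 =
  - (rho s w 0 i * Y s w i 0) + gamma 0 i * xi s w i 0.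
Proof. by rewrite /impact_drift !mul_diag_mx !mxE. Qed.

(** The state equation is linear, so differences of controlled states are
    again controlled states; this is how two controls are compared. *)
Lemma dynamics_sub t x1 y1 xi1 X1 Y1 x2 y2 xi2 X2 Y2 : t <= T ->
  dynamics t x1 y1 xi1 X1 Y1 -> dynamics t x2 y2 xi2 X2 Y2 ->
  dynamics t (x1 - x2) (y1 - y2) (fun s w => xi1 s w - xi2 s w)
    (fun s w => X1 s w - X2 s w) (fun s w => Y1 s w - Y2 s w).
Proof.
move=> tT [l1 [aX1 cX1 hX1] [aY1 cY1 hY1]] [l2 [aX2 cX2 hX2] [aY2 cY2 hY2]].
have adB (f g : R -> Omega -> 'cV[R]_d) : entrywise (adapted P W t T) f ->
    entrywise (adapted P W t T) g ->
    entrywise (adapted P W t T) (fun s w => f s w - g s w).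
  move=> hf hg i j s ts.
  rewrite (_ : (fun w => _) = fun w => f s w i j - g s w i j); last first.
    by apply/funext => w; rewrite !mxE.
  by apply: measurable_funB; [exact: hf|exact: hg].
have ctB (f g : R -> Omega -> 'cV[R]_d) : entrywise (continuous_paths t T) f ->
    entrywise (continuous_paths t T) g ->
    entrywise (continuous_paths t T) (fun s w => f s w - g s w).
  move=> hf hg i j w.
  rewrite (_ : (fun s => _) = fun s => f s w i j - g s w i j); last first.
    by apply/funext => s; rewrite !mxE.
  by move=> s; apply: cvgB; [exact: hf|exact: hg].
split.
- move=> i j; have l1' := l1 i j; have l2' := l2 i j.
  have e : (fun s w => (xi1 s w - xi2 s w) i j) = fun s w => xi1 s w i j - xi2 s w i j.
    by apply/funext => s; apply/funext => w; rewrite !mxE.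
  rewrite e; have m1 := L2F_jmeas l1'; have m2 := L2F_jmeas l2'.
  apply: L2F_intro.
  + have [a1 _ _] := l1'; have [a2 _ _] := l2'.
    by move=> s ts; apply: measurable_funB; [exact: a1|exact: a2].
  + exact: measurable_funB.
  + have i2 : L1 nu (`[t, T] `*` setT) (fun p => (- xi2 p.1 p.2 i j) ^+ 2).
      rewrite (_ : (fun p : RR * Omega => _) = fun p => xi2 p.1 p.2 i j ^+ 2).
        exact: L2F_L1 l2'.
      by apply/funext => p; rewrite sqrrN.
    apply: (L1_sqrD (mDT t) m1 _ (L2F_L1 l1') i2).
    exact: measurableT_comp m2.
- split; [exact: adB|exact: ctB|].
  apply: filterS2 hX1 hX2 => w h1 h2 s ts i.
  have [i1 e1] := h1 s ts i; have [i2 e2] := h2 s ts i.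
  have mts : measurable (`[t, s] : set RR) by exact: measurable_itv.
  have iB := L1B mts i1 i2.
  split.
    apply: eq_integrable iB => // u _ /=.
    by rewrite !mxE.
  transitivity (x1 i 0 - x2 i 0 - \int[mu]_(u in `[t, s]) (xi1 u w i 0 - xi2 u w i 0)).
    by rewrite RintegralB// !mxE e1 e2; ring.
  by rewrite !mxE; congr (_ - _); apply: eq_Rintegral => u _; rewrite !mxE.
- split; [exact: adB|exact: ctB|].
  apply: filterS2 hY1 hY2 => w h1 h2 s ts i.
  have [i1 e1] := h1 s ts i; have [i2 e2] := h2 s ts i.
  set xi := (fun s w => xi1 s w - xi2 s w); set Y := (fun s w => Y1 s w - Y2 s w).
  have e u : impact_drift gamma rho xi1 Y1 u w i 0 - impact_drift gamma rho xi2 Y2 u w i 0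
      = impact_drift gamma rho xi Y u w i 0.
    by rewrite !impact_driftE /xi /Y !mxE; ring.
  have mts : measurable (`[t, s] : set RR) by exact: measurable_itv.
  have iB := L1B mts i1 i2.
  split.
    apply: eq_integrable iB => // u _ /=.
    by rewrite e.
  transitivity (y1 i 0 - y2 i 0 + \int[mu]_(u in `[t, s])
    (impact_drift gamma rho xi1 Y1 u w i 0 - impact_drift gamma rho xi2 Y2 u w i 0)).
    by rewrite RintegralB// /Y !mxE e1 e2; ring.
  by rewrite !mxE; congr (_ + _); apply: eq_Rintegral => u _; exact: e.
Qed.

Section estimates.
Variables (t : R) (x y : 'cV[R]_d) (xi X Y : R -> Omega -> 'cV[R]_d).
Hypotheses (t0 : 0 <= t) (tT : t <= T).
Hypothesis hdyn : dynamics t x y xi X Y.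

Let tt : t <= t <= T. Proof. by rewrite lexx. Qed.
Let TT : t <= T <= T. Proof. by rewrite lexx andbT. Qed.

Lemma position_AC : {ae P, forall w i,
  [/\ L1 mu `[t, T] (fun s => xi s w i 0),
      is_AC t T (fun s => X s w i 0) (fun s => - xi s w i 0) & X t w i 0 = x i 0]}.
Proof.
have [_ [_ _ h] _] := hdyn; apply: filterS h => w h i.
have [iT _] := h T TT i.
have Xt : X t w i 0 = x i 0.
  by have [_ ->] := h t tt i; rewrite set_itv1 Rintegral_set1 subr0.
split=> // s ts; have [is_ e] := h s ts i; split; first exact: L1N.
by rewrite Xt e RintN.
Qed.

Lemma impact_AC : {ae P, forall w i,
  is_AC t T (fun s => Y s w i 0)
    (fun s => - (rho s w 0 i * Y s w i 0) + gamma 0 i * xi s w i 0) /\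
  Y t w i 0 = y i 0}.
Proof.
have [_ _ [_ _ h]] := hdyn; apply: filterS h => w h i.
have Yt : Y t w i 0 = y i 0.
  by have [_ ->] := h t tt i; rewrite set_itv1 Rintegral_set1 addr0.
have e : (fun s => - (rho s w 0 i * Y s w i 0) + gamma 0 i * xi s w i 0)
    = fun s => impact_drift gamma rho xi Y s w i 0.
  by apply/funext => s; rewrite impact_driftE.
by rewrite e; split=> // s ts; have [is_ ->] := h s ts i; rewrite Yt.
Qed.

(** Pathwise bounds by the L^1 norm of the control: immediate for the
    position, and for the impact because the resilience is dissipative. *)
Lemma dynamics_bounds : {ae P, forall w i,
  L1 mu `[t, T] (fun s => xi s w i 0) /\ forall s, t <= s <= T ->
  `|X s w i 0| <= `|x i 0| + \int[mu]_(u in `[t, T]) `|xi u w i 0| /\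
  `|Y s w i 0| <= `|y i 0| + 2 * gamma 0 i * \int[mu]_(u in `[t, T]) `|xi u w i 0|}.
Proof.
apply: filterS2 position_AC impact_AC => w hX hY i.
have [ix hx xt] := hX i; have [hy yt] := hY i; split=> // s ts; split.
  rewrite -xt (le_trans (AC_le ts hx))// lerD2l le_eqVlt; apply/orP; left; apply/eqP.
  by apply: eq_Rintegral => u _; rewrite normrN.
rewrite -yt; apply: (@resilience_bound _ t T (fun s => Y s w i 0) (fun s => rho s w 0 i)) => //.
- exact: ltW.
- by move=> u /andP[tu uT]; apply: rho0; rewrite (le_trans t0 tu).
Qed.

Lemma xi_jmeas i : jmeas t T (fun s w => xi s w i 0).
Proof. by have [l _ _] := hdyn; exact: L2F_jmeas (l i 0). Qed.

Lemma X_jmeas i : jmeas t T (fun s w => X s w i 0).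
Proof. by have [_ [a c _] _] := hdyn; apply: (continuous_jmeas hF tT (a i 0) (c i 0)). Qed.

Lemma Y_jmeas i : jmeas t T (fun s w => Y s w i 0).
Proof. by have [_ _ [a c _]] := hdyn; apply: (continuous_jmeas hF tT (a i 0) (c i 0)). Qed.

Lemma rho_jmeas i j : jmeas t T (fun s w => rho s w i j).
Proof. by apply: (jmeasS t0 (lexx T)); exact: (progressive_jmeas hF (rho_prog i j)). Qed.

Lemma Sigma_jmeas i j : jmeas t T (fun s w => Sigma s w i j).
Proof. by apply: (jmeasS t0 (lexx T)); exact: (progressive_jmeas hF (Sigma_prog i j)). Qed.

Lemma xi_L1 i : L1 nu (`[t, T] `*` setT) (fun p => xi p.1 p.2 i 0 ^+ 2).
Proof. by have [l _ _] := hdyn; exact: (L2F_L1 (l i 0)). Qed.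

Let sup_L1 (c g : R) (f : R -> Omega -> R) i : jmeas t T f -> 0 <= g ->
  {ae P, forall w, L1 mu `[t, T] (fun s => xi s w i 0) /\ forall s, t <= s <= T ->
    `|f s w| <= `|c| + g * \int[mu]_(u in `[t, T]) `|xi u w i 0|} ->
  L1 nu (`[t, T] `*` setT) (fun p => f p.1 p.2 ^+ 2) /\ L1 P setT (fun w => f T w ^+ 2).
Proof.
move=> mf gg0 hf.
pose J w := \int[mu]_(u in `[t, T]) xi u w i 0 ^+ 2.
have iJ : L1 P setT J.
  exact: (fubini_L1_2 (m1 := mu) (m2 := P) (f := fun s w => xi s w i 0 ^+ 2)
    (measurable_itv _) measurableT (xi_L1 i)).
pose B w := 2 * c ^+ 2 + 2 * g ^+ 2 * (T - t) * J w.
have iB : L1 P setT B.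
  by apply: L1D => //; [exact: L1_cst|exact: L1Z].
have ae2 := fubini_ae2 (m1 := mu) (m2 := P) (f := fun s w => xi s w i 0 ^+ 2)
    (measurable_itv _) measurableT (xi_L1 i).
have key : {ae P, forall w, forall s, t <= s <= T -> f s w ^+ 2 <= B w}.
  apply: filterS2 hf ae2 => w [ix h] /(_ Logic.I) ix2 s ts.
  have [_ cs] := Rint_norm_sqr tT (L1_measurable ix) ix2.
  have := h s ts; set I := \int[mu]_(u in _) _ => hfs.
  have h1 : f s w ^+ 2 <= (`|c| + g * I) ^+ 2.
    by rewrite -(real_normK (num_real (f s w))) ler_sqr ?nnegrE// (le_trans (normr_ge0 _) hfs).
  apply: (le_trans h1); rewrite /B -(real_normK (num_real c)).
  have h2 : (g * I) ^+ 2 <= g ^+ 2 * (T - t) * J w.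
    by rewrite exprMn -mulrA ler_wpM2l ?sqr_ge0.
  have -> : 2 * g ^+ 2 * (T - t) * J w = 2 * (g ^+ 2 * (T - t) * J w) by ring.
  exact: sqrD_le2.
split.
  apply: (L1_le_ae (mDT t) _ _ (L1_snd t T iB)).
    exact: jmeas_sqr mf.
  apply: filterS (ae_prod_snd key) => -[s w] /= h [/=]; rewrite in_itv/= => ts _.
  by rewrite ger0_norm ?sqr_ge0//; exact: h.
apply: (L1_le_ae _ _ _ iB) => //.
  by apply: measurable_funX; exact: jmeas_section1 mf TT.
by apply: filterS key => w h _; rewrite ger0_norm ?sqr_ge0//; exact: h.
Qed.

Lemma X_L1 i : L1 nu (`[t, T] `*` setT) (fun p => X p.1 p.2 i 0 ^+ 2) /\
  L1 P setT (fun w => X T w i 0 ^+ 2).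
Proof.
apply: (@sup_L1 (x i 0) 1 (fun s w => X s w i 0) i (X_jmeas i)) => //.
apply: filterS dynamics_bounds => w /(_ i)[ix h]; split=> // s ts.
by rewrite mul1r; have [] := h s ts.
Qed.

Lemma Y_L1 i : L1 nu (`[t, T] `*` setT) (fun p => Y p.1 p.2 i 0 ^+ 2) /\
  L1 P setT (fun w => Y T w i 0 ^+ 2).
Proof.
apply: (@sup_L1 (y i 0) (2 * gamma 0 i) (fun s w => Y s w i 0) i (Y_jmeas i)).
  by rewrite mulr_ge0// ltW.
apply: filterS dynamics_bounds => w /(_ i)[ix h]; split=> // s ts.
by have [] := h s ts.
Qed.

Lemma state_jmeas i : jmeas t T (fun s w => state X Y s w i 0).
Proof.
rewrite -(splitK i); case: (fintype.split i) => k /=.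
  rewrite (_ : (fun s w => _) = fun s w => X s w k 0); first exact: X_jmeas.
  by apply/funext => s; apply/funext => w; rewrite /state col_mxEu.
rewrite (_ : (fun s w => _) = fun s w => Y s w k 0); first exact: Y_jmeas.
by apply/funext => s; apply/funext => w; rewrite /state col_mxEd.
Qed.

Lemma state_L1 i : L1 nu (`[t, T] `*` setT) (fun p => state X Y p.1 p.2 i 0 ^+ 2) /\
  L1 P setT (fun w => state X Y T w i 0 ^+ 2).
Proof.
rewrite -(splitK i); case: (fintype.split i) => k /=.
  rewrite (_ : (fun p : RR * Omega => _) = fun p => X p.1 p.2 k 0 ^+ 2); last first.
    by apply/funext => p; rewrite /state col_mxEu.
  rewrite (_ : (fun w => _) = fun w => X T w k 0 ^+ 2); first exact: X_L1.
  by apply/funext => p; rewrite /state col_mxEu.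
rewrite (_ : (fun p : RR * Omega => _) = fun p => Y p.1 p.2 k 0 ^+ 2); last first.
  by apply/funext => p; rewrite /state col_mxEd.
rewrite (_ : (fun w => _) = fun w => Y T w k 0 ^+ 2); first exact: Y_L1.
by apply/funext => p; rewrite /state col_mxEd.
Qed.

Let velocityEu xi' Y' s w k : state_velocity xi' Y' s w (lshift d k) 0 = - xi' s w k 0.
Proof. by rewrite /state_velocity /velocity col_mxEu mxE. Qed.

Let velocityEd xi' Y' s w k : state_velocity xi' Y' s w (rshift d k) 0 =
  - (rho s w 0 k * Y' s w k 0) + gamma 0 k * xi' s w k 0.
Proof. by rewrite /state_velocity /velocity col_mxEd -impact_driftE. Qed.

Lemma velocity_jmeas i : jmeas t T (fun s w => state_velocity xi Y s w i 0).
Proof.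
rewrite -(splitK i); case: (fintype.split i) => k /=.
  rewrite (_ : (fun s w => _) = fun s w => - xi s w k 0).
    by apply: measurableT_comp => //; exact: xi_jmeas.
  by apply/funext => s; apply/funext => w; rewrite velocityEu.
rewrite (_ : (fun s w => _) = fun s w => - (rho s w 0 k * Y s w k 0) + gamma 0 k * xi s w k 0).
  apply: measurable_funD; last by apply: measurable_funM => //; exact: xi_jmeas.
  by apply: measurableT_comp => //; apply: measurable_funM; [exact: rho_jmeas|exact: Y_jmeas].
by apply/funext => s; apply/funext => w; rewrite velocityEd.
Qed.

Lemma velocity_adapted i : adapted P W t T (fun s w => state_velocity xi Y s w i 0).
Proof.
have [l _ [aY _ _]] := hdyn.
move=> s ts; rewrite -(splitK i); case: (fintype.split i) => k /=.
  rewrite (_ : (fun w => _) = fun w => - xi s w k 0).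
    by apply: measurableT_comp => //; have [a _ _] := l k 0; exact: a.
  by apply/funext => w; rewrite velocityEu.
rewrite (_ : (fun w => _) = fun w => - (rho s w 0 k * Y s w k 0) + gamma 0 k * xi s w k 0).
  have hs : 0 <= s <= T by have /andP[h ->] := ts; rewrite (le_trans t0 h).
  apply: measurable_funD; last first.
    by apply: measurable_funM => //; have [a _ _] := l k 0; exact: a.
  apply: measurableT_comp => //; apply: measurable_funM; last exact: aY.
  exact: (progressive_adapted (rho_prog 0 k) hs).
by apply/funext => w; rewrite velocityEd.
Qed.

Lemma velocity_L1 i :
  L1 nu (`[t, T] `*` setT) (fun p => state_velocity xi Y p.1 p.2 i 0 ^+ 2).
Proof.
rewrite -(splitK i); case: (fintype.split i) => k /=.
  rewrite (_ : (fun p : RR * Omega => _) = fun p => xi p.1 p.2 k 0 ^+ 2); first exact: xi_L1.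
  by apply/funext => p; rewrite velocityEu sqrrN.
rewrite (_ : (fun p : RR * Omega => _) = fun p => (- (rho p.1 p.2 0 k * Y p.1 p.2 k 0)
    + gamma 0 k * xi p.1 p.2 k 0) ^+ 2); last first.
  by apply/funext => p; rewrite velocityEd.
have [K K0 hK] := ess_bounded_entries rho_bd.
have mrY : jmeas t T (fun s w => rho s w 0 k * Y s w k 0).
  by apply: measurable_funM; [exact: rho_jmeas|exact: Y_jmeas].
apply: (L1_sqrD (mDT t)).
- exact: (measurableT_comp _ mrY).
- by apply: measurable_funM => //; exact: xi_jmeas.
- rewrite (_ : (fun p : RR * Omega => _) = fun p => rho p.1 p.2 0 k ^+ 2 * Y p.1 p.2 k 0 ^+ 2); last first.
    by apply/funext => p; rewrite sqrrN exprMn.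
  apply: (L1_mulb (mDT t) (Y_L1 k).1 (K := K ^+ 2)).
    exact: (jmeas_sqr (rho_jmeas 0 k)).
  apply: filterS hK => -[s w] /= h [/=]; rewrite in_itv/= => /andP[ts sT] _.
  rewrite normrX ler_sqr ?nnegrE//; apply: h.
  by rewrite (le_trans t0 ts).
- rewrite (_ : (fun p : RR * Omega => _) = fun p => gamma 0 k ^+ 2 * xi p.1 p.2 k 0 ^+ 2); last first.
    by apply/funext => p; rewrite exprMn.
  by apply: L1Z => //; exact: xi_L1.
Qed.

Lemma state_AC : {ae P, forall w i,
  is_AC t T (fun s => state X Y s w i 0) (fun s => state_velocity xi Y s w i 0) /\
  state X Y t w i 0 = col_mx x y i 0}.
Proof.
apply: filterS2 position_AC impact_AC => w hX hY i.
rewrite -(splitK i); case: (fintype.split i) => k /=.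
  have [_ h xt] := hX k; rewrite {2}/state !col_mxEu; split=> //.
  rewrite (_ : (fun s => _) = fun s => X s w k 0); last first.
    by apply/funext => s; rewrite /state col_mxEu.
  rewrite (_ : (fun s => state_velocity _ _ _ _ _ _) = fun s => - xi s w k 0)//.
  by apply/funext => s; rewrite velocityEu.
have [h yt] := hY k; rewrite {2}/state !col_mxEd; split=> //.
rewrite (_ : (fun s => _) = fun s => Y s w k 0); last first.
  by apply/funext => s; rewrite /state col_mxEd.
rewrite (_ : (fun s => state_velocity _ _ _ _ _ _)
    = fun s => - (rho s w 0 k * Y s w k 0) + gamma 0 k * xi s w k 0)//.
by apply/funext => s; rewrite velocityEd.
Qed.

End estimates.

(** ** The cost is integrable *)

Section integrability.
Variables (t : R) (x y : 'cV[R]_d) (xi X Y : R -> Omega -> 'cV[R]_d).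
Hypotheses (t0 : 0 <= t) (tT : t <= T).
Hypothesis hdyn : dynamics t x y xi X Y.
Local Notation DT := ((`[t, T] : set RR) `*` [set: Omega]).

Lemma in_DT (p : RR * Omega) : DT p -> 0 <= p.1 <= T.
Proof. by case: p => s w /= [/=]; rewrite in_itv/= => /andP[ts ->] _; rewrite (le_trans t0 ts). Qed.

Let xx_L1 i j : L1 nu DT (fun p => xi p.1 p.2 i 0 * xi p.1 p.2 j 0).
Proof.
apply: (L1_sqrM (mDT t)).
- exact: (xi_jmeas hdyn i).
- exact: (xi_jmeas hdyn j).
- exact: (xi_L1 hdyn i).
- exact: (xi_L1 hdyn j).
Qed.

Let XX_L1 i j : L1 nu DT (fun p => X p.1 p.2 i 0 * X p.1 p.2 j 0).
Proof.
apply: (L1_sqrM (mDT t)).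
- exact: (X_jmeas tT hdyn i).
- exact: (X_jmeas tT hdyn j).
- exact: (X_L1 t0 tT hdyn i).1.
- exact: (X_L1 t0 tT hdyn j).1.
Qed.

Lemma quad_control_L1 : L1 nu DT (fun p => quad Lambda (xi p.1 p.2)).
Proof.
rewrite (_ : (fun p : RR * Omega => _) = fun p => \sum_i \sum_j
    Lambda i j * (xi p.1 p.2 i 0 * xi p.1 p.2 j 0)); last first.
  by apply/funext => p; rewrite quadE.
by apply: (L1_sum (mDT t)) => i; apply: (L1_sum (mDT t)) => j; apply: (L1Z (mDT t)).
Qed.

Lemma kcost_L1 : L1 nu DT (fun p => kcost Lambda gamma (rho p.1 p.2) (Sigma p.1 p.2)
  (xi p.1 p.2) (X p.1 p.2) (Y p.1 p.2)).
Proof.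
have [Kr _ hKr] := ess_bounded_entries rho_bd.
have [Ks _ hKs] := ess_bounded_entries Sigma_bd.
apply: (L1D (mDT t)); first apply: (L1D (mDT t)).
- exact/(L1Z (mDT t))/quad_control_L1.
- apply/(L1Z (mDT t)).
  rewrite (_ : (fun p : RR * Omega => _) = fun p => \sum_i \sum_j
      Sigma p.1 p.2 i j * (X p.1 p.2 i 0 * X p.1 p.2 j 0)); last first.
    by apply/funext => p; rewrite quadE.
  apply: (L1_sum (mDT t)) => i; apply: (L1_sum (mDT t)) => j.
  apply: (L1_mulb (mDT t) (XX_L1 i j) (K := Ks)).
    exact: (Sigma_jmeas t0).
  by apply: filterS hKs => p h /in_DT hp; exact: h.
- apply: (L1_sum (mDT t)) => i; apply: (L1Z (mDT t)).
  apply: (L1_mulb (mDT t) (Y_L1 t0 tT hdyn i).1 (K := Kr)).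
    exact: (rho_jmeas t0).
  by apply: filterS hKr => p h /in_DT hp; exact: h.
Qed.

End integrability.

(** * The verification identity *)

Section riccati.
Variables (n : nat) (Q M : R -> Omega -> 'M[R]_(d + d)).
Hypothesis hQ : riccati_solution P W T Lambda gamma rho Sigma n Q M.

Lemma riccati_jmeas t i j : 0 <= t -> jmeas t T (fun s w => Q s w i j).
Proof.
move=> t0; have [[pQ _ _ _] _ _ _] := hQ.
by apply: (jmeasS t0 (lexx T)); exact: (progressive_jmeas hF (pQ i j)).
Qed.

Lemma riccati_tr t w : 0 <= t <= T -> (Q t w)^T = Q t w.
Proof. by have [[_ _ _ h] _ _ _] := hQ => /(h t w)[]. Qed.

Lemma riccati_quad_L1 t (v : 'cV[R]_(d + d)) : 0 <= t <= T ->
  Fm t (fun w => quad (Q t w) v) /\ L1 P setT (fun w => quad (Q t w) v).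
Proof.
move=> tT; have [[pQ _ bQ _] _ _ _] := hQ.
rewrite (_ : (fun w => _) = fun w => \sum_i \sum_j Q t w i j * (v i 0 * v j 0)); last first.
  by apply/funext => w; rewrite quadE.
have mQ i j : Fm t (fun w => Q t w i j) by exact: (progressive_adapted (pQ i j) tT).
split.
  by apply: measurable_sum => i; apply: measurable_sum => j; apply: measurable_funM.
apply: (L1_sum measurableT) => i; apply: (L1_sum measurableT) => j.
rewrite (_ : (fun w => _) = fun w => (v i 0 * v j 0) * Q t w i j); last first.
  by apply/funext => w; rewrite mulrC.
apply: L1Z => //; have [K hK] := bQ i j; apply: (@L1_bounded _ _ _ _ _ _ K) => //.
  by apply: (Fm_measurable hF (s := t)) => //; have /andP[] := tT.
by apply: filterS hK => w h _; exact: h.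
Qed.

(** All entries of Q and of the drift are bounded by one constant outside a
    null set, so that truncating the drift changes no integral. *)
Lemma riccati_bounded : exists2 K, 0 <= K &
  {ae P, forall w s, 0 <= s <= T -> forall i j, `|Q s w i j| <= K} /\
  {ae nu, forall p : RR * Omega, 0 <= p.1 <= T -> forall i j,
    `|riccati_drift Lambda gamma (rho p.1 p.2) (Sigma p.1 p.2) (Q p.1 p.2) i j| <= K}.
Proof.
have [[_ _ bQ _] _ _ _] := hQ.
have [Kr Kr0 hKr] := ess_bounded_entries rho_bd.
have [Ks Ks0 hKs] := ess_bounded_entries Sigma_bd.
have [Kq Kq0 hKq] := ess_bounded_paths_entries bQ.
have [K' K'0 hK'] := riccati_drift_bounded (Kr + Ks + Kq).
exists (Kq + K'); first exact: addr_ge0.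
split.
  by apply: filterS hKq => w h s hs i j; rewrite (le_trans (h s hs i j))// lerDl.
have hKq' := ae_prod_snd hKq.
apply: filterS3 hKr hKs hKq' => p h1 h2 h3 hp i j.
rewrite (le_trans (hK' _ _ _ _ _ _ i j))// ?lerDr// => k l.
- by rewrite (le_trans (h1 hp k l))// -addrA lerDl addr_ge0.
- by rewrite (le_trans (h2 hp k l))// addrAC lerDr addr_ge0.
- by rewrite (le_trans (h3 _ hp k l))// lerDr addr_ge0.
Qed.

Section verification.
Variables (t : R) (x y : 'cV[R]_d) (xi X Y : R -> Omega -> 'cV[R]_d).
Hypotheses (t0 : 0 <= t) (tT : t <= T).
Hypothesis hdyn : dynamics t x y xi X Y.
Local Notation DT := ((`[t, T] : set RR) `*` [set: Omega]).
Local Notation Z := (state X Y).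
Local Notation V := (state_velocity xi Y).
Local Notation drift s w := (riccati_drift Lambda gamma (rho s w) (Sigma s w) (Q s w)).

(** The product rule for the entry (i, j) of Q and the product of the
    coordinates i and j of the state. *)
Let entry K i j A : 0 <= K ->
  {ae P, forall w s, 0 <= s <= T -> forall i j, `|Q s w i j| <= K} ->
  {ae nu, forall p : RR * Omega, 0 <= p.1 <= T -> forall i j,
    `|drift p.1 p.2 i j| <= K} -> FF t A ->
  let rest p := Q p.1 p.2 i j * (V p.1 p.2 i 0 * Z p.1 p.2 j 0 + Z p.1 p.2 i 0 * V p.1 p.2 j 0)
    - clip K (drift p.1 p.2 i j) * (Z p.1 p.2 i 0 * Z p.1 p.2 j 0) in
  [/\ L1 P setT (fun w => Q T w i j * (Z T w i 0 * Z T w j 0)),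
      L1 P setT (fun w => Q t w i j), L1 nu DT rest &
      \int[P]_(w in A) (Q T w i j * (Z T w i 0 * Z T w j 0))
      = (col_mx x y i 0 * col_mx x y j 0) * \int[P]_(w in A) Q t w i j
        + \int[nu]_(p in `[t, T] `*` A) rest p].
Proof.
move=> K0 hK hD FA rest.
have [[pQ cQ _ _] [LM _] _ hE] := hQ.
have mz k := state_jmeas tT hdyn k; have mv k := velocity_jmeas t0 tT hdyn k.
have iz k := (state_L1 t0 tT hdyn k).1.
have iv k := velocity_L1 t0 tT hdyn k.
have mQ k l : jmeas t T (fun s w => Q s w k l) by exact: riccati_jmeas.
have mdrift : jmeas t T (fun s w => drift s w i j).
  apply: (entries_riccati (measurable_function_ring R DT)) => k l //.
  - exact: (rho_jmeas t0).
  - exact: (Sigma_jmeas t0).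
  - exact: mQ.
have adz k : adapted P W t T (fun s w => Z s w k 0).
  have [_ [aX _ _] [aY _ _]] := hdyn.
  move=> s ts; rewrite -(splitK k); case: (fintype.split k) => l /=.
    rewrite (_ : (fun w => _) = fun w => X s w l 0); first exact: aX.
    by apply/funext => w; rewrite /state col_mxEu.
  rewrite (_ : (fun w => _) = fun w => Y s w l 0); first exact: aY.
  by apply/funext => w; rewrite /state col_mxEd.
have adv k := velocity_adapted t0 hdyn k.
apply: (product_rule (q := fun s w => Q s w i j) (D := fun s w => clip K (drift s w i j))
  (a := fun s w => Z s w i 0 * Z s w j 0)
  (a' := fun s w => V s w i 0 * Z s w j 0 + Z s w i 0 * V s w j 0) (K := K) hF tT) => //.
- by apply: filterS hK => w h s /andP[ts sT]; apply: h; rewrite (le_trans t0 ts).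
- exact: (measurable_clip K mdrift).
- by move=> s w _; exact: clip_le.
- move=> u /andP[tu uT] B FB.
  have u0T : 0 <= u <= T by rewrite (le_trans t0 tu).
  have [I hI eI] := hE u u0T i j.
  have [iI I0] := ito_mean0 hW hF u0T hI.
  have e : {ae P, forall w, Q T w i j + \int[mu]_(s in `[u, T]) clip K (drift s w i j)
      - Q u w i j = I w}.
    apply: filterS2 eI (ae_prod_section hD) => w [id eQ] hd.
    suff -> : \int[mu]_(s in `[u, T]) clip K (drift s w i j)
        = \int[mu]_(s in `[u, T]) drift s w i j by rewrite eQ; ring.
    apply: Rint_eq_ae.
    + exact: measurable_itv.
    + by apply: measurable_clip; exact: (L1_measurable id).
    + exact: (L1_measurable id).
    + apply: filterS hd => s h; rewrite /= in_itv/= => /andP[us sT].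
      apply: clip_id; apply: h; rewrite /= sT andbT.
      by rewrite (le_trans _ us)// (le_trans t0).
  rewrite -(I0 B FB).
  have mB : measurable B by exact: (filtration_measurable hF uT FB).
  apply: Rint_eq_ae => //.
  + by apply: measurable_funTS; apply: (measurable_ae hF e); exact: L1_measurable iI.
  + by apply: measurable_funTS; exact: L1_measurable iI.
  + by apply: filterS e => w h _.
- move=> s ts; apply: measurable_funD; apply: measurable_funM.
  + exact: adv.
  + exact: adz.
  + exact: adz.
  + exact: adv.
- by apply: (L1D (mDT t)); apply: (L1_sqrM (mDT t)); (exact: mz || exact: mv || done).
- by apply: measurable_funM; exact: mz.
- by apply: (L1_sqrM (mDT t)); (exact: mz || done).
- apply: filterS (state_AC tT hdyn) => w h.
  have [hi ei] := h i; have [hj ej] := h j.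
  by split; [exact: AC_mul|rewrite ei ej].
Qed.

(** The cost of any control exceeds the quadratic form of the Riccati solution
    by the integrated squared deviation from the feedback law. It is the sum
    of the product rules for the entries, with the square completed. *)
Theorem verification A : FF t A ->
  [/\ L1 P setT (fun w => quad (riccati_terminal gamma n) (Z T w)),
      L1 nu DT (fun p => quad Lambda
        (xi p.1 p.2 - feedback Lambda gamma (Q p.1 p.2) (X p.1 p.2) (Y p.1 p.2))) &
      \int[P]_(w in A) quad (riccati_terminal gamma n) (Z T w)
        + 2 * \int[nu]_(p in `[t, T] `*` A) kcost Lambda gamma (rho p.1 p.2)
            (Sigma p.1 p.2) (xi p.1 p.2) (X p.1 p.2) (Y p.1 p.2)
      = \int[P]_(w in A) quad (Q t w) (col_mx x y)
        + \int[nu]_(p in `[t, T] `*` A) quad Lambda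
          (xi p.1 p.2 - feedback Lambda gamma (Q p.1 p.2) (X p.1 p.2) (Y p.1 p.2))].
Proof.
move=> FA; have [K K0 [hK hD]] := riccati_bounded.
have mA : measurable A by exact: (filtration_measurable hF tT FA).
have mDA : measurable ((`[t, T] : set RR) `*` A) by exact: measurableX.
pose kc (p : RR * Omega) := kcost Lambda gamma (rho p.1 p.2)
  (Sigma p.1 p.2) (xi p.1 p.2) (X p.1 p.2) (Y p.1 p.2).
pose sq (p : RR * Omega) := quad Lambda
  (xi p.1 p.2 - feedback Lambda gamma (Q p.1 p.2) (X p.1 p.2) (Y p.1 p.2)).
pose rest i j (p : RR * Omega) := Q p.1 p.2 i j * (V p.1 p.2 i 0 * Z p.1 p.2 j 0 + Z p.1 p.2 i 0 * V p.1 p.2 j 0)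
    - clip K (drift p.1 p.2 i j) * (Z p.1 p.2 i 0 * Z p.1 p.2 j 0).
have ent i j := @entry K i j A K0 hK hD FA.
have i1 i j : L1 P setT (fun w => Q T w i j * (Z T w i 0 * Z T w j 0)) by have [] := ent i j.
have i2 i j : L1 P setT (fun w => Q t w i j) by have [] := ent i j.
have i3 i j : L1 nu DT (rest i j) by have [] := ent i j.
have subA (f : Omega -> R) : L1 P setT f -> L1 P A f by exact: integrableS.
have subDA (f : RR * Omega -> R) : L1 nu DT f -> L1 nu (`[t, T] `*` A) f.
  by apply: integrableS => // -[s w] [].
have ik : L1 nu DT kc by exact: (kcost_L1 t0 tT hdyn).
have mQ k l : jmeas t T (fun s w => Q s w k l) by exact: riccati_jmeas.
have msq : measurable_fun DT sq.
  apply: (entries_quad (measurable_function_ring R DT)).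
    exact: (entries_cst (measurable_function_ring R DT)).
  apply: (entries_add (measurable_function_ring R DT)).
    by move=> i j; rewrite (ord1 j); exact: (xi_jmeas hdyn i).
  apply: (entries_opp (measurable_function_ring R DT)).
  apply: (entries_feedback (measurable_function_ring R DT)) => i j.
  - exact: mQ.
  - by rewrite (ord1 j); exact: (X_jmeas tT hdyn i).
  - by rewrite (ord1 j); exact: (Y_jmeas tT hdyn i).
have esum : {ae nu, forall p : RR * Omega, DT p ->
    \sum_i \sum_j rest i j p + 2 * kc p = sq p}.
  apply: filterS hD => p h /(in_DT t0) hp.
  have := square_completion pdL g0 (rho p.1 p.2) (Sigma p.1 p.2)
    (xi p.1 p.2) (X p.1 p.2) (Y p.1 p.2) (riccati_tr p.2 hp).
  rewrite /= => /(congr1 (fun r => r + 2 * kc p)); rewrite subrK -/(sq p) => <-; congr (_ + _).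
  rewrite !bilinE -big_split -sumrB /=; apply: eq_bigr => i _.
  rewrite -big_split -sumrB /=; apply: eq_bigr => j _.
  by rewrite /rest clip_id ?h// mulrDr.
have irest : L1 nu DT (fun p => \sum_i \sum_j rest i j p).
  by apply: (L1_sum (mDT t)) => i; apply: (L1_sum (mDT t)).
have isq : L1 nu DT sq.
  apply: (L1_eq_ae (mDT t) msq esum).
  by apply: (L1D (mDT t) irest); exact: (L1Z (mDT t)).
have eT : {ae P, forall w, quad (riccati_terminal gamma n) (Z T w)
    = \sum_i \sum_j Q T w i j * (Z T w i 0 * Z T w j 0)}.
  by have [_ _ h _] := hQ; apply: filterS h => w <-; rewrite quadE.
have mqT : measurable_fun setT (fun w => quad (riccati_terminal gamma n) (Z T w)).
  apply: (entries_quad (measurable_function_ring R setT)).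
    exact: (entries_cst (measurable_function_ring R setT)).
  move=> i j; rewrite (ord1 j).
  by apply: (jmeas_section1 (state_jmeas tT hdyn i)); rewrite tT lexx.
have iqT : L1 P setT (fun w => quad (riccati_terminal gamma n) (Z T w)).
  apply: (@L1_eq_ae _ _ _ _ _ _ (fun w => \sum_i \sum_j Q T w i j * (Z T w i 0 * Z T w j 0))) => //.
    by apply: filterS eT => w -> _.
  by apply: L1_sum => // i; apply: L1_sum.
split=> //.
have -> : \int[nu]_(p in `[t, T] `*` A) sq p = \int[nu]_(p in `[t, T] `*` A)
    (\sum_i \sum_j rest i j p + 2 * kc p).
  apply: Rint_eq_ae => //.
  - by apply: measurable_funS msq => // -[s w] [].
  - apply: L1_measurable; apply: subDA.
    by apply: (L1D (mDT t) irest); exact: (L1Z (mDT t)).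
  - by apply: filterS esum => p h [p1 p2]; rewrite h.
have iDA1 := subDA _ irest; have iDA2 := subDA _ (L1Z (mDT t) 2 ik).
have -> : \int[nu]_(p in `[t, T] `*` A) (\sum_i \sum_j rest i j p + 2 * kc p)
    = \int[nu]_(p in `[t, T] `*` A) (\sum_i \sum_j rest i j p)
      + \int[nu]_(p in `[t, T] `*` A) (2 * kc p) by exact: RintegralD.
rewrite RintegralZl//; last exact: subDA.
rewrite addrA; congr (_ + _).
have -> : \int[P]_(w in A) quad (riccati_terminal gamma n) (Z T w)
    = \int[P]_(w in A) \sum_i \sum_j Q T w i j * (Z T w i 0 * Z T w j 0).
  apply: Rint_eq_ae => //; [exact: measurable_funTS|apply: L1_measurable; apply: subA|].
    by apply: L1_sum => // i; apply: L1_sum.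
  by apply: filterS eT.
rewrite Rint_sum//; last by move=> i; apply: subA; exact: L1_sum.
rewrite Rint_sum//; last by move=> i; apply: subDA; exact: (L1_sum (mDT t)).
have -> : \int[P]_(w in A) quad (Q t w) (col_mx x y)
    = \sum_i \sum_j (col_mx x y i 0 * col_mx x y j 0) * \int[P]_(w in A) Q t w i j.
  rewrite (@eq_Rintegral _ _ _ P A (fun w => \sum_i \sum_j
    (col_mx x y i 0 * col_mx x y j 0) * Q t w i j)); last first.
    move=> w _; rewrite quadE; apply: eq_bigr => i _; apply: eq_bigr => j _.
    by rewrite mulrC.
  rewrite Rint_sum//; last by move=> i; apply: subA; apply: L1_sum => // j; exact: L1Z.
  apply: eq_bigr => i _; rewrite Rint_sum//; last by move=> j; apply: subA; exact: L1Z.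
  by apply: eq_bigr => j _; rewrite RintegralZl//; exact: subA.
rewrite -big_split; apply: eq_bigr => i _ /=.
rewrite Rint_sum//; last by move=> j; exact: subA.
rewrite Rint_sum//; last by move=> j; exact: subDA.
rewrite -big_split; apply: eq_bigr => j _ /=.
by have [] := ent i j.
Qed.

End verification.
End riccati.

(** ** The cost of a control *)

Section cost_of_control.
Variables (t : R) (x y : 'cV[R]_d) (xi X Y : R -> Omega -> 'cV[R]_d).
Hypotheses (t0 : 0 <= t) (tT : t <= T).
Hypothesis hdyn : dynamics t x y xi X Y.
Local Notation DT := ((`[t, T] : set RR) `*` [set: Omega]).
Local Notation run := (running_cost Lambda Sigma xi X Y).
Local Notation kc s w := (kcost Lambda gamma (rho s w) (Sigma s w) (xi s w) (X s w) (Y s w)).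

Lemma running_jmeas : jmeas t T run.
Proof.
have mr := measurable_function_ring R DT.
have hx : entries (fun f : RR * Omega -> R => measurable_fun DT f) (fun p => xi p.1 p.2).
  by move=> i j; rewrite (ord1 j); exact: (xi_jmeas hdyn i).
have hX : entries (fun f : RR * Omega -> R => measurable_fun DT f) (fun p => X p.1 p.2).
  by move=> i j; rewrite (ord1 j); exact: (X_jmeas tT hdyn i).
have hY : entries (fun f : RR * Omega -> R => measurable_fun DT f) (fun p => Y p.1 p.2).
  by move=> i j; rewrite (ord1 j); exact: (Y_jmeas tT hdyn i).
have hS : entries (fun f : RR * Omega -> R => measurable_fun DT f) (fun p => Sigma p.1 p.2).
  by move=> i j; exact: (Sigma_jmeas t0).
rewrite /jmeas (_ : (fun p : RR * Omega => _) = fun p =>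
  2^-1 * quad Lambda (xi p.1 p.2) + ((Y p.1 p.2)^T *m xi p.1 p.2) 0 0
  + 2^-1 * quad (Sigma p.1 p.2) (X p.1 p.2)); last first.
  by apply/funext => p; rewrite /running_cost !addmx00 mxE [X in _ + X]mxE.
apply: measurable_funD; first apply: measurable_funD.
- apply: measurable_funM => //; apply: (entries_quad mr) => //; exact: (entries_cst mr).
- exact: ((entries_mul mr (entries_tr hY) hx) 0 0).
- by apply: measurable_funM => //; exact: (entries_quad mr).
Qed.

(** Y.xi is the derivative of the stored energy plus the dissipation. *)
Lemma running_costE s w : run s w = kc s w + \sum_i (2 * gamma 0 i)^-1 *
  ((- (rho s w 0 i * Y s w i 0) + gamma 0 i * xi s w i 0) * Y s w i 0
   + Y s w i 0 * (- (rho s w 0 i * Y s w i 0) + gamma 0 i * xi s w i 0)).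
Proof.
rewrite /running_cost !addmx00 mxE [X in _ + X = _]mxE -/(quad _ _) -/(quad _ _) /kcost.
rewrite addrAC -[RHS]addrA; congr (_ + _).
rewrite /dissipation -big_split mxE /=; apply: eq_bigr => i _.
by rewrite mxE; field; rewrite gt_eqF.
Qed.

(** The energy terms integrate to a boundary term, by the product rule for the
    absolutely continuous paths of Y. *)
Lemma cost_pathwise : {ae P, forall w,
  \int[mu]_(s in `[t, T]) run s w = \int[mu]_(s in `[t, T]) kc s w
    + 2^-1 * energy gamma (Y T w) - 2^-1 * energy gamma y}.
Proof.
have ik := kcost_L1 t0 tT hdyn.
have mDt : measurable (`[t, T] : set RR) by exact: measurable_itv.
have aek := fubini_ae2 (m1 := mu) (m2 := P) (f := fun s w => kc s w) mDt measurableT ik.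
apply: filterS2 (impact_AC tT hdyn) aek => w hY /(_ Logic.I) ikw.
pose d_ i s := - (rho s w 0 i * Y s w i 0) + gamma 0 i * xi s w i 0.
have hYY i := AC_mul (hY i).1 (hY i).1.
have TT : t <= T <= T by rewrite tT lexx.
have i1 i : L1 mu `[t, T] (fun s => (2 * gamma 0 i)^-1 * (d_ i s * Y s w i 0 + Y s w i 0 * d_ i s)).
  by apply: (L1Z mDt); exact: (hYY i T TT).1.
have -> : \int[mu]_(s in `[t, T]) run s w = \int[mu]_(s in `[t, T]) (kc s w +
    \sum_i (2 * gamma 0 i)^-1 * (d_ i s * Y s w i 0 + Y s w i 0 * d_ i s)).
  by apply: eq_Rintegral => s _; exact: running_costE.
rewrite RintegralD//; last exact: (L1_sum mDt).
rewrite -addrA; congr (_ + _); rewrite (Rint_sum mDt)//.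
rewrite /energy !mulr_sumr -sumrB; apply: eq_bigr => i _.
rewrite RintegralZl//; last exact: (hYY i T TT).1.
have := (hYY i T TT).2; rewrite (hY i).2 => e.
have -> : \int[mu]_(s in `[t, T]) (d_ i s * Y s w i 0 + Y s w i 0 * d_ i s)
    = Y T w i 0 * Y T w i 0 - y i 0 * y i 0 by rewrite e; ring.
by field; rewrite gt_eqF.
Qed.

Let Zc w := \int[mu]_(s in `[t, T]) run s w.

Lemma energy_L1 : L1 P setT (fun w => energy gamma (Y T w)).
Proof.
apply: L1_sum => // i; apply: L1Z => //.
exact: (Y_L1 t0 tT hdyn i).2.
Qed.

Lemma cost_integral : L1 P setT Zc /\ forall A, FF t A ->
  \int[P]_(w in A) Zc w = \int[nu]_(p in `[t, T] `*` A) kc p.1 p.2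
    + 2^-1 * \int[P]_(w in A) energy gamma (Y T w)
    - \int[P]_(w in A) (2^-1 * energy gamma y).
Proof.
have ik := kcost_L1 t0 tT hdyn.
have mDt : measurable (`[t, T] : set RR) by exact: measurable_itv.
pose k w := \int[mu]_(s in `[t, T]) kc s w.
have iK : L1 P setT k.
  exact: (fubini_L1_2 (m1 := mu) (m2 := P) (f := fun s w => kc s w) mDt measurableT ik).
have ie : L1 P setT (fun w => 2^-1 * energy gamma (Y T w)) by apply: L1Z => //; exact: energy_L1.
have ic : L1 P setT (fun=> 2^-1 * energy gamma y) by exact: L1_cst.
have mZ : measurable_fun setT Zc by exact: (measurable_Rint_section mu mDt running_jmeas).
have iS : L1 P setT (fun w => k w + 2^-1 * energy gamma (Y T w) - 2^-1 * energy gamma y).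
  by apply: L1B => //; exact: L1D.
have iZ : L1 P setT Zc.
  by apply: L1_eq_ae iS => //; apply: filterS cost_pathwise => w e _; rewrite /Zc e.
split=> // A FA; have mA : measurable A by exact: (filtration_measurable hF tT FA).
have subA (f : Omega -> R) : L1 P setT f -> L1 P A f by exact: integrableS.
transitivity (\int[P]_(w in A) (k w + 2^-1 * energy gamma (Y T w) - 2^-1 * energy gamma y)).
  apply: Rint_eq_ae => //; [exact: measurable_funTS|exact/L1_measurable/subA|].
  by apply: filterS cost_pathwise.
have iKA := subA _ iK; have ieA := subA _ ie; have icA := subA _ ic.
rewrite RintegralB//; last exact: L1D.
rewrite RintegralD//; congr (_ + _ - _).
  apply: (fubini_Rint2 (m1 := mu) (m2 := P) (f := fun s w => kc s w) mDt mA).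
  apply: integrableS ik => //; last by move=> -[s w] [].
  exact: measurableX.
by rewrite RintegralZl//; apply: subA; exact: energy_L1.
Qed.

Section admissible.
Variables (n : nat) (Q M : R -> Omega -> 'M[R]_(d + d)).
Hypothesis hQ : riccati_solution P W T Lambda gamma rho Sigma n Q M.

(** For a liquidating control the terminal term of [verification] is the
    stored energy at T, and it cancels the one in the cost. *)
Theorem admissible_cost : {ae P, forall w, X T w = 0} ->
  [/\ L1 P setT Zc, L1 P setT (fun w => value_form gamma (Q t w) x y) &
  forall A, FF t A -> \int[P]_(w in A) Zc w = \int[P]_(w in A) value_form gamma (Q t w) x y
    + 2^-1 * \int[nu]_(p in `[t, T] `*` A) quad Lambda
          (xi p.1 p.2 - feedback Lambda gamma (Q p.1 p.2) (X p.1 p.2) (Y p.1 p.2))].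
Proof.
move=> XT; have [iZ cZ] := cost_integral.
have t0T : 0 <= t <= T by rewrite t0 tT.
have [_ iq] := riccati_quad_L1 hQ (col_mx x y) t0T.
have iv : L1 P setT (fun w => value_form gamma (Q t w) x y).
  rewrite (_ : (fun w => _) = fun w => 2^-1 * (quad (Q t w) (col_mx x y) - energy gamma y)).
    by apply: L1Z => //; apply: L1B => //; exact: L1_cst.
  by apply/funext => w; rewrite value_formE.
split=> // A FA; have mA : measurable A by exact: (filtration_measurable hF tT FA).
have subA (f : Omega -> R) : L1 P setT f -> L1 P A f by exact: integrableS.
have [iT _ e] := verification hQ t0 tT hdyn FA.
have eT : \int[P]_(w in A) quad (riccati_terminal gamma n) (state X Y T w)
    = \int[P]_(w in A) energy gamma (Y T w).
  apply: Rint_eq_ae => //; [exact/L1_measurable/subA|exact/L1_measurable/subA/energy_L1|].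
  by apply: filterS XT => w h _; rewrite /state h riccati_terminal0.
rewrite cZ// (_ : \int[P]_(w in A) value_form _ _ _ _ =
    2^-1 * \int[P]_(w in A) quad (Q t w) (col_mx x y) - \int[P]_(w in A) (2^-1 * energy gamma y)).
  by rewrite eT in e; lra.
rewrite (@eq_Rintegral _ _ _ P A (fun w => 2^-1 * quad (Q t w) (col_mx x y) - 2^-1 * energy gamma y)).
  rewrite RintegralB//; [|by apply: subA; exact: L1Z|by apply: subA; exact: L1_cst].
  by rewrite RintegralZl//; exact: subA.
by move=> w _; rewrite value_formE// mulrBr.
Qed.

End admissible.
End cost_of_control.

(** * Existence of controls *)

Lemma progressive_function_ring :
  function_ring (fun f : R * Omega -> R => progressive P W T (fun s w => f (s, w))).
Proof.
split=> [c|f g hf hg|f g hf hg] s hs; first exact: measurable_cst.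
- by apply: measurable_funD; [exact: hf|exact: hg].
- by apply: measurable_funM; [exact: hf|exact: hg].
Qed.

Lemma progressive_clip K f : progressive P W T f ->
  progressive P W T (fun s w => clip K (f s w)).
Proof. by move=> hf s hs; apply: measurable_clip; exact: hf. Qed.

Section existence.
Variables (t : R) (x y : 'cV[R]_d).
Hypotheses (t0 : 0 <= t) (tT : t <= T).
Local Notation DT := ((`[t, T] : set RR) `*` [set: Omega]).

Lemma cst_L1 (c : R) : L1 nu DT (fun=> c).
Proof. exact: (@L1_snd _ _ _ P t T (fun=> c) (L1_cst c measurableT P1)). Qed.

(** A differential equation with truncated resilience gives the impact
    process, since the truncation is only active on a null set. *)
Lemma impact_intro K xi Y : {ae nu, forall p : RR * Omega, 0 <= p.1 <= T ->
    forall i j, `|rho p.1 p.2 i j| <= K} ->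
  (forall i, jmeas t T (fun s w => xi s w i 0)) ->
  entrywise (adapted P W t T) Y -> entrywise (continuous_paths t T) Y ->
  {ae P, forall w s i, t <= s <= T ->
    let drift u := - (clip K (rho u w 0 i) * Y u w i 0) + gamma 0 i * xi u w i 0 in
    L1 mu `[t, s] drift /\ Y s w i 0 = y i 0 + \int[mu]_(u in `[t, s]) drift u} ->
  is_impact P W T gamma rho t y xi Y.
Proof.
move=> hK mxi aY cY hY; split=> //.
have mY i : jmeas t T (fun s w => Y s w i 0).
  exact: (continuous_jmeas hF tT (aY i 0) (cY i 0)).
have mr i j : jmeas t T (fun s w => rho s w i j) by exact: (rho_jmeas t0).
have mdr i : jmeas t T (fun u w => impact_drift gamma rho xi Y u w i 0).
  rewrite /jmeas (_ : (fun p : RR * Omega => _) = fun p =>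
    - (rho p.1 p.2 0 i * Y p.1 p.2 i 0) + gamma 0 i * xi p.1 p.2 i 0); last first.
    by apply/funext => p; rewrite impact_driftE.
  apply: measurable_funD; last by apply: measurable_funM => //; exact: mxi.
  by apply: measurableT_comp => //; apply: measurable_funM; [exact: mr|exact: mY].
apply: filterS2 hY (ae_prod_section hK) => w h hk s ts i.
have [i1 e1] := h s i ts; have /andP[ts' sT] := ts.
have mts : measurable (`[t, s] : set RR) by exact: measurable_itv.
have ms : measurable_fun (`[t, s] : set RR) (fun u => impact_drift gamma rho xi Y u w i 0).
  apply: measurable_funS (jmeas_section2 w (mdr i)) => //.
  by move=> u /=; rewrite !in_itv/= => /andP[-> us]; exact: le_trans us sT.
pose I : set RR := [set` `[t, s]].
have e : {ae mu, forall u, I u ->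
    - (clip K (rho u w 0 i) * Y u w i 0) + gamma 0 i * xi u w i 0
    = impact_drift gamma rho xi Y u w i 0}.
  apply: filterS hk => u hu; rewrite /I /= in_itv/= => /andP[tu us].
  by rewrite impact_driftE clip_id// hu//= (le_trans t0 tu) (le_trans us).
split; first exact: (L1_eq_ae mts ms e i1).
rewrite e1; congr (_ + _); apply: Rint_eq_ae => //.
exact: L1_measurable i1.
Qed.

(** The closed-loop equation is linear. Its coefficients are truncated to be
    bounded everywhere, and agree with the original ones for almost every
    path, at almost every time. The law holds identically because the control
    is defined by it. *)
Lemma feedback_control n Q M : riccati_solution P W T Lambda gamma rho Sigma n Q M ->
  exists xi X Y, dynamics t x y xi X Y /\
  forall s w, xi s w = feedback Lambda gamma (Q s w) (X s w) (Y s w).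
Proof.
move=> hQ; have [[pQ _ bQ _] _ _ _] := hQ.
have [Kr Kr0 hKr] := ess_bounded_entries rho_bd.
have [Kq Kq0 hKq] := ess_bounded_paths_entries bQ.
pose rc (p : R * Omega) : 'rV[R]_d := \row_i clip Kr (rho p.1 p.2 0 i).
pose Qc (p : R * Omega) : 'M[R]_(d + d) := \matrix_(i, j) clip Kq (Q p.1 p.2 i j).
pose B : 'M[R]_(d + d, d) := col_mx (- 1%:M) G.
pose A (p : R * Omega) : 'M[R]_(d + d) :=
  - (B *m invmx Lambda *m row_mx (- 1%:M) G *m Qc p) + block_mx 0 0 0 (- diag_mx (rc p)).
have entA (S : (R * Omega -> R) -> Prop) : function_ring S -> entries S Qc -> entries S rc ->
    entries S A.
  move=> hS hq hr; apply: (entries_add hS).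
    by apply: (entries_opp hS); apply: (entries_mul hS) => //; exact: (entries_cst hS).
  apply: entries_block; do ?exact: (entries_cst hS).
  by apply: (entries_opp hS); exact: (entries_diag hS).
have pA : entrywise (progressive P W T) (fun s w => A (s, w)).
  have := entA _ progressive_function_ring; apply => i j.
    rewrite (_ : (fun s w => _) = fun s w => clip Kq (Q s w i j)).
      by apply: progressive_clip; exact: pQ.
    by apply/funext => s; apply/funext => w; rewrite mxE.
  rewrite (_ : (fun s w => _) = fun s w => clip Kr (rho s w 0 j)).
    by apply: progressive_clip; exact: rho_prog.
  by apply/funext => s; apply/funext => w; rewrite mxE.
have [K K0 bA] : exists2 K : R, 0 <= K & forall p, setT p -> forall i j, `|A p i j| <= K.
  apply: bounded_entries; apply: (entA _ (bounded_function_ring R setT)) => i j.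
    by exists Kq => p _; rewrite mxE clip_le.
  by exists Kr => p _; rewrite mxE clip_le.
have [z [az cz [C hC] hz]] := linear_ode hF 0 (col_mx x y) t0 tT K0 pA (fun s w => bA (s, w) Logic.I).
pose X s w : 'cV[R]_d := usubmx (z s w); pose Y s w : 'cV[R]_d := dsubmx (z s w).
have XE s w i j : X s w i j = z s w (lshift d i) j by rewrite /X mxE.
have YE s w i j : Y s w i j = z s w (rshift d i) j by rewrite /Y mxE.
have aX : entrywise (adapted P W t T) X.
  by move=> i j s ts; under eq_fun do rewrite XE; exact: az.
have aY : entrywise (adapted P W t T) Y.
  by move=> i j s ts; under eq_fun do rewrite YE; exact: az.
have cX : entrywise (continuous_paths t T) X.
  move=> i j w; rewrite (_ : (fun s => X s w i j) = fun s => z s w (lshift d i) j); first exact: cz.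
  by apply/funext => s; rewrite XE.
have cY : entrywise (continuous_paths t T) Y.
  move=> i j w; rewrite (_ : (fun s => Y s w i j) = fun s => z s w (rshift d i) j); first exact: cz.
  by apply/funext => s; rewrite YE.
pose xi s w : 'cV[R]_d := feedback Lambda gamma (Q s w) (X s w) (Y s w).
have mX i j : jmeas t T (fun s w => X s w i j) by exact: (continuous_jmeas hF tT (aX i j) (cX i j)).
have mY i j : jmeas t T (fun s w => Y s w i j) by exact: (continuous_jmeas hF tT (aY i j) (cY i j)).
have mQ i j : jmeas t T (fun s w => Q s w i j) by exact: (riccati_jmeas hQ).
have mxi i j : jmeas t T (fun s w => xi s w i j).
  exact: (entries_feedback (measurable_function_ring R DT) _ _ mQ mX mY).
have velE u w : Qc (u, w) = Q u w ->
    A (u, w) *m z u w + 0 = velocity gamma (rc (u, w)) (xi u w) (Y u w).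
  move=> eQ; rewrite addr0 /A eQ mulmxDl /velocity -[z u w]vsubmxK -/(X u w) -/(Y u w).
  rewrite mul_block_col !mul0mx !addr0 add0r.
  have -> : - (B *m invmx Lambda *m row_mx (- 1%:M) G *m Q u w) *m col_mx (X u w) (Y u w)
      = B *m xi u w by rewrite /xi /feedback mulNmx mulmxN !mulmxA.
  by rewrite /B mul_col_mx add_col_mx mulNmx mul1mx addr0 mulNmx addrC.
have QcE : {ae P, forall w u, 0 <= u <= T -> Qc (u, w) = Q u w}.
  apply: filterS hKq => w h u hu; apply/matrixP => i j; rewrite mxE clip_id//.
  exact: h.
exists xi, X, Y; split=> //; split.
- move=> i j; apply: L2F_intro.
  + move=> s ts; have hs : 0 <= s <= T by have /andP[ts' ->] := ts; rewrite (le_trans t0).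
    apply: (entries_feedback (@measurable_function_ring R _ (filtered P W s) setT)) => k l.
    * exact: (progressive_adapted (pQ k l) hs).
    * exact: aX.
    * exact: aY.
  + exact: mxi.
  + have [K' K'0 hK'] := feedback_bounded (Kq + `|C|).
    apply: (L1_le_ae (mDT t) _ _ (cst_L1 (K' ^+ 2))); first exact: jmeas_sqr (mxi i j).
    apply: filterS (ae_prod_snd hKq) => -[s w] /= h [/=]; rewrite in_itv/= => ts _.
    have hs : 0 <= s <= T by have /andP[ts' ->] := ts; rewrite (le_trans t0).
    rewrite normrX ler_sqr ?nnegrE//; apply: hK' => k l.
    * by rewrite (le_trans (h _ hs k l))// lerDl.
    * rewrite XE (ord1 l) (le_trans (hC s w _ ts))// (le_trans (ler_norm _))// lerDr//.
    * rewrite YE (ord1 l) (le_trans (hC s w _ ts))// (le_trans (ler_norm _))// lerDr//.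
- split=> //; apply: filterS QcE => w eQ s ts i.
  have /andP[ts' sT] := ts; have mts : measurable (`[t, s] : set RR) by exact: measurable_itv.
  have [i1 e1] := hz w s (lshift d i) ts.
  have e u : [set` `[t, s]] u -> (A (u, w) *m z u w + 0) (lshift d i) 0 = - xi u w i 0.
    rewrite /= in_itv/= => /andP[tu us]; rewrite velE.
      by rewrite /velocity col_mxEu mxE.
    by apply: eQ; rewrite (le_trans t0 tu) (le_trans us).
  have iN : L1 mu `[t, s] (fun u => - xi u w i 0).
    by apply: eq_integrable i1 => // u /set_mem hu /=; rewrite e.
  have ix : L1 mu `[t, s] (fun u => xi u w i 0).
    have := L1N iN; apply: eq_integrable => // u _ /=.
    by rewrite opprK.
  split=> //; rewrite XE e1 col_mxEu; congr (_ + _); rewrite -RintN//.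
  by apply: eq_Rintegral => u /set_mem; exact: e.
- apply: (impact_intro hKr) => //.
  apply: filterS QcE => w eQ s i ts.
  pose drift u := - (clip Kr (rho u w 0 i) * Y u w i 0) + gamma 0 i * xi u w i 0.
  have /andP[ts' sT] := ts; have mts : measurable (`[t, s] : set RR) by exact: measurable_itv.
  have [i1 e1] := hz w s (rshift d i) ts.
  have e u : [set` `[t, s]] u -> (A (u, w) *m z u w + 0) (rshift d i) 0 = drift u.
    rewrite /= in_itv/= => /andP[tu us]; rewrite velE.
      by rewrite /velocity col_mxEd /drift !mul_diag_mx !mxE.
    by apply: eQ; rewrite (le_trans t0 tu) (le_trans us).
  split; first by apply: eq_integrable i1 => // u /set_mem hu /=; rewrite e.
  rewrite YE e1 col_mxEd; congr (_ + _).
  by apply: eq_Rintegral => u /set_mem; exact: e.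
Qed.

(** Liquidation at constant speed, whose cost bounds the values for all n. *)
Lemma reference_control : t < T ->
  exists xi X Y, dynamics t x y xi X Y /\ forall w, X T w = 0.
Proof.
move=> ltT; have [Kr Kr0 hKr] := ess_bounded_entries rho_bd.
pose xi0 : 'cV[R]_d := (T - t)^-1 *: x.
pose A (p : R * Omega) : 'M[R]_d := - diag_mx (\row_i clip Kr (rho p.1 p.2 0 i)).
have entA (S : (R * Omega -> R) -> Prop) : function_ring S ->
    entries S (fun p => \row_i clip Kr (rho p.1 p.2 0 i)) -> entries S A.
  by move=> hS hr; apply: (entries_opp hS); exact: (entries_diag hS).
have pA : entrywise (progressive P W T) (fun s w => A (s, w)).
  have := entA _ progressive_function_ring; apply => i j.
  rewrite (_ : (fun s w => _) = fun s w => clip Kr (rho s w 0 j)).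
    by apply: progressive_clip; exact: rho_prog.
  by apply/funext => s; apply/funext => w; rewrite mxE.
have [K K0 bA] : exists2 K : R, 0 <= K & forall p, setT p -> forall i j, `|A p i j| <= K.
  apply: bounded_entries; apply: (entA _ (bounded_function_ring R setT)) => i j.
  by exists Kr => p _; rewrite mxE clip_le.
have [Y [aY cY _ hY]] := linear_ode hF (G *m xi0) y t0 tT K0 pA (fun s w => bA (s, w) Logic.I).
pose X (s : R) (_ : Omega) : 'cV[R]_d := x - (s - t) *: xi0.
exists (fun _ _ => xi0), X, Y; split; last first.
  by move=> w; rewrite /X scalerA mulfV ?scale1r ?subrr// subr_eq0 gt_eqF.
split.
- move=> i j; apply: L2F_intro.
  + by move=> s _.
  + exact: measurable_cst.
  + exact: cst_L1.
- split.
  + by move=> i j s _.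
  + move=> i j w; rewrite (_ : (fun s => _) = fun s => x i j - (s - t) * xi0 i j).
      apply: continuous_subspaceT => s; apply: cvgB; first exact: cvg_cst.
      by apply: cvgMl; apply: cvgB; [exact: cvg_id|exact: cvg_cst].
    by apply/funext => s; rewrite !mxE.
  + apply: aeW => w s /andP[ts sT] i; have mts : measurable (`[t, s] : set RR) by exact: measurable_itv.
    split; first by apply: L1_cst => //; exact: (lebesgue_itv_lty t s).
    rewrite /X !mxE; congr (_ - _); rewrite Rintegral_cst//= lebesgue_measure_itv/= lte_fin.
    case: ltP => h /=; first by rewrite mulrC.
    by have -> : s = t; [apply/eqP; rewrite eq_le h|rewrite subrr mul0r mulr0].
- apply: (impact_intro hKr) => //; first by move=> i; exact: measurable_cst.
  apply: aeW => w s i ts; pose drift u := - (clip Kr (rho u w 0 i) * Y u w i 0) + gamma 0 i * xi0 i 0.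
  have /andP[ts' sT] := ts; have mts : measurable (`[t, s] : set RR) by exact: measurable_itv.
  have [i1 e1] := hY w s i ts.
  have e u : (A (u, w) *m Y u w + G *m xi0) i 0 = drift u.
    by rewrite /A /drift mulNmx !mul_diag_mx !mxE.
  split; first by apply: eq_integrable i1 => // u _ /=; rewrite e.
  by rewrite e1; congr (_ + _); apply: eq_Rintegral => u _; exact: e.
Qed.

End existence.
(** * Comparison of the penalized problems *)

Section penalized.
Variables (Qn Mn : nat -> R -> Omega -> 'M[R]_(d + d)).
Hypothesis hQn : forall n : nat, gamma_max gamma <= n%:R ->
  riccati_solution P W T Lambda gamma rho Sigma n (Qn n) (Mn n).

Section comparison.
Variables (t : R) (x y : 'cV[R]_d).
Hypotheses (t0 : 0 <= t) (tT : t <= T).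
Local Notation DT := ((`[t, T] : set RR) `*` [set: Omega]).

Definition kc xi X Y (p : RR * Omega) := kcost Lambda gamma (rho p.1 p.2)
  (Sigma p.1 p.2) (xi p.1 p.2) (X p.1 p.2) (Y p.1 p.2).

(** The squared deviation from the n-th feedback law, measured by Lambda; its
    integral is the excess of the cost in [verification]. *)
Definition gap n xi X Y (p : RR * Omega) := quad Lambda
  (xi p.1 p.2 - feedback Lambda gamma (Qn n p.1 p.2) (X p.1 p.2) (Y p.1 p.2)).

Definition feedback_law n xi X Y := forall s w,
  xi s w = feedback Lambda gamma (Qn n s w) (X s w) (Y s w).

(** Twice the expectation of the value form, shifted by the energy of y
    ([value_formE]). *)
Definition riccati_value n := \int[P]_w quad (Qn n t w) (col_mx x y).

Lemma gap_ge0 n xi X Y p : 0 <= gap n xi X Y p.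
Proof. exact: (pd_psd pdL).2. Qed.

Lemma gap_feedback n xi X Y p : feedback_law n xi X Y -> gap n xi X Y p = 0.
Proof. by move=> h; rewrite /gap h subrr /quad mulmx0 mxE. Qed.

Lemma feedbackB (A : 'M[R]_(d + d)) (x1 y1 x2 y2 : 'cV[R]_d) :
  feedback Lambda gamma A (x1 - x2) (y1 - y2)
  = feedback Lambda gamma A x1 y1 - feedback Lambda gamma A x2 y2.
Proof.
rewrite /feedback (_ : col_mx (x1 - x2) (y1 - y2) = col_mx x1 y1 - col_mx x2 y2).
  by rewrite mulmxBr opprB opprK addrC.
by rewrite opp_col_mx add_col_mx.
Qed.

Lemma kc_ge xi X Y (p : RR * Omega) : DT p -> 2^-1 * quad Lambda (xi p.1 p.2) <= kc xi X Y p.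
Proof.
move=> /(in_DT t0) hp; apply: kcost_ge => //; first by move=> i; exact: rho0.
exact: Sigma_psd.
Qed.

Section restriction.
Variable A : set Omega.
Hypothesis FA : FF t A.

Let mA : measurable A. Proof. exact: (filtration_measurable hF tT FA). Qed.
Let mDA : measurable ((`[t, T] : set RR) `*` A). Proof. exact: measurableX. Qed.

Lemma L1_restrict (f : Omega -> R) : L1 P setT f -> L1 P A f.
Proof. exact: integrableS. Qed.

Lemma L1_restrict_prod (f : RR * Omega -> R) : L1 nu DT f -> L1 nu (`[t, T] `*` A) f.
Proof. by apply: integrableS => // -[s w] []. Qed.

(** The optimal control of the m-th problem is a competitor in the n-th one,
    where the terminal position is penalized less. Besides monotonicity this
    bounds its deviation from the n-th law. *)
Lemma riccati_compare n m xi X Y : gamma_max gamma <= n%:R -> (n <= m)%N ->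
  dynamics t x y xi X Y -> feedback_law m xi X Y ->
  L1 nu DT (gap n xi X Y) /\
  \int[P]_(w in A) quad (Qn n t w) (col_mx x y) + \int[nu]_(p in `[t, T] `*` A) gap n xi X Y p
  <= \int[P]_(w in A) quad (Qn m t w) (col_mx x y).
Proof.
move=> gn nm hdyn hlaw; have gm : gamma_max gamma <= m%:R by rewrite (le_trans gn)// ler_nat.
have [i1 i2 e1] := verification (hQn gn) t0 tT hdyn FA.
have [i3 i4 e2] := verification (hQn gm) t0 tT hdyn FA.
split=> //; rewrite -e1.
have -> : \int[P]_(w in A) quad (Qn m t w) (col_mx x y) =
    \int[P]_(w in A) quad (Qn m t w) (col_mx x y) + \int[nu]_(p in `[t, T] `*` A) gap m xi X Y p.
  rewrite (@eq_Rintegral _ _ _ nu _ (fun=> 0) (gap m xi X Y)); last first.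
    by move=> p _; rewrite gap_feedback.
  by rewrite Rintegral_cst// mul0r addr0.
rewrite -e2 lerD2r; apply: le_Rintegral => //; [exact: L1_restrict|exact: L1_restrict|].
by move=> w _; exact: riccati_terminal_mono.
Qed.

End restriction.

Let FT : FF t setT.
Proof. exact: (@measurableT _ (filtered P W t)). Qed.

Lemma feedback_gap n m xi X Y : gamma_max gamma <= n%:R -> (n <= m)%N ->
  dynamics t x y xi X Y -> feedback_law m xi X Y ->
  L1 nu DT (gap n xi X Y) /\
  \int[nu]_(p in DT) gap n xi X Y p <= riccati_value m - riccati_value n.
Proof.
move=> gn nm hdyn hlaw; have [ig h] := riccati_compare FT gn nm hdyn hlaw.
by split=> //; rewrite lerBrDl.
Qed.

Lemma kc_quad_le xi X Y : dynamics t x y xi X Y ->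
  \int[nu]_(p in DT) quad Lambda (xi p.1 p.2) <= 2 * \int[nu]_(p in DT) kc xi X Y p.
Proof.
move=> hdyn.
have ik : L1 nu DT (kc xi X Y).
  exact: (kcost_L1 t0 tT hdyn).
rewrite -RintegralZl//; apply: le_Rintegral => //.
- exact: (quad_control_L1 hdyn).
- exact: (L1Z (mDT t)).
- by move=> p Dp; have := kc_ge xi X Y Dp; move: (kc _ _ _ _) (quad _ _) => a b; lra.
Qed.

(** For the n-th law the deviation vanishes, so its value is the sum of two
    nonnegative terms: the accumulated cost, which controls xi, and the
    terminal term, which is at least a multiple of order n of the squared
    terminal position. *)
Lemma feedback_bound n xi X Y : gamma_max gamma <= n%:R ->
  dynamics t x y xi X Y -> feedback_law n xi X Y ->
  \int[nu]_(p in DT) quad Lambda (xi p.1 p.2) <= riccati_value n /\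
  forall i, (n%:R - gamma_max gamma) * \int[P]_w (X T w i 0 ^+ 2) <= riccati_value n.
Proof.
move=> gn hdyn hlaw.
have [i1 i2 e] := verification (hQn gn) t0 tT hdyn FT.
have {}e : \int[P]_w quad (riccati_terminal gamma n) (state X Y T w)
    + 2 * \int[nu]_(p in DT) kc xi X Y p = riccati_value n.
  rewrite [LHS]e (@eq_Rintegral _ _ _ nu _ (fun=> 0) (gap n xi X Y)); last first.
    by move=> p _; rewrite gap_feedback.
  by rewrite Rintegral_cst// mul0r addr0.
have hk := kc_quad_le hdyn.
have q0 : 0 <= \int[nu]_(p in DT) quad Lambda (xi p.1 p.2).
  by apply: Rintegral_ge0 => p _; exact: (pd_psd pdL).2.
have T_ge0 : 0 <= \int[P]_w quad (riccati_terminal gamma n) (state X Y T w).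
  by apply: Rintegral_ge0 => w _; exact: riccati_terminal_ge0.
split.
  by rewrite -e (le_trans hk)// lerDr.
move=> i; have iX := (X_L1 t0 tT hdyn i).2.
rewrite -RintegralZl//.
apply: (@le_trans _ _ (\int[P]_w quad (riccati_terminal gamma n) (state X Y T w))).
  apply: le_Rintegral => //; first exact: L1Z.
  by move=> w _; exact: riccati_terminal_ge.
by rewrite -e lerDl (le_trans q0).
Qed.

Lemma riccati_value_bounded : t < T ->
  exists B, forall n, gamma_max gamma <= n%:R -> riccati_value n <= B.
Proof.
move=> ltT.
have [xi [X [Y [hdyn XT]]]] := reference_control x y t0 tT ltT.
exists (\int[P]_w energy gamma (Y T w) + 2 * \int[nu]_(p in DT) kc xi X Y p) => n gn.
have [i1 i2 e] := verification (hQn gn) t0 tT hdyn FT.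
have -> : \int[P]_w energy gamma (Y T w) = \int[P]_w quad (riccati_terminal gamma n) (state X Y T w).
  by apply: eq_Rintegral => w _; rewrite /state XT riccati_terminal0.
rewrite [leRHS]e lerDl; apply: Rintegral_ge0 => p _; exact: gap_ge0.
Qed.

End comparison.

Section distance.
Variables (t : R) (x y : 'cV[R]_d).
Hypotheses (t0 : 0 <= t) (tT : t <= T).
Local Notation DT := ((`[t, T] : set RR) `*` [set: Omega]).
(** The difference of two optimal states starts at zero, where the penalized
    problem has value zero; hence its cost is paid for by its deviation from
    the n-th law, which is that of the m-th optimal control because the law is
    linear. *)
Lemma feedback_dist n m xin Xn Yn xim Xm Ym : gamma_max gamma <= n%:R -> (n <= m)%N ->
  dynamics t x y xin Xn Yn -> feedback_law n xin Xn Yn ->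
  dynamics t x y xim Xm Ym -> feedback_law m xim Xm Ym ->
  \int[nu]_(p in DT) quad Lambda (xim p.1 p.2 - xin p.1 p.2)
  <= riccati_value t x y m - riccati_value t x y n.
Proof.
move=> gn nm dn ln dm lm.
have FT : FF t setT by exact: (@measurableT _ (filtered P W t)).
have hd := dynamics_sub tT dm dn; rewrite !subrr in hd.
set xi := (fun s w => xim s w - xin s w) in hd.
set X := (fun s w => Xm s w - Xn s w) in hd.
set Y := (fun s w => Ym s w - Yn s w) in hd.
have [i1 i2 e] := verification (hQn gn) t0 tT hd FT.
have T_ge0 : 0 <= \int[P]_w quad (riccati_terminal gamma n) (state X Y T w).
  by apply: Rintegral_ge0 => w _; exact: riccati_terminal_ge0.
have [ig hg] := feedback_gap t0 tT gn nm dm lm.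
have hk := kc_quad_le t0 tT hd.
apply: (le_trans hk); apply: le_trans hg.
have -> : \int[nu]_(p in DT) gap n xim Xm Ym p
    = \int[P]_w quad (Qn n t w) (col_mx 0 0) + \int[nu]_(p in DT) gap n xi X Y p.
  rewrite (@eq_Rintegral _ _ _ P _ (fun=> 0) (fun w => quad (Qn n t w) (col_mx 0 0))); last first.
    by move=> w _; rewrite col_mx0 /quad mulmx0 mxE.
  rewrite Rintegral_cst// mul0r add0r; apply: eq_Rintegral => p _.
  rewrite /gap /xi /X /Y feedbackB ln; congr (quad _ _).
  by rewrite opprB addrA subrK.
by rewrite -[leRHS]e lerDr.
Qed.

End distance.

(** * The limit of the penalized problems *)

Section limit.
Variable Q : R -> Omega -> 'M[R]_(d + d).
Hypothesis hlim : is_riccati_limit P T Qn Q.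
Variables (t : R) (x y : 'cV[R]_d).
Hypotheses (t0 : 0 <= t) (ltT : t < T).
Local Notation DT := ((`[t, T] : set RR) `*` [set: Omega]).
Local Notation v := (riccati_value t x y).

Let tT : t <= T. Proof. exact: ltW. Qed.

Lemma gamma_max_ge0 : 0 <= gamma_max gamma.
Proof. by rewrite /gamma_max; apply: bigmax_ge_id. Qed.

(** The remaining increase of the values bounds squared L^2 norms. With 16^-k,
    the L^1 distances of consecutive controls are of order 4^-k, and there
    remains a factor 2^-k after the passage to almost every path
    ([ae_geometric]). *)
Lemma minimizing_sequence : exists (n : nat -> nat) (vv : R),
  [/\ forall k, gamma_max gamma + k.+1%:R <= (n k)%:R,
      forall j k, (j <= k)%N -> (n j <= n k)%N,
      forall k, v (n k) <= vv &
      forall k, vv - v (n k) <= ((2^-1 ^+ k) ^+ 2) ^+ 2].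
Proof.
have [N gN] : exists N, gamma_max gamma <= N%:R.
  by exists (Num.truncn (gamma_max gamma)).+1; exact/ltW/truncnS_gt.
pose u k := v (N + k).
have gk k : gamma_max gamma <= (N + k)%:R.
  by rewrite (le_trans gN)// ler_nat leq_addr.
have u_nd : nondecreasing_seq u.
  move=> j k jk; have [xi [X [Y [hd hl]]]] :=
    feedback_control x y t0 tT (hQn (gk k)).
  have jk' : (N + j <= N + k)%N by rewrite leq_add2l.
  have [_ h] := feedback_gap t0 tT (gk j) jk' hd hl.
  rewrite -subr_ge0; apply: le_trans h; apply: Rintegral_ge0 => p _; exact: gap_ge0.
have [B hB] := riccati_value_bounded x y t0 tT ltT.
have cu : cvgn u.
  by apply: nondecreasing_is_cvgn => //; exists B => _ [k _ <-]; exact: hB.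
pose vv := limn u.
have u_le k : u k <= vv by exact: nondecreasing_cvgn_le.
have /choice[m hm] : forall k, exists m, vv - u m <= ((2^-1 ^+ k) ^+ 2) ^+ 2.
  move=> k; have e0 : 0 < ((2^-1 ^+ k) ^+ 2) ^+ 2 :> R by do 2 apply: exprn_gt0; exact: half_exp_gt0.
  have /cvgrPdist_le/(_ _ e0)[m _ /(_ m (leqnn m))] : u k @[k --> \oo] --> vv by [].
  by move=> h; exists m; exact: le_trans (ler_norm _) h.
pose n k := (N + (k.+1 + \sum_(i < k.+1) m i))%N.
exists n, vv; split.
- by move=> k; rewrite /n addnA 2!natrD -addrA lerD// lerDl.
- move=> j k jk; rewrite /n leq_add2l leq_add//.
  rewrite -(subnKC (_ : j.+1 <= k.+1)%N)// big_split_ord /=.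
  exact: leq_addr.
- by move=> k; exact: u_le.
- move=> k; apply: le_trans (hm k); rewrite lerD2l lerN2; apply: u_nd.
  by rewrite big_ord_recr /= addnA leq_addl.
Qed.

Lemma riccati_limit_cvg (n : nat -> nat) : (forall k, (k <= n k)%N) ->
  {ae P, forall w s, t <= s < T -> forall i j,
    Qn (n k) s w i j @[k --> \oo] --> Q s w i j}.
Proof.
move=> hn; apply: filterS hlim => w h s /andP[ts sT] i j.
have s0 : 0 <= s by exact: le_trans ts.
have := h s; rewrite s0 sT => /(_ isT i j) hu.
have hs : [set s] `<=` [set` `[0, s]] by move=> _ ->; rewrite /= in_itv/= s0 lexx.
have := uniform_subset_cvg _ hs hu; rewrite uniform_set1 => hc.
have hc' : Qn k s w i j @[k --> \oo] --> Q s w i j by exact: hc.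
apply: (cvg_comp n (fun k => Qn k s w i j) _ hc').
move=> A [m _ hA]; exists m => // k /= mk; apply: hA => /=.
exact: leq_trans mk (hn k).
Qed.

Section sequence.
Variables (n : nat -> nat) (vv : R) (xi_ X_ Y_ : nat -> R -> Omega -> 'cV[R]_d).
Hypothesis n_ge : forall k, gamma_max gamma + k.+1%:R <= (n k)%:R.
Hypothesis n_homo : forall j k, (j <= k)%N -> (n j <= n k)%N.
Hypothesis v_le : forall k, v (n k) <= vv.
Hypothesis v_fast : forall k, vv - v (n k) <= ((2^-1 ^+ k) ^+ 2) ^+ 2.
Hypothesis hdyn : forall k, dynamics t x y (xi_ k) (X_ k) (Y_ k).
Hypothesis hlaw : forall k, feedback_law (n k) (xi_ k) (X_ k) (Y_ k).

Let TT : t <= T <= T. Proof. by rewrite tT lexx. Qed.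

Let gn k : gamma_max gamma <= (n k)%:R.
Proof. by rewrite (le_trans _ (n_ge k))// lerDl. Qed.

Let n_id k : (k <= n k)%N.
Proof.
rewrite -(ler_nat R) (le_trans _ (n_ge k))//.
by rewrite (le_trans (_ : _ <= k.+1%:R)) ?ler_nat// lerDr gamma_max_ge0.
Qed.

Let delta k i s w := xi_ k.+1 s w i 0 - xi_ k s w i 0.

Let mdelta k i : jmeas t T (delta k i).
Proof. by apply: measurable_funB; [exact: (xi_jmeas (hdyn k.+1) i)|exact: (xi_jmeas (hdyn k) i)]. Qed.

Let coord_le (A : 'cV[R]_d) i : A i 0 ^+ 2 <= invmx Lambda i i * quad Lambda A.
Proof. exact: (pd_coord_le A i pdL).2. Qed.

Let inv_ge0 i : 0 <= invmx Lambda i i.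
Proof. exact/ltW/(pd_coord_le 0 i pdL).1. Qed.

(** ** Fast convergence of the controls *)

(** The L^1 norm is bounded through 2 e |a| <= e^2 + a^2 with e = 4^-k, the
    square root of the bound on the integral of the square. *)
Lemma delta_L1 : exists2 C : R, 0 <= C & forall k i, L1 nu DT (fun p => delta k i p.1 p.2) /\
  \int[nu]_(p in DT) `|delta k i p.1 p.2| <= C * (2^-1 ^+ k) ^+ 2.
Proof.
pose M := \int[nu]_(p in DT) (1 : R).
have M0 : 0 <= M by apply: Rintegral_ge0.
have sum_le (f : 'I_d -> R) i : (forall i, 0 <= f i) -> f i <= \sum_j f j.
  by move=> f0; rewrite (bigD1 i)//= lerDl sumr_ge0.
exists (\sum_i 2^-1 * (M + invmx Lambda i i)).
  by apply: sumr_ge0 => i _; rewrite mulr_ge0// addr_ge0.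
move=> k i; set e := (2^-1 ^+ k) ^+ 2.
have e0 : 0 < e by rewrite exprn_gt0// half_exp_gt0.
have hd := dynamics_sub tT (hdyn k.+1) (hdyn k).
have iq := quad_control_L1 hd.
have hdist := feedback_dist t0 tT (gn k) (n_homo (leqnSn k)) (hdyn k) (@hlaw k) (hdyn k.+1) (@hlaw k.+1).
have iB : L1 nu DT (fun p : RR * Omega => (2 * e)^-1 * (e ^+ 2 + invmx Lambda i i *
    quad Lambda (xi_ k.+1 p.1 p.2 - xi_ k p.1 p.2))).
  apply: (L1Z (mDT t)); apply: (L1D (mDT t)); first exact: cst_L1.
  exact: (L1Z (mDT t)).
have le p : `|delta k i p.1 p.2| <= (2 * e)^-1 * (e ^+ 2 + invmx Lambda i i *
    quad Lambda (xi_ k.+1 p.1 p.2 - xi_ k p.1 p.2)).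
  rewrite mulrC ler_pdivlMr ?mulr_gt0// (le_trans (two_mulr_le e _))// lerD2l.
  have := coord_le (xi_ k.+1 p.1 p.2 - xi_ k p.1 p.2) i.
  by rewrite /delta mxE [X in (_ + X) ^+ 2]mxE.
have id : L1 nu DT (fun p => delta k i p.1 p.2).
  by apply: (L1_le (mDT t) (mdelta k i) _ iB) => p _; exact: le.
split=> //.
apply: (@le_trans _ _ (\int[nu]_(p in DT) ((2 * e)^-1 * (e ^+ 2 + invmx Lambda i i *
    quad Lambda (xi_ k.+1 p.1 p.2 - xi_ k p.1 p.2))))).
  by apply: le_Rintegral => //; exact: L1_norm.
rewrite RintegralZl//; last first.
  by apply: (L1D (mDT t)); [exact: cst_L1|exact: (L1Z (mDT t))].
rewrite RintegralD//; [|exact: cst_L1|exact: (L1Z (mDT t))].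
have -> : \int[nu]_(p in DT) (invmx Lambda i i * quad Lambda (xi_ k.+1 p.1 p.2 - xi_ k p.1 p.2))
  = invmx Lambda i i * \int[nu]_(p in DT) quad Lambda (xi_ k.+1 p.1 p.2 - xi_ k p.1 p.2).
  by rewrite RintegralZl.
have -> : \int[nu]_(p in DT) (e ^+ 2) = e ^+ 2 * M.
  by rewrite /M -RintegralZl//; [apply: eq_Rintegral => p _; rewrite mulr1|exact: cst_L1].
have hq : \int[nu]_(p in DT) quad Lambda (xi_ k.+1 p.1 p.2 - xi_ k p.1 p.2) <= e ^+ 2.
  by apply: (le_trans hdist); apply: le_trans (v_fast k); rewrite lerD2r.
apply: (@le_trans _ _ ((2 * e)^-1 * (e ^+ 2 * M + invmx Lambda i i * e ^+ 2))).
  by rewrite ler_wpM2l ?invr_ge0 ?mulr_ge0 ?(ltW e0)// lerD2l ler_wpM2l.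
have -> : (2 * e)^-1 * (e ^+ 2 * M + invmx Lambda i i * e ^+ 2) = 2^-1 * (M + invmx Lambda i i) * e.
  by field; rewrite gt_eqF.
rewrite ler_wpM2r ?(ltW e0)//.
apply: (sum_le (fun i => 2^-1 * (M + invmx Lambda i i))) => j.
by rewrite mulr_ge0// addr_ge0.
Qed.

(** ** The set of convergence *)

Let I k i w := \int[mu]_(s in `[t, T]) `|delta k i s w|.

(** The paths along which the limit is taken. Collecting the properties that
    hold almost surely in one condition allows the limit to be defined path by
    path and to be set to zero on a single null set, which the completed
    filtration does not notice. *)
Record convergent (K : R) (w : Omega) : Prop := {
  conv_fast : exists2 c : R, 0 <= c & forall k i, I k i w <= c * 2^-1 ^+ k;
  conv_L1 : forall k i, L1 mu `[t, T] (fun s => xi_ k s w i 0);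
  conv_state : forall k i s, t <= s <= T ->
    `|X_ k.+1 s w i 0 - X_ k s w i 0| <= I k i w /\
    `|Y_ k.+1 s w i 0 - Y_ k s w i 0| <= 2 * gamma 0 i * I k i w;
  conv_position : forall k i s, t <= s <= T ->
    X_ k s w i 0 = x i 0 - \int[mu]_(u in `[t, s]) xi_ k u w i 0;
  conv_impact : forall k i s, t <= s <= T ->
    L1 mu `[t, s] (fun u => impact_drift gamma rho (xi_ k) (Y_ k) u w i 0) /\
    Y_ k s w i 0 = y i 0 + \int[mu]_(u in `[t, s]) impact_drift gamma rho (xi_ k) (Y_ k) u w i 0;
  conv_riccati : forall s, t <= s < T -> forall i j,
    Qn (n k) s w i j @[k --> \oo] --> Q s w i j;
  conv_rho : {ae mu, forall s : RR, t <= s <= T -> forall i, `|rho s w 0 i| <= K} }.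

Lemma ae_convergent : exists2 K, 0 <= K & {ae P, forall w, convergent K w}.
Proof.
have [K K0 hK] := ess_bounded_entries rho_bd; exists K => //.
have [C C0 hC] := delta_L1.
have mtT : measurable (`[t, T] : set RR) by exact: measurable_itv.
have fast : {ae P, forall w i, exists2 c : R, 0 <= c & forall k, I k i w <= c * 2^-1 ^+ k}.
  apply: filter_forall => i.
  have iN k : L1 nu DT (fun p => `|delta k i p.1 p.2|) by apply: L1_norm; exact: (hC k i).1.
  have iI k : L1 P setT (I k i).
    exact: (fubini_L1_2 (m1 := mu) (m2 := P) (f := fun s w => `|delta k i s w|) mtT measurableT (iN k)).
  have I0 k w : 0 <= I k i w by apply: Rintegral_ge0.
  have hI k : \int[P]_w I k i w <= C * (2^-1 ^+ k) ^+ 2.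
    rewrite (fubini_Rint2 (m1 := mu) (m2 := P) (f := fun s w => `|delta k i s w|) mtT measurableT (iN k)).
    exact: (hC k i).2.
  by have := ae_geometric measurableT iI I0 hI; apply: filterS => w; apply.
have bounds : {ae P, forall w k i, (L1 mu `[t, T] (fun s => xi_ k s w i 0)) /\
    forall s, t <= s <= T -> `|X_ k.+1 s w i 0 - X_ k s w i 0| <= I k i w /\
    `|Y_ k.+1 s w i 0 - Y_ k s w i 0| <= 2 * gamma 0 i * I k i w}.
  apply: ae_foralln => k.
  have hd := dynamics_sub tT (hdyn k.+1) (hdyn k).
  apply: filterS2 (dynamics_bounds t0 tT (hdyn k)) (dynamics_bounds t0 tT hd).
  move=> w h1 h2 i; have [ix _] := h1 i; have [_ h] := h2 i; split=> // s ts.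
  have eI : \int[mu]_(u in `[t, T]) `|(xi_ k.+1 u w - xi_ k u w) i 0| = I k i w.
    by apply: eq_Rintegral => u _; rewrite /delta mxE [X in _ + X]mxE.
  have := h s ts; rewrite eI !subrr !mxE normr0 !add0r.
  by [].
have pos : {ae P, forall w k i s, t <= s <= T ->
    X_ k s w i 0 = x i 0 - \int[mu]_(u in `[t, s]) xi_ k u w i 0}.
  apply: ae_foralln => k; have [_ [_ _ h] _] := hdyn k.
  by apply: filterS h => w h i s ts; exact: (h s ts i).2.
have imp : {ae P, forall w k i s, t <= s <= T ->
    L1 mu `[t, s] (fun u => impact_drift gamma rho (xi_ k) (Y_ k) u w i 0) /\
    Y_ k s w i 0 = y i 0 + \int[mu]_(u in `[t, s]) impact_drift gamma rho (xi_ k) (Y_ k) u w i 0}.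
  apply: ae_foralln => k; have [_ _ [_ _ h]] := hdyn k.
  by apply: filterS h => w h i s ts; exact: h.
have ric := riccati_limit_cvg n_id.
have brho := ae_prod_section hK.
apply: filterS3 fast bounds (filterI pos (filterI imp (filterI ric brho))).
move=> w hf hb [hp [hi [hr hrho]]]; split.
- have /choice[c hc] : forall i, exists c : R, 0 <= c /\ forall k, I k i w <= c * 2^-1 ^+ k.
    by move=> i; have [c c0 hc] := hf i; exists c.
  exists (\sum_i c i); first by apply: sumr_ge0 => i _; exact: (hc i).1.
  move=> k i; apply: (le_trans ((hc i).2 k)); rewrite ler_wpM2r ?(ltW (half_exp_gt0 _ _))//.
  by rewrite (bigD1 i)//= lerDl sumr_ge0// => j _; exact: (hc j).1.
- by move=> k i; exact: (hb k i).1.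
- by move=> k i s ts; exact: (hb k i).2.
- exact: hp.
- exact: hi.
- exact: hr.
- apply: filterS hrho => s h /andP[ts sT] i; apply: h.
  by rewrite /= sT (le_trans t0 ts).
Qed.

Variables (K : R).
Hypotheses (K0 : 0 <= K) (hconv : {ae P, forall w, convergent K w}).

Definition limit_position s w : 'cV[R]_d :=
  if `[< convergent K w >] then \col_i limn (fun k => X_ k s w i 0) else 0.

Definition limit_impact s w : 'cV[R]_d :=
  if `[< convergent K w >] then \col_i limn (fun k => Y_ k s w i 0) else 0.

(** The feedback law of Q is imposed as the definition. At time T, where the
    Q^n diverge, the control is set to zero. *)
Definition limit_control s w : 'cV[R]_d :=
  if `[< convergent K w >] && (s < T)
  then feedback Lambda gamma (Q s w) (limit_position s w) (limit_impact s w) else 0.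

Let convE w : convergent K w -> `[< convergent K w >] = true.
Proof. by move=> /asboolP. Qed.

Lemma limit_position_cvg w s i : convergent K w -> t <= s <= T ->
  X_ k s w i 0 @[k --> \oo] --> limit_position s w i 0.
Proof.
move=> cw ts; rewrite /limit_position convE// mxE.
have [c c0 hc] := conv_fast cw.
have [l [hl _]] := @geometric_cauchy R (fun k => X_ k s w i 0) c c0
  (fun k => le_trans (conv_state cw k i ts).1 (hc k i)).
by rewrite (cvg_lim (@Rhausdorff R) hl).
Qed.

Lemma limit_impact_cvg w s i : convergent K w -> t <= s <= T ->
  Y_ k s w i 0 @[k --> \oo] --> limit_impact s w i 0.
Proof.
move=> cw ts; rewrite /limit_impact convE// mxE.
have [c c0 hc] := conv_fast cw.
have c1 : 0 <= 2 * gamma 0 i * c by rewrite mulr_ge0// mulr_ge0// ltW.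
have [|l [hl _]] := @geometric_cauchy R (fun k => Y_ k s w i 0) (2 * gamma 0 i * c) c1.
  move=> k; apply: (le_trans (conv_state cw k i ts).2).
  by rewrite -[leRHS]mulrA ler_wpM2l ?hc// mulr_ge0// ltW.
by rewrite (cvg_lim (@Rhausdorff R) hl).
Qed.

Lemma limit_feedback_cvg (q : nat -> 'M[R]_(d + d)) (q0 : 'M[R]_(d + d)) w s i :
  convergent K w -> t <= s <= T ->
  (forall i j, q k i j @[k --> \oo] --> q0 i j) ->
  feedback Lambda gamma (q k) (X_ k s w) (Y_ k s w) i 0 @[k --> \oo] -->
  feedback Lambda gamma q0 (limit_position s w) (limit_impact s w) i 0.
Proof.
move=> cw ts hq.
exact: (entries_feedback (cvg_function_ring R) Lambda gamma
  (Q := fun o => if o is Some k then q k else q0)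
  (x := fun o => if o is Some k then X_ k s w else limit_position s w)
  (y := fun o => if o is Some k then Y_ k s w else limit_impact s w)
  hq (fun i j => ltac:(rewrite (ord1 j); exact: limit_position_cvg))
  (fun i j => ltac:(rewrite (ord1 j); exact: limit_impact_cvg)) i 0).
Qed.

(** Before T the limit control is the limit of the controls, because the laws
    converge together with the states. *)
Lemma limit_control_cvg w s i : convergent K w -> t <= s < T ->
  xi_ k s w i 0 @[k --> \oo] --> limit_control s w i 0.
Proof.
move=> cw ts; have /andP[ts' sT] := ts; have ts2 : t <= s <= T by rewrite ts' ltW.
rewrite /limit_control convE// sT /=.
rewrite (_ : (fun k => _) = fun k => feedback Lambda gamma (Qn (n k) s w) (X_ k s w) (Y_ k s w) i 0).
  exact: (@limit_feedback_cvg (fun k => Qn (n k) s w) (Q s w) w s i cw ts2 (conv_riccati cw ts)).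
by apply/funext => k; rewrite hlaw.
Qed.

(** Restricted to the set of convergence, a process is modified on a null set
    only. *)
Let Fm_conv s (f : Omega -> R) : Fm s f -> Fm s (fun w => if `[< convergent K w >] then f w else 0).
Proof. by move=> mf; apply: Fm_ae mf; apply: filterS hconv => w /asboolP ->. Qed.

Lemma limit_position_adapted : entrywise (adapted P W t T) limit_position.
Proof.
move=> i j s ts; rewrite (ord1 j).
apply: (@measurable_fun_cvg _ _ _ _ (fun k (w : filtered P W s) =>
  if `[< convergent K w >] then X_ k s w i 0 else 0)).
  by move=> k; apply: Fm_conv; have [_ [aX _ _] _] := hdyn k; exact: aX.
move=> w _ /=; have [cw|ncw] := pselect (convergent K w).
  by rewrite convE//; exact: limit_position_cvg.
rewrite /limit_position; have /asboolPn/negPf -> := ncw.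
by rewrite mxE; exact: cvg_cst.
Qed.

Lemma limit_impact_adapted : entrywise (adapted P W t T) limit_impact.
Proof.
move=> i j s ts; rewrite (ord1 j).
apply: (@measurable_fun_cvg _ _ _ _ (fun k (w : filtered P W s) =>
  if `[< convergent K w >] then Y_ k s w i 0 else 0)).
  by move=> k; apply: Fm_conv; have [_ _ [aY _ _]] := hdyn k; exact: aY.
move=> w _ /=; have [cw|ncw] := pselect (convergent K w).
  by rewrite convE//; exact: limit_impact_cvg.
rewrite /limit_impact; have /asboolPn/negPf -> := ncw.
by rewrite mxE; exact: cvg_cst.
Qed.

Lemma limit_control_adapted : entrywise (adapted P W t T) limit_control.
Proof.
move=> i j s ts; rewrite (ord1 j).
have [sT|sT] := ltP s T; last first.
  rewrite (_ : (fun w => _) = fun=> 0); first exact: measurable_cst.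
  by apply/funext => w; rewrite /limit_control ltNge sT andbF mxE.
apply: (@measurable_fun_cvg _ _ _ _ (fun k (w : filtered P W s) =>
  if `[< convergent K w >] then xi_ k s w i 0 else 0)).
  by move=> k; apply: Fm_conv; have [l _ _] := hdyn k; have [a _ _] := l i 0; exact: a.
move=> w _ /=; have [cw|ncw] := pselect (convergent K w).
  by rewrite convE//; apply: limit_control_cvg => //; rewrite sT; have /andP[->] := ts.
rewrite /limit_control; have /asboolPn/negPf -> := ncw.
by rewrite mxE; exact: cvg_cst.
Qed.

Lemma limit_control_jmeas i : jmeas t T (fun s w => limit_control s w i 0).
Proof.
pose g (w : Omega) : R := if `[< convergent K w >] then 1 else 0.
have mg : measurable_fun setT g.
  apply: (measurable_ae hF (g := fun=> 1)); last exact: measurable_cst.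
  by apply: filterS hconv => w /asboolP; rewrite /g => ->.
apply: (@measurable_fun_cvg _ _ _ _ (fun k (p : RR * Omega) =>
  \1_(`]-oo, T[%classic : set RR) p.1 * g p.2 * xi_ k p.1 p.2 i 0)).
  move=> k; apply: measurable_funM; last exact: (xi_jmeas (hdyn k) i).
  apply: measurable_funTS; apply: measurable_funM.
    apply: (@measurableT_comp _ _ _ _ RR); last exact: measurable_fst.
    exact: measurable_indic.
  by apply: measurableT_comp => //; exact: measurable_snd.
move=> [s w] [/=]; rewrite in_itv/= => ts _; rewrite indicE /g /limit_control.
have [cw|ncw] := pselect (convergent K w); last first.
  have /asboolPn/negPf -> := ncw; rewrite /= mxE.
  by rewrite (_ : (fun k => _) = fun=> 0); [exact: cvg_cst|apply/funext => k; rewrite mulr0 mul0r].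
rewrite convE//=; have [sT|sT] := ltP s T.
  rewrite mem_set/= ?in_itv//= (_ : (fun k => _) = fun k => xi_ k s w i 0); last first.
    by apply/funext => k; rewrite !mul1r.
  have := @limit_control_cvg w s i cw; rewrite /limit_control convE// sT/=; apply.
  by have /andP[->] := ts.
rewrite memNset/= ?in_itv/= ?ltNge ?sT// mxE.
by rewrite (_ : (fun k => _) = fun=> 0); [exact: cvg_cst|apply/funext => k; rewrite !mul0r].
Qed.

Let ae_ltT : {ae nu, forall p : RR * Omega, p.1 != T}.
Proof.
apply: (ae_prod_fst P (S := fun s : RR => s != T)).
exists [set T]; split; [exact: measurable_set1|exact: lebesgue_measure_set1|].
by move=> s /= /negP; rewrite negbK => /eqP.
Qed.

(** Almost every point of the strip is a point of convergence. *)
Let ae_conv (S : RR * Omega -> Prop) :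
  (forall s w, t <= s < T -> convergent K w -> S (s, w)) ->
  {ae nu, forall p, DT p -> S p}.
Proof.
move=> hS; apply: filterS2 ae_ltT (ae_prod_snd hconv) => -[s w] /= sT cw [/=].
rewrite in_itv/= => /andP[ts sT'] _; apply: hS => //.
by rewrite ts lt_neqAle sT.
Qed.

(** The controls are bounded in L^2 by the limit of the values, and Fatou's
    lemma transfers the bound. *)
Lemma limit_control_L1 i : L1 nu DT (fun p => limit_control p.1 p.2 i 0 ^+ 2).
Proof.
apply: (Rfatou (mDT t) (f_ := fun k (p : RR * Omega) => xi_ k p.1 p.2 i 0 ^+ 2)
  (c_ := fun=> invmx Lambda i i * vv) (c := invmx Lambda i i * vv) _ _ _ _ _ _ _).1.
- by move=> k; exact: (xi_L1 (hdyn k) i).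
- by move=> k p _; exact: sqr_ge0.
- by have := jmeas_sqr (@limit_control_jmeas i).
- by move=> p _; exact: sqr_ge0.
- apply: ae_conv => s w ts cw /=.
  by apply: cvgM; exact: limit_control_cvg.
- move=> k; have [hb _] := feedback_bound t0 tT (gn k) (hdyn k) (@hlaw k).
  apply: (@le_trans _ _ (invmx Lambda i i * \int[nu]_(p in DT) quad Lambda (xi_ k p.1 p.2))).
    have iq := quad_control_L1 (hdyn k).
    rewrite -RintegralZl//; apply: le_Rintegral => //.
    + exact: (xi_L1 (hdyn k) i).
    + exact: (L1Z (mDT t)).
  by rewrite ler_wpM2l// (le_trans hb).
- exact: cvg_cst.
Qed.

Let position_lim w i : convergent K w ->
  L1 mu `[t, T] (fun s => - limit_control s w i 0) /\ forall s, t <= s <= T ->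
  limit_position s w i 0 = x i 0 + \int[mu]_(u in `[t, s]) (- limit_control u w i 0).
Proof.
move=> cw; have [c c0 hc] := conv_fast cw.
apply: (@AC_limit R t T (x i 0) c (fun k s => X_ k s w i 0) (fun k s => - xi_ k s w i 0)
  (fun s => limit_position s w i 0)) => //.
- by move=> k; apply: L1N; exact: conv_L1 cw k i.
- move=> k s ts; rewrite (conv_position cw k i ts) RintN//.
  by apply: L1_itvS (conv_L1 cw k i) => //; have /andP[] := ts.
- apply: measurableT_comp => //.
  exact: (jmeas_section2 w (@limit_control_jmeas i)).
- exists [set T]; split; [exact: measurable_set1|exact: lebesgue_measure_set1|].
  move=> s /= hs; apply: contrapT => sT; apply: hs => /andP[ts sT']; apply: cvgN.
  by apply: limit_control_cvg => //; rewrite ts lt_neqAle sT' andbT; exact/eqP.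
- move=> k; apply: le_trans (hc k i); rewrite le_eqVlt; apply/orP; left; apply/eqP.
  by apply: eq_Rintegral => s _; rewrite -normrN; congr `|_|; rewrite /delta; ring.
- by move=> s ts; exact: limit_position_cvg.
Qed.

Let impact_lim w i : convergent K w ->
  L1 mu `[t, T] (fun s => impact_drift gamma rho limit_control limit_impact s w i 0) /\
  forall s, t <= s <= T -> limit_impact s w i 0 = y i 0 +
    \int[mu]_(u in `[t, s]) impact_drift gamma rho limit_control limit_impact u w i 0.
Proof.
move=> cw; have [c c0 hc] := conv_fast cw.
have mtT : measurable (`[t, T] : set RR) by exact: measurable_itv.
have gi : 0 <= gamma 0 i by exact: ltW.
have idrift k := (conv_impact cw k i TT).1.
have mrho : measurable_fun (`[t, T] : set RR) (fun s => rho s w 0 i).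
  exact: (jmeas_section2 w (rho_jmeas t0 0 i)).
have mY : measurable_fun (`[t, T] : set RR) (fun s => limit_impact s w i 0).
  apply: (@measurable_fun_cvg _ _ _ _ (fun k s => Y_ k s w i 0)).
    by move=> k; exact: (jmeas_section2 w (Y_jmeas tT (hdyn k) i)).
  by move=> s /=; rewrite in_itv/=; exact: limit_impact_cvg.
pose C := K * (2 * gamma 0 i * c) * (T - t) + gamma 0 i * c.
have Kg : 0 <= K * (2 * gamma 0 i * c) by rewrite !mulr_ge0.
have C0 : 0 <= C by rewrite addr_ge0 ?mulr_ge0// subr_ge0.
apply: (@AC_limit R t T (y i 0) C (fun k s => Y_ k s w i 0)
  (fun k s => impact_drift gamma rho (xi_ k) (Y_ k) s w i 0)
  (fun s => limit_impact s w i 0)) => //.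
- by move=> k s ts; exact: (conv_impact cw k i ts).2.
- rewrite (_ : (fun s => _) = fun s => - (rho s w 0 i * limit_impact s w i 0)
      + gamma 0 i * limit_control s w i 0); last first.
    by apply/funext => s; rewrite impact_driftE.
  apply: measurable_funD; first by apply: measurableT_comp => //; exact: measurable_funM.
  apply: measurable_funM => //; exact: (jmeas_section2 w (@limit_control_jmeas i)).
- exists [set T]; split; [exact: measurable_set1|exact: lebesgue_measure_set1|].
  move=> s /= hs; apply: contrapT => sT; apply: hs => /andP[ts sT'].
  rewrite (_ : (fun k => _) = fun k => - (rho s w 0 i * Y_ k s w i 0)
      + gamma 0 i * xi_ k s w i 0); last first.
    by apply/funext => k; rewrite impact_driftE.
  rewrite impact_driftE; apply: cvgD.
    by apply: cvgN; apply: cvgMr; apply: limit_impact_cvg => //; rewrite ts.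
  apply: cvgMr; apply: limit_control_cvg => //.
  by rewrite ts lt_neqAle sT' andbT; exact/eqP.
- move=> k.
  have id : L1 mu `[t, T] (fun s => `|delta k i s w|).
    by apply: L1_norm; apply: (L1B mtT); exact: conv_L1 cw _ i.
  have ic : L1 mu `[t, T] (fun=> K * (2 * gamma 0 i * (c * 2^-1 ^+ k))).
    by apply: L1_cst => //; exact: (lebesgue_itv_lty t T).
  apply: (@le_trans _ _ (\int[mu]_(s in `[t, T])
      (K * (2 * gamma 0 i * (c * 2^-1 ^+ k)) + gamma 0 i * `|delta k i s w|))).
    apply: (Rint_le_ae mtT).
    + by apply: L1_norm; apply: (L1B mtT); exact: idrift.
    + by apply: (L1D mtT) => //; exact: (L1Z mtT).
    + apply: filterS (conv_rho cw) => s hr; rewrite /= in_itv/= => ts.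
      rewrite !impact_driftE.
      have -> : - (rho s w 0 i * Y_ k.+1 s w i 0) + gamma 0 i * xi_ k.+1 s w i 0 -
          (- (rho s w 0 i * Y_ k s w i 0) + gamma 0 i * xi_ k s w i 0)
        = - (rho s w 0 i * (Y_ k.+1 s w i 0 - Y_ k s w i 0)) + gamma 0 i * delta k i s w.
        by rewrite /delta; ring.
      rewrite (le_trans (ler_normD _ _))// normrN !normrM (ger0_norm gi) lerD2r.
      apply: ler_pM => //; first exact: hr.
      apply: (le_trans (conv_state cw k i ts).2); rewrite ler_wpM2l ?mulr_ge0//; exact: hc.
  rewrite RintegralD//; last exact: (L1Z mtT).
  rewrite Rintegral_cst//= lebesgue_measure_itv/= lte_fin ltT /= RintegralZl//.
  rewrite /C [leRHS]mulrDl lerD//.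
    by rewrite le_eqVlt; apply/orP; left; apply/eqP; ring.
  by rewrite -[leRHS]mulrA ler_wpM2l//; exact: hc.
- by move=> s ts; exact: limit_impact_cvg.
Qed.

(** The state equation passes to the limit by [AC_limit], for every convergent
    path. *)
Lemma limit_dynamics :
  dynamics t x y limit_control limit_position limit_impact.
Proof.
have mts s : measurable (`[t, s] : set RR) by exact: measurable_itv.
split.
- move=> i j; rewrite (ord1 j); apply: L2F_intro.
  + exact: limit_control_adapted.
  + exact: limit_control_jmeas.
  + exact: limit_control_L1.
- split.
  + exact: limit_position_adapted.
  + move=> i j w; rewrite (ord1 j); have [cw|ncw] := pselect (convergent K w); last first.
      rewrite (_ : (fun s => _) = fun=> 0); first by move=> s; exact: cvg_cst.
      by apply/funext => s; rewrite /limit_position; have /asboolPn/negPf -> := ncw; rewrite mxE.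
    have [i1 e1] := position_lim i cw.
    exact: (AC_continuous tT (AC_intro i1 tT e1)).
  + apply: filterS hconv => w cw s ts i; have [i1 e1] := position_lim i cw.
    have /andP[ts' sT] := ts; have i2 := L1_itvS (lexx t) sT i1.
    have i3 : L1 mu `[t, s] (fun u => limit_control u w i 0).
      have := L1N i2; apply: eq_integrable => // u _ /=.
      by rewrite opprK.
    by split=> //; rewrite e1// RintN.
- split.
  + exact: limit_impact_adapted.
  + move=> i j w; rewrite (ord1 j); have [cw|ncw] := pselect (convergent K w); last first.
      rewrite (_ : (fun s => _) = fun=> 0); first by move=> s; exact: cvg_cst.
      by apply/funext => s; rewrite /limit_impact; have /asboolPn/negPf -> := ncw; rewrite mxE.
    have [i1 e1] := impact_lim i cw.
    exact: (AC_continuous tT (AC_intro i1 tT e1)).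
  + apply: filterS hconv => w cw s ts i; have [i1 e1] := impact_lim i cw.
    have /andP[ts' sT] := ts; have i2 := L1_itvS (lexx t) sT i1.
    by split=> //; exact: e1.
Qed.

(** The price of order n paid for the terminal position stays below the limit
    of the values, so the position at T tends to zero in L^2. *)
Lemma limit_liquidates : {ae P, forall w, limit_position T w = 0}.
Proof.
have hi i : {ae P, forall w, limit_position T w i 0 = 0}.
  have mX : measurable_fun setT (fun w => limit_position T w i 0 ^+ 2).
    apply: measurable_funX; apply: (Fm_measurable hF (lexx T)).
    exact: (limit_position_adapted i 0 TT).
  have hk k : \int[P]_w (X_ k T w i 0 ^+ 2) <= vv / k.+1%:R.
    have [_ /(_ i) hb] := feedback_bound t0 tT (gn k) (hdyn k) (@hlaw k).
    rewrite ler_pdivlMr ?ltr0n// mulrC (le_trans _ (v_le k))// (le_trans _ hb)//.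
    rewrite ler_wpM2r//; last by rewrite lerBrDl n_ge.
    by apply: Rintegral_ge0 => w _; exact: sqr_ge0.
  have c0 : vv / k.+1%:R @[k --> \oo] --> (0 : R).
    rewrite -(mulr0 vv); apply: cvgM; first exact: cvg_cst.
    exact: cvg_harmonic.
  have [iX IX] := Rfatou measurableT (f_ := fun k w => X_ k T w i 0 ^+ 2)
    (fun k => (X_L1 t0 tT (hdyn k) i).2) (fun k w _ => sqr_ge0 _) mX
    (fun w _ => sqr_ge0 _) (filterS (fun w cw _ => cvgM (@limit_position_cvg w T i cw TT)
      (@limit_position_cvg w T i cw TT)) hconv) hk c0.
  have := Rint0_ae measurableT iX (fun w _ => sqr_ge0 _) IX.
  by apply: filterS => w /(_ Logic.I)/eqP; rewrite sqrf_eq0 => /eqP.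
have /filter_forall := hi.
by apply: filterS => w h; apply/matrixP => i j; rewrite (ord1 j) h mxE.
Qed.

(** The optimal control of a later problem deviates from the law n k by at
    most the difference of the values; Fatou's lemma transfers this to the
    limit. *)
Lemma limit_gap k : L1 nu DT (gap (n k) limit_control limit_position limit_impact) /\
  \int[nu]_(p in DT) gap (n k) limit_control limit_position limit_impact p
  <= vv - v (n k).
Proof.
have FT : FF t setT by exact: (@measurableT _ (filtered P W t)).
have hg j := feedback_gap t0 tT (gn k) (n_homo (leq_addl j k)) (hdyn (j + k)) (@hlaw (j + k)%N).
have [i1 i2 _] := verification (hQn (gn k)) t0 tT limit_dynamics FT.
apply: (Rfatou (mDT t) (f_ := fun j => gap (n k) (xi_ (j + k)) (X_ (j + k)) (Y_ (j + k)))
  (c_ := fun=> vv - v (n k))).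
- by move=> j; exact: (hg j).1.
- by move=> j p _; exact: gap_ge0.
- exact: L1_measurable i2.
- by move=> p _; exact: gap_ge0.
- apply: ae_conv => s w ts cw; rewrite /gap /=.
  have ts2 : t <= s <= T by have /andP[-> h] := ts; rewrite ltW.
  pose q := Qn (n k) s w.
  have shift (u : nat -> R) (l : R) : u j @[j --> \oo] --> l -> u (j + k)%N @[j --> \oo] --> l.
    by move=> hu; have := hu; rewrite -(cvg_shiftn k).
  have hc : entries (fun f : option nat -> R => f (Some j) @[j --> \oo] --> f None)
      (fun o => if o is Some j then xi_ (j + k) s w - feedback Lambda gamma q (X_ (j + k) s w) (Y_ (j + k) s w)
       else limit_control s w - feedback Lambda gamma q (limit_position s w) (limit_impact s w)).
    move=> i j; rewrite (ord1 j) /=.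
    rewrite (_ : (fun m => _) = fun m => xi_ (m + k) s w i 0
      - feedback Lambda gamma q (X_ (m + k) s w) (Y_ (m + k) s w) i 0); last first.
      by apply/funext => m; rewrite mxE [X in _ + X]mxE.
    have h1 := shift _ _ (@limit_control_cvg w s i cw ts).
    have hq i' j' : q i' j' @[_ --> \oo] --> q i' j' by exact: cvg_cst.
    have h2 := shift _ _ (@limit_feedback_cvg (fun=> q) q w s i cw ts2 hq).
    by rewrite mxE [X in _ + X]mxE; exact: cvgB h1 h2.
  exact: (entries_quad (cvg_function_ring R) (entries_cst (cvg_function_ring R) Lambda) hc).
- move=> j; apply: (le_trans (hg j).2); rewrite lerD2r; exact: v_le.
- exact: cvg_cst.
Qed.

Lemma limit_feedback : {ae P, forall w s, t <= s < T ->
  limit_control s w = feedback Lambda gamma (Q s w) (limit_position s w) (limit_impact s w)}.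
Proof.
apply: filterS hconv => w cw s /andP[ts sT].
by rewrite /limit_control convE// sT.
Qed.

End sequence.

Local Notation c := (col_mx x y).

Let t0T : 0 <= t <= T. Proof. by rewrite t0 tT. Qed.
Let FT : FF t setT. Proof. exact: (@measurableT _ (filtered P W t)). Qed.

(** Costs and optimality refer to some version of the state of a control; this
    compares it with a given one. *)
Lemma state_unique xi X Y X1 Y1 : dynamics t x y xi X Y ->
  dynamics t x y xi X1 Y1 ->
  {ae P, forall w s, t <= s <= T -> X s w = X1 s w /\ Y s w = Y1 s w}.
Proof.
move=> h h1; have hd := dynamics_sub tT h h1.
apply: filterS (dynamics_bounds t0 tT hd) => w hb s ts.
have I0 i : \int[mu]_(u in `[t, T]) `|(xi u w - xi u w) i 0| = 0.
  rewrite (@eq_Rintegral _ _ _ mu _ (fun=> 0)); first by rewrite Rintegral_cst// mul0r.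
  by move=> u _; rewrite subrr mxE normr0.
split; apply/matrixP => i j; rewrite (ord1 j); apply/eqP; rewrite -subr_eq0 -normr_le0.
- have [_ /(_ s ts)[+ _]] := hb i; rewrite I0 subrr !mxE normr0 addr0.
  by [].
- have [_ /(_ s ts)[_ +]] := hb i; rewrite I0 mulr0 !subrr !mxE normr0 addr0.
  by [].
Qed.

(** The properties of the limit control from which its cost is computed. *)
Lemma optimal_limit : exists (n : nat -> nat) (vv : R) xi X Y,
  [/\ (forall k, (k <= n k)%N) /\ (forall k, gamma_max gamma <= (n k)%:R),
      forall j k, (j <= k)%N -> (n j <= n k)%N,
      forall k, v (n k) <= vv /\ vv - v (n k) <= 2^-1 ^+ k,
      dynamics t x y xi X Y /\ {ae P, forall w, X T w = 0} &
      {ae P, forall w s, t <= s < T -> xi s w = feedback Lambda gamma (Q s w) (X s w) (Y s w)} /\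
      forall k, \int[nu]_(p in DT) gap (n k) xi X Y p <= vv - v (n k)].
Proof.
have [n [vv [n_ge n_homo v_le v_fast]]] := minimizing_sequence.
have gn k : gamma_max gamma <= (n k)%:R by rewrite (le_trans _ (n_ge k))// lerDl.
have /choice[z hz] : forall k, exists z : (R -> Omega -> 'cV[R]_d) * (R -> Omega -> 'cV[R]_d) *
    (R -> Omega -> 'cV[R]_d), dynamics t x y z.1.1 z.1.2 z.2 /\
    feedback_law (n k) z.1.1 z.1.2 z.2.
  move=> k; have [xi [X [Y [h1 h2]]]] := feedback_control x y t0 tT (hQn (gn k)).
  by exists (xi, X, Y).
have hdyn k := (hz k).1; have hlaw k := (hz k).2.
have [K K0 hconv] := ae_convergent n_ge n_homo v_le v_fast hdyn hlaw.
have hd := limit_dynamics n_ge v_le hdyn hlaw K0 hconv.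
have hl := limit_liquidates n_ge v_le hdyn hlaw hconv.
have hg k := (limit_gap n_ge n_homo v_le hdyn hlaw K0 hconv k).2.
have hf := limit_feedback hconv.
exists n, vv; do 3 eexists; split; [| | |split; [exact: hd|exact: hl]|split; [exact: hf|exact: hg]].
- split=> // k; rewrite -(ler_nat R) (le_trans _ (n_ge k))//.
  by rewrite (le_trans (_ : _ <= k.+1%:R)) ?ler_nat// lerDr gamma_max_ge0.
- exact: n_homo.
- move=> k; split=> //; apply: (le_trans (v_fast k)); rewrite -!exprM.
  apply: ler_wiXn2l => //; first by rewrite invf_le1// ler1n.
  by rewrite leq_pmulr.
Qed.

(** * The value of the liquidation problem *)

Section convergence.
Variables (n : nat -> nat) (vv : R).
Hypothesis n_id : forall k, (k <= n k)%N.
Hypothesis gn : forall k, gamma_max gamma <= (n k)%:R.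
Hypothesis n_homo : forall j k, (j <= k)%N -> (n j <= n k)%N.
Hypothesis v_le : forall k, v (n k) <= vv.
Hypothesis v_fast : forall k, vv - v (n k) <= 2^-1 ^+ k.

Let qf k w := quad (Qn (n k) t w) c.
Let q w := quad (Q t w) c.

Let mqf k : Fm t (qf k). Proof. exact: (riccati_quad_L1 (hQn (gn k)) c t0T).1. Qed.
Let iqf k : L1 P setT (qf k). Proof. exact: (riccati_quad_L1 (hQn (gn k)) c t0T).2. Qed.

(** The comparison of the values on all events of F_t gives an order almost
    surely. *)
Lemma riccati_quad_mono j k : (j <= k)%N -> {ae P, forall w, qf j w <= qf k w}.
Proof.
move=> jk; apply: (Fm_le_ae hF tT) => // A FA.
have [xi [X [Y [h1 h2]]]] := feedback_control x y t0 tT (hQn (gn k)).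
have [_] := riccati_compare t0 tT FA (gn j) (n_homo jk) h1 h2.
by apply: le_trans; rewrite lerDl; apply: Rintegral_ge0 => p _; exact: gap_ge0.
Qed.

Let Qcvg w := forall i j, Qn (n k) t w i j @[k --> \oo] --> Q t w i j.

Let aeQ : {ae P, forall w, Qcvg w}.
Proof.
by apply: filterS (riccati_limit_cvg n_id) => w h; apply: h; rewrite lexx.
Qed.

Lemma riccati_quad_cvg : {ae P, forall w, qf k w @[k --> \oo] --> q w}.
Proof.
apply: filterS aeQ => w h.
exact: (entries_quad (cvg_function_ring R)
  (A := fun o => if o is Some k then Qn (n k) t w else Q t w)
  h (entries_cst (cvg_function_ring R) c)).
Qed.

Lemma riccati_quad_Fm : Fm t q.
Proof.
pose S w := qf k w @[k --> \oo] --> q w.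
have aeS : {ae P, forall w, S w} by exact: riccati_quad_cvg.
apply: (@Fm_ae _ _ _ P W t q (fun w => if `[< S w >] then q w else 0)).
  by apply: filterS aeS => w /asboolP ->.
apply: (@measurable_fun_cvg _ _ _ _ (fun k (w : filtered P W t) => if `[< S w >] then qf k w else 0)).
  move=> k; apply: (@Fm_ae _ _ _ P W t _ (qf k)) => //.
  by apply: filterS aeS => w /asboolP ->.
move=> w _ /=; have [Sw|nSw] := pselect (S w); first by have /asboolP -> := Sw.
by have /asboolPn/negPf -> := nSw; exact: cvg_cst.
Qed.

Let mq : measurable_fun setT q.
Proof. exact: (Fm_measurable hF tT riccati_quad_Fm). Qed.

(** The forms increase, so the integral of a difference is the difference of
    the values. *)
Lemma riccati_quad_dist k : L1 P setT (fun w => `|q w - qf k w|) /\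
  \int[P]_w `|q w - qf k w| <= vv - v (n k).
Proof.
apply: (Rfatou measurableT (f_ := fun j w => `|qf (j + k)%N w - qf k w|)
  (c_ := fun=> vv - v (n k))).
- by move=> j; apply: L1_norm; exact: L1B.
- by [].
- apply: measurableT_comp => //; apply: measurable_funB => //.
  exact: L1_measurable (iqf k).
- by [].
- apply: filterS riccati_quad_cvg => w h _; apply: cvg_norm; apply: cvgB; last exact: cvg_cst.
  by have := h; rewrite -(cvg_shiftn k).
- move=> j; apply: (@le_trans _ _ (v (n (j + k)%N) - v (n k))); last by rewrite lerD2r.
  have iqj := iqf (j + k)%N; have iqk := iqf k.
  rewrite -[leRHS](RintegralB _ iqj iqk)//; apply: (Rint_le_ae measurableT).
  + by apply: L1_norm; exact: L1B.
  + exact: L1B.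
  + apply: filterS (riccati_quad_mono (leq_addl j k)) => w h _.
    by rewrite ger0_norm// subr_ge0.
- exact: cvg_cst.
Qed.

Let V w := value_form gamma (Q t w) x y.
Let Vk k w := value_form gamma (Qn (n k) t w) x y.

Let VE w : V w = 2^-1 * (q w - energy gamma y). Proof. exact: value_formE. Qed.
Let VkE k w : Vk k w = 2^-1 * (qf k w - energy gamma y). Proof. exact: value_formE. Qed.

Lemma value_Fm : Fm t V.
Proof.
rewrite (_ : V = fun w => 2^-1 * (q w - energy gamma y)); last by apply/funext => w; rewrite VE.
by apply: measurable_funM => //; apply: measurable_funB => //; exact: riccati_quad_Fm.
Qed.

Lemma value_k_Fm k : Fm t (Vk k).
Proof.
rewrite (_ : Vk k = fun w => 2^-1 * (qf k w - energy gamma y)); last by apply/funext => w; rewrite VkE.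
by apply: measurable_funM => //; apply: measurable_funB.
Qed.

Lemma value_k_L1 k : L1 P setT (Vk k).
Proof.
rewrite (_ : Vk k = fun w => 2^-1 * (qf k w - energy gamma y)); last by apply/funext => w; rewrite VkE.
by apply: L1Z => //; apply: L1B => //; exact: L1_cst.
Qed.

Let V_dist k : L1 P setT (fun w => `|V w - Vk k w|) /\
  \int[P]_w `|V w - Vk k w| <= 2^-1 ^+ k.
Proof.
have [h1 h2] := riccati_quad_dist k.
have e w : `|V w - Vk k w| = 2^-1 * `|q w - qf k w|.
  rewrite VE VkE -mulrBr normrM ger0_norm//; congr (_ * `|_|); ring.
have -> : (fun w => `|V w - Vk k w|) = fun w => 2^-1 * `|q w - qf k w| by apply/funext.
split; first exact: L1Z.
rewrite RintegralZl//; have I0 : 0 <= \int[P]_w `|q w - qf k w| by apply: Rintegral_ge0.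
by move: (v_fast k) h2 I0; move: (vv - _) (\int[P]_w _) => a b; lra.
Qed.

Lemma value_L1 : L1 P setT V.
Proof.
apply: (L1_le measurableT (Fm_measurable hF tT value_Fm) (g := fun w => `|V w - Vk 0 w| + `|Vk 0%N w|)).
  by move=> w _; rewrite (le_trans _ (ler_normD _ _))// subrK.
by apply: L1D => //; [exact: (V_dist 0).1|exact: L1_norm (value_k_L1 0)].
Qed.

(** On every event of F_t the integrals converge, at a rate that does not
    depend on the event. *)
Lemma value_int k A : FF t A ->
  `|\int[P]_(w in A) V w - \int[P]_(w in A) Vk k w| <= 2^-1 ^+ k.
Proof.
move=> FA; have mA : measurable A by exact: (filtration_measurable hF tT FA).
have subA (f : Omega -> R) : L1 P setT f -> L1 P A f by exact: integrableS.
have iV := subA _ value_L1; have iVk := subA _ (value_k_L1 k).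
rewrite -RintegralB//; apply: (le_trans (le_normr_Rintegral mA (L1B mA iV iVk))).
apply: le_trans (V_dist k).2.
rewrite -(Rint_indic P (fun w => `|V w - Vk k w|) mA); apply: le_Rintegral => //.
- by apply: L1_indic => //; exact: (V_dist k).1.
- exact: (V_dist k).1.
- move=> w _; rewrite indicE; case: (w \in A); first by rewrite mul1r.
  by rewrite mul0r.
Qed.

Lemma value_le (J : Omega -> R) : (forall k, {ae P, forall w, Vk k w <= J w}) ->
  {ae P, forall w, V w <= J w}.
Proof.
move=> h; apply: filterS2 riccati_quad_cvg (ae_foralln h) => w hc hJ.
have cV : Vk k w @[k --> \oo] --> V w.
  rewrite VE (_ : (fun k => _) = fun k => 2^-1 * (qf k w - energy gamma y)).
    by apply: cvgMr; apply: cvgB => //; exact: cvg_cst.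
  by apply/funext => k; rewrite VkE.
rewrite -(cvg_lim (@Rhausdorff R) cV); apply: limr_le; first exact: cvgP cV.
exact: nearW.
Qed.

(** ** Costs of admissible controls *)

Section admissible.
Variables (xi X Y : R -> Omega -> 'cV[R]_d).
Hypothesis hdyn : dynamics t x y xi X Y.
Hypothesis XT : {ae P, forall w, X T w = 0}.

Let Z w := \int[mu]_(s in `[t, T]) running_cost Lambda Sigma xi X Y s w.

Lemma cost_k k A : FF t A -> \int[P]_(w in A) Z w = \int[P]_(w in A) Vk k w
    + 2^-1 * \int[nu]_(p in `[t, T] `*` A) gap (n k) xi X Y p.
Proof.
have [_ _ h] := admissible_cost t0 tT hdyn (hQn (gn k)) XT.
exact: h.
Qed.

Lemma cost_L1 : L1 P setT Z.
Proof.
by have [] := admissible_cost t0 tT hdyn (hQn (gn 0)) XT.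
Qed.

(** On each event of F_t the cost exceeds the integral of the k-th value form
    by a nonnegative deviation. *)
Lemma value_le_cost (J : Omega -> R) : is_cond_exp P W t Z J -> {ae P, forall w, V w <= J w}.
Proof.
move=> [iZ iJ mJ hJ]; apply: value_le => k.
apply: (Fm_le_ae hF tT (value_k_Fm k) mJ (value_k_L1 k) iJ) => A FA.
have mA : measurable A by exact: (filtration_measurable hF tT FA).
rewrite /Rintegral hJ// -[leRHS]/(\int[P]_(w in A) Z w) -[leLHS]/(\int[P]_(w in A) Vk k w).
rewrite (cost_k k FA) lerDl mulr_ge0//; apply: Rintegral_ge0 => p _; exact: gap_ge0.
Qed.

(** Both the deviation and the distance of the value forms are at most 2^-k on
    every event of F_t, for every k. *)
Lemma value_eq_cost : (forall k, \int[nu]_(p in DT) gap (n k) xi X Y p <= vv - v (n k)) ->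
  is_cond_exp P W t Z V.
Proof.
move=> hg; split; [exact: cost_L1|exact: value_L1|exact: value_Fm|] => A FA.
have mA : measurable A by exact: (filtration_measurable hF tT FA).
have subA (f : Omega -> R) : L1 P setT f -> L1 P A f by exact: integrableS.
have iV := subA _ value_L1; have iZ := subA _ cost_L1.
rewrite (RintE mA iV) (RintE mA iZ); congr (_%:E).
apply/esym/eqP; rewrite -subr_eq0; apply/eqP; apply: (@half_exp_small _ 2) => k.
have [_ ig _] := verification (hQn (gn k)) t0 tT hdyn FT.
have mDA : measurable ((`[t, T] : set RR) `*` A) by exact: measurableX.
have g_ge0 : 0 <= \int[nu]_(p in `[t, T] `*` A) gap (n k) xi X Y p.
  by apply: Rintegral_ge0 => p _; exact: gap_ge0.
have g_le : \int[nu]_(p in `[t, T] `*` A) gap (n k) xi X Y p <= 2^-1 ^+ k.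
  apply: le_trans (v_fast k); apply: le_trans (hg k).
  rewrite /Rintegral fine_le//.
  + by rewrite RintE//; apply: (L1_restrict_prod tT FA); exact: ig.
  + by rewrite RintE.
  + apply: ge0_subset_integral => //.
    * by apply/measurable_EFinP; exact: L1_measurable ig.
    * by move=> p _; rewrite lee_fin; exact: gap_ge0.
    * by move=> -[s w] [].
have := value_int k FA; rewrite (cost_k k FA) !ler_norml => /andP[h1 h2].
move: g_ge0 g_le h1 h2; move: (\int[nu]_(p in _) _) (\int[P]_(w in A) V w) (\int[P]_(w in A) Vk k w).
by move: (2^-1 ^+ k) => e a b b' g_ge0 g_le h1 h2; apply/andP; split; lra.
Qed.

(** ** Optimality forces the feedback law *)

(** The deviations from the laws n k have integrals tending to zero, and they
    converge to the deviation from the law of Q, which Fatou's lemma forces to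
    vanish; a positive definite form vanishes only at zero. *)
Lemma optimal_feedback : \int[P]_w Z w = \int[P]_w V w ->
  {ae nu, forall p : RR * Omega, t <= p.1 < T ->
    xi p.1 p.2 = feedback Lambda gamma (Q p.1 p.2) (X p.1 p.2) (Y p.1 p.2)}.
Proof.
move=> eZ.
have ig k : L1 nu DT (gap (n k) xi X Y).
  by have [_ ig _] := verification (hQn (gn k)) t0 tT hdyn FT.
have hI k : \int[nu]_(p in DT) gap (n k) xi X Y p <= 2 * 2^-1 ^+ k.
  have := value_int k FT; have := cost_k k FT; rewrite eZ => ->.
  rewrite addrAC subrr add0r normrM (ger0_norm (_ : 0 <= 2^-1))//.
  have : 0 <= \int[nu]_(p in DT) gap (n k) xi X Y p.
    by apply: Rintegral_ge0 => p _; exact: gap_ge0.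
  by move=> g_ge0; rewrite ger0_norm//; move: (\int[nu]_(p in DT) _) (2^-1 ^+ k) => a e; lra.
pose S w := forall s, t <= s < T -> forall i j, Qn (n k) s w i j @[k --> \oo] --> Q s w i j.
have aeS : {ae P, forall w, S w} by exact: (riccati_limit_cvg n_id).
pose g0_ (w : Omega) : R := if `[< S w >] then 1 else 0.
have mg : measurable_fun setT g0_.
  apply: (measurable_ae hF (g := fun=> 1)); last exact: measurable_cst.
  by apply: filterS aeS => w /asboolP; rewrite /g0_ => ->.
pose f (p : RR * Omega) : R := if `[< S p.2 >] && (p.1 < T) then
  quad Lambda (xi p.1 p.2 - feedback Lambda gamma (Q p.1 p.2) (X p.1 p.2) (Y p.1 p.2)) else 0.
have gc s w : t <= s < T -> S w -> gap (n k) xi X Y (s, w) @[k --> \oo] --> quad Lambda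
    (xi s w - feedback Lambda gamma (Q s w) (X s w) (Y s w)).
  move=> ts Sw; have cr := cvg_function_ring R.
  apply: (entries_quad cr (entries_cst cr Lambda)
    (u := fun o => if o is Some k then xi s w - feedback Lambda gamma (Qn (n k) s w) (X s w) (Y s w)
      else xi s w - feedback Lambda gamma (Q s w) (X s w) (Y s w))).
  have := entries_add cr (entries_cst cr (xi s w)) (entries_opp cr (entries_feedback cr Lambda gamma
    (Q := fun o => if o is Some k then Qn (n k) s w else Q s w) (Sw s ts)
    (entries_cst cr (X s w)) (entries_cst cr (Y s w)))).
  by apply.
have mf : measurable_fun DT f.
  apply: (@measurable_fun_cvg _ _ _ _ (fun k (p : RR * Omega) =>
    \1_(`]-oo, T[%classic : set RR) p.1 * g0_ p.2 * gap (n k) xi X Y p)).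
    move=> k; apply: measurable_funM; last exact: L1_measurable (ig k).
    apply: measurable_funTS; apply: measurable_funM.
      apply: (@measurableT_comp _ _ _ _ RR); last exact: measurable_fst.
      exact: measurable_indic.
    by apply: measurableT_comp => //; exact: measurable_snd.
  move=> [s w] [/=]; rewrite in_itv/= => /andP[ts _] _; rewrite indicE /g0_ /f.
  have [Sw|nSw] := pselect (S w); last first.
    have /asboolPn/negPf -> := nSw; rewrite /=.
    by rewrite (_ : (fun k => _) = fun=> 0); [exact: cvg_cst|apply/funext => k; rewrite mulr0 mul0r].
  have /asboolP -> := Sw; have [sT|sT] := ltP s T => /=.
    rewrite mem_set/= ?in_itv//= (_ : (fun k => _) = fun k => gap (n k) xi X Y (s, w)); last first.
      by apply/funext => k; rewrite !mul1r.
    by apply: gc => //; rewrite ts.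
  rewrite memNset/= ?in_itv/= ?ltNge ?sT//.
  by rewrite (_ : (fun k => _) = fun=> 0); [exact: cvg_cst|apply/funext => k; rewrite !mul0r].
have f0 p : 0 <= f p by rewrite /f; case: ifP => // _; exact: (pd_psd pdL).2.
have aeT : {ae nu, forall p : RR * Omega, p.1 != T}.
  apply: (ae_prod_fst P (S := fun s : RR => s != T)).
  exists [set T]; split; [exact: measurable_set1|exact: lebesgue_measure_set1|].
  by move=> s /= /negP; rewrite negbK => /eqP.
have cvf : {ae nu, forall p, DT p -> gap (n k) xi X Y p @[k --> \oo] --> f p}.
  apply: filterS2 aeT (ae_prod_snd aeS) => -[s w] /= sT Sw [/=].
  rewrite in_itv/= => /andP[ts sT'] _; rewrite /f /=; have /asboolP -> := Sw.
  have sT2 : s < T by rewrite lt_neqAle sT.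
  by rewrite sT2; apply: gc => //; rewrite ts.
have [jf If] := Rfatou (mDT t) ig (fun k p _ => gap_ge0 (n k) xi X Y p) mf
  (fun p _ => f0 p) cvf hI (cvg_half_exp 2).
apply: filterS2 (Rint0_ae (mDT t) jf (fun p _ => f0 p) If) (ae_prod_snd aeS).
move=> [s w] /= h Sw ts; have /andP[ts' sT] := ts.
have : f (s, w) = 0 by apply: h; split=> //=; rewrite in_itv/= ts' ltW.
rewrite /f /=; have /asboolP -> := Sw; rewrite sT /= => e.
apply/eqP; rewrite -subr_eq0; apply/eqP/matrixP => i j; rewrite (ord1 j) [RHS]mxE.
have [_] := pd_coord_le (xi s w - feedback Lambda gamma (Q s w) (X s w) (Y s w)) i pdL.
by rewrite e mulr0 => h0; apply/eqP; rewrite -sqrf_eq0 eq_le h0 sqr_ge0.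
Qed.

End admissible.
End convergence.

End limit.
End penalized.
End control.

(** * The value function and the optimal control *)

Theorem theorem2p5 (R : realType) (disp : measure_display)
    (Omega : measurableType disp) (P : probability Omega R)
    (W : R -> Omega -> R) (T : R) (d : nat)
    (Lambda : 'M[R]_d) (gamma : 'rV[R]_d)
    (rho : R -> Omega -> 'rV[R]_d) (Sigma : R -> Omega -> 'M[R]_d)
    (Qn Mn : nat -> R -> Omega -> 'M[R]_(d + d))
    (Q : R -> Omega -> 'M[R]_(d + d)) :
  0 < T -> (0 < d)%N ->
  is_brownian P W T -> full_filtration P W T ->
  pdmx Lambda -> (forall i, 0 < gamma 0 i) ->
  entrywise (progressive P W T) rho -> entrywise (ess_bounded P T) rho ->
  (forall t w i, 0 <= t <= T -> 0 <= rho t w 0 i) ->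
  entrywise (progressive P W T) Sigma -> entrywise (ess_bounded P T) Sigma ->
  (forall t w, 0 <= t <= T -> psdmx (Sigma t w)) ->
  (forall n : nat, gamma_max gamma <= n%:R ->
     riccati_solution P W T Lambda gamma rho Sigma n (Qn n) (Mn n)) ->
  is_riccati_limit P T Qn Q ->
  forall (t : R) (x y : 'cV[R]_d), 0 <= t < T ->
  [/\ is_value P W T Lambda gamma rho Sigma t x y
        (fun w => value_form gamma (Q t w) x y),
      exists xi X Y,
        [/\ is_optimal P W T Lambda gamma rho Sigma t x y xi,
            is_position P W T t x xi X,
            is_impact P W T gamma rho t y xi Y
          & {ae P, forall w, forall s, t <= s < T ->
               xi s w = feedback Lambda gamma (Q s w) (X s w) (Y s w)}]
    & forall xi X Y,
        is_optimal P W T Lambda gamma rho Sigma t x y xi ->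
        is_position P W T t x xi X ->
        is_impact P W T gamma rho t y xi Y ->
        {ae (@lebesgue_measure R \x P)%E, forall p : R * Omega, t <= p.1 < T ->
           xi p.1 p.2
           = feedback Lambda gamma (Q p.1 p.2) (X p.1 p.2) (Y p.1 p.2)}].
Proof.
move=> T0 d0 hW hF pdL g0 rp rb r0 sp sb spsd hQn hlim t x y /andP[t0 ltT].
have tT := ltW ltT.
have TT : t <= T <= T by rewrite tT lexx.
have [n [vv [xi [X [Y [[n_id gn] n_homo vh [hdyn XT] [hfb hgap]]]]]]] :=
  optimal_limit hW hF T0 pdL g0 rp rb r0 sp sb spsd hQn hlim x y t0 ltT.
have v_le k := (vh k).1; have v_fast k := (vh k).2.
have [hxi hX hY] := hdyn.
pose V w := value_form gamma (Q t w) x y.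
have hce := value_eq_cost hW hF T0 pdL g0 rp rb r0 sp sb hQn hlim t0 ltT n_id gn n_homo
  v_le v_fast hdyn XT hgap.
have adm : admissible P W T t x xi by split=> //; exists X.
have hcost : is_cost P W T Lambda gamma rho Sigma t x y xi V by exists X, Y.
(* two versions of the position of one control agree at time T *)
have liquidated xi1 X0 X1 : is_position P W T t x xi1 X0 -> is_position P W T t x xi1 X1 ->
    {ae P, forall w, X0 T w = 0} -> {ae P, forall w, X1 T w = 0}.
  move=> [_ _ h0] [_ _ h1]; apply: filterS3 h0 h1 => w h0 h1 e.
  apply/matrixP => i j; rewrite (ord1 j) (h1 T TT i).2 -(h0 T TT i).2.
  by rewrite e.
have lower J : costs P W T Lambda gamma rho Sigma t x y J -> {ae P, forall w, V w <= J w}.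
  move=> [xi1 [l1 [X0 pX0 X0T]] [X1 [Y1 [pX1 iY1 ce]]]].
  have d1 : dynamics P W T gamma rho t x y xi1 X1 Y1 by split.
  exact: (value_le_cost hW hF T0 pdL g0 rp rb r0 sp sb hQn hlim t0 ltT n_id gn d1
    (liquidated _ _ _ pX0 pX1 X0T) ce).
have isV : is_value P W T Lambda gamma rho Sigma t x y V.
  split.
  - apply/measurable_EFinP; apply: (Fm_measurable hF tT).
    exact: (value_Fm hF g0 hQn hlim x y t0 ltT n_id gn).
  - by move=> J /lower; apply: filterS => w; rewrite lee_fin.
  - by move=> U _ hU; apply: (hU V); exists xi.
split.
- exact: isV.
- by exists xi, X, Y; split=> //; split=> //; exists V.
move=> xi1 X1 Y1 [[l1 [X0 pX0 X0T]] [J [X2 [Y2 [pX2 iY2 ce]]] isJ]] pX1 iY1.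
have d1 : dynamics P W T gamma rho t x y xi1 X1 Y1 by split.
have d2 : dynamics P W T gamma rho t x y xi1 X2 Y2 by split.
have X2T := liquidated _ _ _ pX0 pX2 X0T.
have JV : {ae P, forall w, V w = J w}.
  have [_ hJ _] := isJ.
  have VJ : {ae P, forall w, V w <= J w}.
    by apply: lower; exists xi1; [split=> //; exists X0|exists X2, Y2].
  have JV : {ae P, forall w, ((J w)%:E <= (V w)%:E)%E} by apply: hJ; exists xi.
  by apply: filterS2 VJ JV => w h1; rewrite lee_fin => h2; apply/eqP; rewrite eq_le h1.
have [iZ iJ _ hJ] := ce; have [_ iV _ _] := hce.
have eZ : \int[P]_w \int[@lebesgue_measure R]_(s in `[t, T])
    running_cost Lambda Sigma xi1 X2 Y2 s w = \int[P]_w V w.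
  transitivity (\int[P]_w J w).
    rewrite /Rintegral -hJ//; exact: (@measurableT _ (filtered P W t)).
  apply: Rint_eq_ae => //; [exact: L1_measurable iJ|exact: L1_measurable iV|].
  by apply: filterS JV => w -> _.
have hopt := optimal_feedback hW hF T0 pdL g0 rp rb r0 sp sb hQn hlim t0 ltT n_id gn n_homo
  v_le v_fast d2 X2T eZ.
apply: filterS2 hopt (ae_prod_snd (state_unique g0 r0 t0 ltT d1 d2)) => p h u tp.
have /andP[tp1 pT] := tp.
have [-> ->] := u p.1 (introT andP (conj tp1 (ltW pT))).
exact: h.
Qed.
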